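(* Let $p=p_n$ satisfy $n>1+p$ for all $n\geq3$ and $\lim_{n\to\infty}p/n=y\in(0,1]$. Let $\mathbf{x}_1,\dots,\mathbf{x}_n$ be i.i.d. $N_p(\boldsymbol\mu,\boldsymbol\Sigma)$, $\bar{\mathbf{x}}=\frac1n\sum_{i=1}^n\mathbf{x}_i$, $\mathbf{A}=\sum_{i=1}^n(\mathbf{x}_i-\bar{\mathbf{x}})(\mathbf{x}_i-\bar{\mathbf{x}})'$, and $$\Lambda_n=\Big(\frac en\Big)^{np/2}|\mathbf{A}|^{n/2}e^{-\operatorname{tr}(\mathbf{A})/2}e^{-n\bar{\mathbf{x}}'\bar{\mathbf{x}}/2}.$$ Assume $H_0:\boldsymbol\mu=\mathbf{0}$ and $\boldsymbol\Sigma=\mathbf{I}_p$. Then $(\log\Lambda_n-\mu_n)/(n\sigma_n)$ converges in distribution to $N(0,1)$ as $n\to\infty$, where $$\mu_n=-\frac14\Big[n(2n-2p-3)\log\Big(1-\frac p{n-1}\Big)+2(n+1)p\Big],\qquad \sigma_n^2=-\frac12\Big(\frac p{n-1}+\log\Big(1-\frac p{n-1}\Big)\Big)>0.$$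
   Context: $|\cdot|$ denotes the determinant; $\Lambda_n$ is the likelihood ratio statistic for testing $\boldsymbol\mu=\mathbf 0,\boldsymbol\Sigma=\mathbf I_p$. *)

(* Defs.v *)
From HB Require Import structures.
From mathcomp Require Import all_boot all_order all_algebra.
From mathcomp Require Import all_classical all_reals all_analysis.
Set Implicit Arguments. Unset Strict Implicit. Unset Printing Implicit Defensive.
Import Order.TTheory GRing.Theory Num.Theory.
Import numFieldNormedType.Exports.
Local Open Scope classical_set_scope.
Local Open Scope ring_scope.

Section defs.
Context {R : realType}.

Definition xbar (n p : nat) (x : 'I_n -> 'I_p -> R) (j : 'I_p) : R :=
  n%:R^-1 * \sum_(i < n) x i j.

Definition Amat (n p : nat) (x : 'I_n -> 'I_p -> R) : 'M[R]_p :=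
  \matrix_(j < p, k < p)
     \sum_(i < n) (x i j - xbar x j) * (x i k - xbar x k).

Definition Lambda (n p : nat) (x : 'I_n -> 'I_p -> R) : R :=
  powR (expR 1 / n%:R) (n%:R * p%:R / 2)
  * powR (\det (Amat x)) (n%:R / 2)
  * expR (- (\tr (Amat x)) / 2)
  * expR (- (n%:R * \sum_(j < p) xbar x j ^+ 2) / 2).

Definition mu_n (n p : nat) : R :=
  - (1/4) * (n%:R * (2 * n%:R - 2 * p%:R - 3) * ln (1 - p%:R / (n%:R - 1))
             + 2 * (n%:R + 1) * p%:R).

Definition sigma2_n (n p : nat) : R :=
  - (1/2) * (p%:R / (n%:R - 1) + ln (1 - p%:R / (n%:R - 1))).

End defs.

Definition mutually_independent {d} {T : measurableType d} {R : realType}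
  (P : probability T R) (I : finType) (X : I -> T -> R) : Prop :=
  forall B : I -> set R, (forall i, measurable (B i)) ->
    P [set t | forall i, B i (X i t)] =
    (\big[*%E/1%E]_(i : I) P (X i @^-1` B i))%E.

Definition std_normal {d} {T : measurableType d} {R : realType}
  (P : probability T R) (X : T -> R) : Prop :=
  forall B : set R, measurable B -> P (X @^-1` B) = normal_prob 0 1 B.

(* Main.v *)
Require Import Defs.
From HB Require Import structures.
From mathcomp Require Import all_boot all_order all_algebra.
From mathcomp Require Import all_classical all_reals all_analysis.
From mathcomp Require Import perm measurable_realfun ring lra zify.
Import Order.TTheory GRing.Theory Num.Theory.
Import numFieldNormedType.Exports.
Local Open Scope classical_set_scope.
Local Open Scope ring_scope.
Set Implicit Arguments. Unset Strict Implicit. Unset Printing Implicit Defensive.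

(* The proof is by moment generating functions.  Let D be the determinant of A
   and Q the sum of all x_ij ^ 2, so that tr A + n |xbar|^2 = Q and, where
   D > 0, Lambda_n ^ t is a constant times D^h e^(-tQ/2) with h = nt/2.

   Gaussian integration by parts, applied to the component of each column of
   the centred data orthogonal to the previous ones (written with cofactors, so
   that no division occurs), shows that Psi(h) = E[D^h e^(-tQ/2)] satisfies
   Psi(h + 1) = Psi(h) prod_{k < p} (n - 1 - k + 2h)/(1 + t).  Together with the
   bounds of Psi(h + a) that follow from tangent-line inequalities for powers,
   this determines log Psi as log-convexity determines the Gamma function
   (Bohr-Mollerup), with an error of order h sum_k (n - 1 - k)^(-2).  Stirling
   asymptotics then give E[e^(s T_n); D > 0] = exp(s^2/2 + O(h/q)) for the
   normalized statistic T_n, with h = s/(2 sigma_n) and q = n - 1 - p; here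
   h/q -> 0, because sigma_n is bounded below and tends to infinity along any
   subsequence on which q stays bounded.

   Only moments with s > 0 are available.  They still imply convergence of the
   tails: the functions f whose integrals converge contain all
   e^(sx) P(sin(vx)) with P a polynomial and v small, and Bernstein polynomials
   approximate with them the ramps that sandwich the indicator of ]a, +oo[.
   Convergence of all tails yields P(D > 0) -> 1, so that the event D = 0 does
   not matter. *)

(** * Derivatives and continuity along a line *)

(** Behind the recursion stands the formula Psi(h) = (1 + t)^(-np/2) (2/(1 + t))^(ph) prod_{k < p}
    Gamma(a_k + h)/Gamma(a_k) with a_k = (n - 1 - k)/2, usually read off from the law of D as a
    product of independent chi-square variables. Neither that law nor the Gamma function occurs
    below: the recursion and two inequalities between moments carry the same information. The weight
    e^(-tQ/2), a part of Lambda_n itself, makes every function of polynomial growth bounded, so that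
    Fubini and dominated convergence need no separate integrability argument. Exponents s < 0 are
    avoided because D^h with h < 0 is unbounded near D = 0, where the weight does not help; for the
    same reason real powers are differentiated at D + e with e > 0, and e tends to 0 afterwards. All
    estimates must be uniform for p up to n - 2. The smallest a_k may then stay near 1, and the
    expansion of the Gamma factors is not accurate by itself: its error carries a factor h, and only
    the growth of sigma_n makes h small in that regime. *)

Section pointwise_derivatives.
Context {R : realType}.
Implicit Types (f g : R -> R) (x df dg c : R).

Lemma dercst c x : is_derive x (1:R) (fun=> c) 0.
Proof. exact: is_derive_cst. Qed.

Lemma derid x : is_derive x (1:R) (fun u => u) 1.
Proof. exact: is_derive_id. Qed.

Lemma derD f g x df dg : is_derive x (1:R) f df -> is_derive x (1:R) g dg ->
  is_derive x (1:R) (fun u => f u + g u) (df + dg).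
Proof. by move=> hf hg; exact: is_deriveD. Qed.

Lemma derN f x df : is_derive x (1:R) f df -> is_derive x (1:R) (fun u => - f u) (- df).
Proof. by move=> hf; exact: is_deriveN. Qed.

Lemma derB f g x df dg : is_derive x (1:R) f df -> is_derive x (1:R) g dg ->
  is_derive x (1:R) (fun u => f u - g u) (df - dg).
Proof. by move=> hf hg; exact: is_deriveB. Qed.

Lemma derM f g x df dg : is_derive x (1:R) f df -> is_derive x (1:R) g dg ->
  is_derive x (1:R) (fun u => f u * g u) (df * g x + f x * dg).
Proof.
move=> hf hg; have h := @is_deriveM _ _ f g x 1 df dg hf hg.
apply: (is_derive_eq h).
by rewrite /GRing.scale/= addrC; congr (_ + _); rewrite mulrC.
Qed.

Lemma dercomp f g x df dg : is_derive x (1:R) f df -> is_derive (f x) (1:R) g dg ->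
  is_derive x (1:R) (fun u => g (f u)) (df * dg).
Proof.
by move=> hf hg; rewrite mulrC; exact: (@is_derive1_comp _ g f x dg df).
Qed.

Lemma dersum (I : eqType) (r : seq I) (f : I -> R -> R) (df : I -> R) x :
  (forall i, is_derive x (1:R) (f i) (df i)) ->
  is_derive x (1:R) (fun u => \sum_(i <- r) f i u) (\sum_(i <- r) df i).
Proof.
move=> hf; elim: r => [|i r IH].
  rewrite big_nil; under eq_fun do rewrite big_nil; exact: dercst.
rewrite big_cons; under eq_fun do rewrite big_cons; exact: derD.
Qed.

Lemma derprod (I : eqType) (r : seq I) (f : I -> R -> R) (df : I -> R) x : uniq r ->
  (forall i, is_derive x (1:R) (f i) (df i)) ->
  is_derive x (1:R) (fun u => \prod_(i <- r) f i u)
    (\sum_(i <- r) df i * \prod_(j <- r | j != i) f j x).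
Proof.
move=> + hf; elim: r => [|i r IH] /=.
  move=> _; rewrite big_nil; under eq_fun do rewrite big_nil; exact: dercst.
move=> /andP[ir ur].
under eq_fun do rewrite big_cons.
apply: is_derive_eq; first exact: derM (hf i) (IH ur).
rewrite !big_cons eqxx/=; congr (_ + _).
  congr (_ * _); rewrite [RHS]big_seq_cond [LHS]big_seq_cond; apply: eq_bigl => j.
  by case: (boolP (j \in r)) => //= jr; case: eqP => // ji; rewrite -ji jr in ir.
rewrite mulr_sumr [LHS]big_seq [RHS]big_seq; apply: eq_bigr => j jr.
rewrite big_cons ifT; last by apply: contraNneq ir => ->.
by rewrite mulrCA.
Qed.

Lemma der_continuous f (df : R -> R) : (forall x, is_derive x (1:R) f (df x)) ->
  continuous f.
Proof.
move=> hf x; apply: differentiable_continuous; apply/derivable1_diffP.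
by case: (hf x).
Qed.

Lemma powR_continuous_gt0 (a x : R) : 0 < x -> {for x, continuous (fun u => u `^ a)}.
Proof.
move=> x0; apply: differentiable_continuous; apply/derivable1_diffP.
by case: (is_derive1_powR a x0).
Qed.

Lemma dercont1 f x df : is_derive x (1:R) f df -> {for x, continuous f}.
Proof.
by move=> hf; apply: differentiable_continuous; apply/derivable1_diffP; case: hf.
Qed.
End pointwise_derivatives.

(** * Resampling one coordinate of an independent family *)

Section cylinder.
Context {R : realType} {I : finType}.

(** Boxes form a pi-system generating the sigma-algebra of [coords], so two probability laws that
    agree on them coincide; they are also the sets whose probability [mutually_independent]
    prescribes. *)
Definition cylinders : set (set (I -> R)) :=
  [set A | exists2 B : I -> set R, (forall i, measurable (B i)) &
     A = [set y | forall i, B i (y i)]].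

Definition coords := g_sigma_algebraType cylinders.

Lemma cylinders_setI : setI_closed cylinders.
Proof.
move=> _ _ [B mB ->] [C mC ->]; exists (fun i => B i `&` C i).
  by move=> i; exact: measurableI.
apply/seteqP; split=> y /=; first by move=> [By Cy] i; split.
by move=> BCy; split=> i; case: (BCy i).
Qed.

Lemma cylinders_setT : cylinders setT.
Proof.
by exists (fun=> setT) => //; apply/seteqP; split.
Qed.

Lemma measurable_cylinder (B : I -> set R) : (forall i, measurable (B i)) ->
  measurable ([set y | forall i, B i (y i)] : set coords).
Proof. by move=> mB; apply: sub_sigma_algebra; exists B. Qed.

Lemma measurable_coord (i : I) : measurable_fun setT (fun y : coords => y i : R).
Proof.
move=> _ A mA; rewrite setTI.
rewrite (_ : _ @^-1` _ = [set y | forall j, (if j == i then A else setT) (y j)]).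
  by apply: (@measurable_cylinder (fun j => if j == i then A else setT)) => j; case: ifP.
apply/seteqP; split=> y /=; first by move=> Ay j; case: eqP => [->|].
by move=> /(_ i); rewrite eqxx.
Qed.

Lemma measurable_into_coords d (T : measurableType d) (f : T -> coords) :
  (forall i, measurable_fun setT (fun t => f t i : R)) -> measurable_fun setT f.
Proof.
move=> mf; apply: (@measurability _ _ T coords setT f cylinders) => //.
move=> _ [_ [B mB ->] <-]; rewrite setTI.
rewrite (_ : _ @^-1` _ = \bigcap_(i in [set` enum I]) ((fun t => f t i : R) @^-1` B i)).
  apply: (@fin_bigcap_measurable _ T I); first exact: finite_seq.
  by move=> i _; rewrite -[X in measurable X]setTI; exact: mf.
apply/seteqP; split=> t /=; first by move=> h i _; exact: h.
by move=> h i; apply: h => /=; rewrite mem_enum.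
Qed.

Definition upd (y : I -> R) (i : I) (x : R) : I -> R :=
  fun j => if j == i then x else y j.

Lemma updE (y : I -> R) i x : upd y i x i = x.
Proof. by rewrite /upd eqxx. Qed.

Lemma upd_id (y : I -> R) i : upd y i (y i) = y.
Proof. by apply/funext => j; rewrite /upd; case: eqP => [->|]. Qed.

Lemma upd_upd (y : I -> R) i x x' : upd (upd y i x) i x' = upd y i x'.
Proof. by apply/funext => j; rewrite /upd; case: eqP. Qed.

End cylinder.

Lemma bounded_integrable d (T : measurableType d) (R : realType)
    (mu : {measure set T -> \bar R}) (f : T -> R) (K : R) :
  (mu setT < +oo)%E -> measurable_fun setT f -> (forall t, `|f t| <= K) ->
  mu.-integrable setT (EFin \o f).
Proof.
move=> fmu mf fK; apply: measurable_bounded_integrable => //.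
exists K; split; first exact: num_real.
by move=> x Kx t _ /=; rewrite (le_trans (fK t))// ltW.
Qed.

Lemma prob_lty d (T : measurableType d) (R : realType) (P : probability T R) :
  (P setT < +oo)%E.
Proof. by rewrite probability_setT ltry. Qed.

Section resample.
Context {R : realType} {I : finType} d (T : measurableType d) (P : probability T R).
Variable X : I -> {RV P >-> R}.
Hypothesis indepX : mutually_independent P (fun i => (X i : T -> R)).
Hypothesis normalX : forall i, std_normal P (X i).

Let gam : probability _ R := normal_prob (0:R) 1.
Definition sample (t : T) : coords := fun i => X i t.

Lemma measurable_sample : measurable_fun setT sample.
Proof. by apply: measurable_into_coords => i; exact: measurable_funPT. Qed.

Lemma measurable_upd_sample (i : I) :
  measurable_fun setT (fun tx : T * R => upd (sample tx.1) i tx.2 : coords).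
Proof.
apply: measurable_into_coords => j; rewrite /upd; case: eqP => _.
  exact: measurable_snd.
exact: (measurableT_comp (measurable_funPT (X j)) measurable_fst).
Qed.

(** Both sides are laws on [coords], so boxes suffice. On a box, independence gives a product over
    the coordinates, and an independent standard normal draw at [i] leaves the factor of [i]
    unchanged. *)
Lemma resample_law (i : I) (A : set coords) : measurable A ->
  P (sample @^-1` A) = (P \x gam)%E ((fun tx => upd (sample tx.1) i tx.2) @^-1` A).
Proof.
move=> mA; pose f (tx : T * R) : coords := upd (sample tx.1) i tx.2.
have key := @measure_unique _ R coords cylinders (fun=> setT) erefl cylinders_setI
  (fun=> cylinders_setT) _
  (pushforward P sample) (pushforward (P \x gam)%E f).
apply: key => //; [|exact: measurable_sample|exact: measurable_upd_sample| |].
- by apply/seteqP; split=> // y _; exists 0%N.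
- move=> ms mf _ [B mB ->].
  change (P (sample @^-1` [set y | forall i, B i (y i)]) =
    (P \x gam)%E (f @^-1` [set y | forall i, B i (y i)])).
  (* With the whole line in place of [B i], the box [B'] constrains only the other coordinates, and
     [indepX] computes its probability too. *)
  pose B' j := if j == i then setT else B j.
  have mB' j : measurable (B' j) by rewrite /B'; case: ifP.
  have -> : f @^-1` [set y | forall i, B i (y i)] = [set t | forall j, B' j (X j t)] `*` B i.
    apply/seteqP; split=> -[t x] /=.
      move=> h; split; last by have := h i; rewrite /f /upd /= eqxx.
      by move=> j; have := h j; rewrite /B' /f /upd /=; case: eqP.
    move=> [h1 h2] j; have := h1 j; rewrite /B' /f /upd /=; case: eqP => [->|//] _.
    exact: h2.
  have mS : measurable [set t | forall j, B' j (X j t)].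
    have := ms measurableT _ (measurable_cylinder mB').
    by rewrite setTI.
  rewrite product_measure1E//; last exact: mB.
  transitivity (\big[*%E/1%E]_(i : I) P (X i @^-1` B i))%E; first exact: indepX.
  transitivity (\big[*%E/1%E]_(i : I) P (X i @^-1` B' i) * gam (B i))%E; last first.
    by congr (_ * _)%E; rewrite -indepX.
  rewrite (bigD1 i)//= [in RHS](bigD1 i)//= {1}/B' eqxx.
  rewrite preimage_setT probability_setT mul1e muleC; congr (_ * _)%E.
    by apply: eq_bigr => j /negbTE ji; rewrite /B' ji.
  exact: normalX.
- by move=> ms0 _; exact: prob_lty.
Qed.

Definition expect (F : coords -> R) : R := \int[P]_t F (sample t).

(** Fubini isolates a one-dimensional Gaussian integral in coordinate [i], the others being frozen;
    the bound [K] supplies all integrability. *)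
Lemma expect_resample (i : I) (F : coords -> R) (K : R) :
  measurable_fun setT F -> (forall y, `|F y| <= K) ->
  expect F = \int[P]_t (\int[gam]_x F (upd (sample t) i x)).
Proof.
move=> mF FK; rewrite /expect /Rintegral; congr fine.
pose EF (y : coords) : \bar R := (F y)%:E.
have mEF : measurable_fun (setT : set coords) (EF : coords -> \bar R) by exact/measurable_EFinP.
pose f (tx : T * R) : coords := upd (sample tx.1) i tx.2.
have mf : measurable_fun setT f by exact: measurable_upd_sample.
have ms := measurable_sample.
have iF : (P \x gam)%E.-integrable setT (EF \o f).
  have fin : ((P \x gam) (setT `*` setT) < +oo)%E.
    by rewrite product_measure1E// [X in (X * _)%E]probability_setT
      [X in (_ * X)%E]probability_setT mul1e ltry.
  apply: (@bounded_integrable _ _ R (P \x gam)%E (F \o f) K).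
  - by move: fin; rewrite setXTT.
  - exact: measurableT_comp.
  - by move=> t; exact: FK.
have iF1 : P.-integrable setT (EF \o sample).
  apply: (@bounded_integrable _ _ _ _ (F \o sample) K).
  - exact: prob_lty.
  - exact: measurableT_comp.
  - by move=> t; exact: FK.
transitivity (\int[pushforward P sample]_y EF y)%E.
  by rewrite integral_pushforward// preimage_setT.
transitivity (\int[pushforward (P \x gam)%E f]_y EF y)%E.
  by apply: eq_measure_integral => A mA _; exact: resample_law.
rewrite integral_pushforward// preimage_setT.
rewrite -integral12_prod_meas1//; apply: eq_integral => t _.
rewrite /fubini_F fineK//; apply: (@integrable_fin_num _ _ R gam setT) => //.
apply: (@bounded_integrable _ _ R gam (fun x => F (f (t, x))) K).
- exact: prob_lty.
- apply: measurableT_comp => //; apply: measurable_into_coords => j.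
  by rewrite /f /upd /=; case: eqP.
- by move=> x; exact: FK.
Qed.
End resample.

(** * Standard Gaussian integrals *)

Section gaussian.
Context {R : realType}.
Local Notation mu := (@lebesgue_measure R).
Implicit Types (m s x t : R) (f : R -> R).

(** The abstract derivative and the explicit density have the same integral over every measurable
    set. This is what turns integrals against [normal_prob] into Lebesgue integrals. *)
Lemma ae_eq_Radon_Nikodym_normal m s :
  ae_eq mu setT (Radon_Nikodym_SigmaFinite.f (normal_prob m s) mu)
    (fun x => (normal_pdf m s x)%:E).
Proof.
have dom := @normal_prob_dominates R m s.
apply: integral_ae_eq => //.
- exact: Radon_Nikodym_SigmaFinite.f_integrable.
- by apply/measurable_EFinP; exact: measurable_normal_pdf.
- by move=> A _ mA; rewrite -Radon_Nikodym_SigmaFinite.f_integral.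
Qed.

Lemma ge0_integral_normal_prob m s (f : R -> \bar R) :
  measurable_fun setT f -> (forall x, (0 <= f x)%E) ->
  (\int[normal_prob m s]_x f x = \int[mu]_x (f x * (normal_pdf m s x)%:E))%E.
Proof.
move=> mf f0; have dom := @normal_prob_dominates R m s.
rewrite -(Radon_Nikodym_SigmaFinite.change_of_variables dom)//.
apply: ae_eq_integral => //.
- apply: emeasurable_funM => //; apply: (measurable_int mu).
  exact: Radon_Nikodym_SigmaFinite.f_integrable.
- apply: emeasurable_funM => //.
  by apply/measurable_EFinP; exact: measurable_normal_pdf.
- by apply: ae_eqe_mul2l; exact: ae_eq_Radon_Nikodym_normal.
Qed.

Lemma normal_pdf01E x :
  normal_pdf 0 1 x = (Num.sqrt (pi *+ 2))^-1 * expR (- x ^+ 2 / 2) :> R.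
Proof.
rewrite normal_pdfE ?oner_neq0// /normal_peak /normal_fun.
by rewrite expr1n mul1r subr0.
Qed.

(** Completing the square: e^(tx) times the standard density is e^(t^2/2) times the normal density
    of mean t. *)
Lemma mgf_normal_prob t :
  (\int[normal_prob 0 1]_x (expR (t * x))%:E = (expR (t ^+ 2 / 2))%:E)%E.
Proof.
rewrite ge0_integral_normal_prob; last 2 first.
  by apply/measurable_EFinP; apply: measurableT_comp => //; exact: mulrl_measurable.
  by move=> x; rewrite lee_fin expR_ge0.
transitivity (\int[mu]_x ((expR (t ^+ 2 / 2))%:E * (normal_pdf t 1 x)%:E))%E.
  apply: eq_integral => x _; rewrite -!EFinM; congr (_%:E).
  rewrite normal_pdf01E normal_pdfE ?oner_neq0// /normal_peak /normal_fun.
  rewrite expr1n mul1r mulrCA [RHS]mulrCA; congr (_ * _).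
  by rewrite -!expRD; congr expR; field.
rewrite integralZl//; last exact: integrable_normal_pdf.
by rewrite integral_normal_pdf mule1.
Qed.

(** The integrand times the standard density is [s] times the centred normal density of standard
    deviation [s]. *)
Lemma integral_gauss_weight t : 0 < t ->
  \int[normal_prob 0 1]_x (expR (- (t / 2) * x ^+ 2)) = (Num.sqrt (1 + t))^-1 :> R.
Proof.
move=> t0; have t1 : 0 < 1 + t by rewrite addr_gt0.
have s0 : Num.sqrt (1 + t) != 0 by rewrite gt_eqF// sqrtr_gt0.
set s := (Num.sqrt (1 + t))^-1.
rewrite /Rintegral ge0_integral_normal_prob; last 2 first.
  apply/measurable_EFinP; apply: measurableT_comp => //.
  by apply: measurable_funM => //; exact: exprn_measurable.
  by move=> x; rewrite lee_fin expR_ge0.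
transitivity (fine (\int[mu]_x (s%:E * (normal_pdf 0 s x)%:E))%E).
  congr fine; apply: eq_integral => x _; rewrite -!EFinM; congr (_%:E).
  have s2 : s ^+ 2 = (1 + t)^-1 by rewrite exprVn sqr_sqrtr// ltW.
  rewrite normal_pdf01E normal_pdfE ?invr_eq0// /normal_peak /normal_fun.
  rewrite mulrCA -expRD [RHS]mulrA; congr (_ * _).
    rewrite -mulrnAr s2 sqrtrM ?invr_ge0 ?ltW// sqrtrV ?ltW// -/s invfM mulrA.
    by rewrite divff ?mul1r// invr_eq0.
  congr expR; rewrite s2 subr0; field.
  by rewrite gt_eqF.
rewrite integralZl//; last exact: integrable_normal_pdf.
by rewrite integral_normal_pdf mule1.
Qed.

Lemma Rintegral_normal_prob f (K : R) : measurable_fun setT f ->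
  (forall x, `|f x| <= K) ->
  \int[normal_prob 0 1]_x f x = \int[mu]_x (f x * normal_pdf 0 1 x).
Proof.
move=> mf fK.
have Kpdf : mu.-integrable setT (fun x => (K * normal_pdf 0 1 x)%:E).
  under eq_fun do rewrite EFinM.
  by apply: integrableZl => //; exact: integrable_normal_pdf.
have ifp : mu.-integrable setT (fun x => (f x * normal_pdf 0 1 x)%:E).
  apply: le_integrable Kpdf => //.
    by apply/measurable_EFinP; apply: measurable_funM => //; exact: measurable_normal_pdf.
  move=> x _ /=; rewrite lee_fin !normrM ler_wpM2r//.
  by rewrite (le_trans (fK x))// ler_norm.
have iK0 : mu.-integrable setT (fun x => (normal_pdf (0:R) 1 x)%:E).
  exact: integrable_normal_pdf.
have igf : (normal_prob (0:R) 1).-integrable setT (EFin \o f).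
  have h := prob_lty (normal_prob (0:R) 1).
  have h2 := @bounded_integrable _ _ R (normal_prob (0:R) 1) f K h mf fK.
  exact: h2.
have igK : (normal_prob (0:R) 1).-integrable setT (EFin \o cst K).
  exact: finite_measure_integrable_cst.
(* Adding the constant [K] makes the integrand nonnegative, the case already available. *)
apply: (@addIr _ K).
transitivity (\int[normal_prob 0 1]_x (f x + K)).
  rewrite RintegralD// Rintegral_cst//.
  rewrite [X in _ * fine X](_ : _ = 1%E) ?mulr1//; exact: integral_normal_pdf.
rewrite {1}/Rintegral ge0_integral_normal_prob; last 2 first.
  by apply/measurable_EFinP; exact: measurable_funD.
  by move=> x; rewrite lee_fin -lerBlDr sub0r; have := fK x; rewrite ler_norml => /andP[].
transitivity (\int[mu]_x (f x * normal_pdf 0 1 x + K * normal_pdf 0 1 x)).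
  by congr fine; apply: eq_integral => x _; rewrite -EFinM mulrDl.
rewrite RintegralD// RintegralZl//; congr (_ + _).
by rewrite /Rintegral integral_normal_pdf/= mulr1.
Qed.

(** Since phi' = - x phi, the function (f' - x f) phi is the derivative of f phi. Its integral over
    a growing symmetric interval is a boundary term that tends to 0, while 2K phi dominates the
    integrand. *)
Lemma stein1 f f' (K : R) :
  (forall x, is_derive x 1 f (f' x)) -> continuous f' ->
  (forall x, `|f x| <= K) -> (forall x, `|x * f x| <= K) -> (forall x, `|f' x| <= K) ->
  \int[normal_prob 0 1]_x (x * f x) = \int[normal_prob 0 1]_x (f' x).
Proof.
move=> df cf' fK xfK f'K.
have K0 : 0 <= K by rewrite (le_trans _ (fK 0)).
have cf : continuous f.
  by move=> x; apply: differentiable_continuous; apply/derivable1_diffP; case: (df x).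
have mf' : measurable_fun setT f' by exact: continuous_measurable_fun.
have mf : measurable_fun setT f by exact: continuous_measurable_fun.
have mxf : measurable_fun setT (fun x => x * f x) by exact: measurable_funM.
pose phi : R -> R := normal_pdf 0 1.
pose g x := (f' x - x * f x) * phi x.
pose G x := f x * phi x.
have dphi x : is_derive x (1:R) phi (- x * phi x).
  have -> : phi = fun x => (Num.sqrt (pi *+ 2))^-1 * expR (- x ^+ 2 / 2).
    by apply/funext => u; exact: normal_pdf01E.
  have h : is_derive x (1:R) (fun u => - u ^+ 2 / 2) (- x).
    have := derM (derN (derM (derid x) (derid x))) (dercst 2^-1 x).
    by move=> /is_derive_eq; apply; field.
  have := derM (dercst (Num.sqrt (pi *+ 2))^-1 x) (dercomp h (is_derive_expR _)).
  by move=> /is_derive_eq; apply; ring.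
have dG x : is_derive x (1:R) G (g x).
  by have := derM (df x) (dphi x) => /is_derive_eq; apply; rewrite /g; ring.
have cphi : continuous phi by apply: continuous_normal_pdf; rewrite oner_neq0.
have cg : continuous g.
  move=> x; apply: cvgM; last exact: cphi.
  by apply: cvgB; [exact: cf'|apply: cvgM; [exact: cvg_id|exact: cf]].
have gK x : `|f' x - x * f x| <= K + K.
  by rewrite (le_trans (ler_normB _ _))// lerD.
have phi0 x : 0 <= phi x by exact: normal_pdf_ge0.
have iphi : mu.-integrable setT (EFin \o (fun x => (K + K) * phi x)).
  rewrite /comp; under eq_fun do rewrite EFinM.
  by apply: integrableZl => //; exact: integrable_normal_pdf.
have mg : measurable_fun setT g by exact: continuous_measurable_fun.
have gphi x : `|g x| <= (K + K) * phi x.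
  by rewrite normrM (ger0_norm (phi0 x)) ler_wpM2r.
pose Im n : set R := `[- n.+1%:R, n.+1%:R]%classic.
have FTC n : (\int[mu]_(x in Im n) (g x)%:E)%E = ((G n.+1%:R)%:E - (G (- n.+1%:R))%:E)%E.
  apply: continuous_FTC2.
  - by rewrite gtrN// ltr0n.
  - exact: continuous_subspaceT.
  - have cG : continuous G by exact: der_continuous dG.
    split; [by move=> x _; case: (dG x)|..].
    + exact/cvg_at_right_filter/cG.
    + exact/cvg_at_left_filter/cG.
  - by move=> x _; rewrite derive1E; case: (dG x).
have lim0 : (\int[mu]_(x in Im n) (g x)%:E)%E @[n --> \oo] --> 0%E.
  under eq_fun do rewrite FTC -EFinB.
  apply: cvg_EFin; first by near=> n.
  rewrite /comp /=; apply/cvgr0Pnorm_le => e e0; near=> n.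
  have n0 : 0 < n.+1%:R :> R by rewrite ltr0n.
  (* Boundedness of x f(x) gives the boundary terms a decay of order 1/|x|; the density enters only
     through its maximum. *)
  have Gb x : x != 0 -> `|G x| <= K / `|x| * normal_peak 1.
    move=> x0; rewrite normrM ler_pM ?normr_ge0//.
      by rewrite ler_pdivlMr ?normr_gt0// mulrC -normrM.
    by rewrite (ger0_norm (phi0 x)) normal_pdf_ub// oner_neq0.
  rewrite (le_trans (ler_normB _ _))//.
  rewrite (le_trans (lerD (Gb _ _) (Gb _ _))) ?oppr_eq0 ?gt_eqF//.
  rewrite normrN gtr0_norm// -mulrDl -mulrDl mulrAC ler_pdivrMr// -ler_pdivrMl//.
  rewrite mulrC.
  near: n; apply: filterS (nbhs_infty_ger ((K + K) * normal_peak 1 / e)) => n /= h.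
  by rewrite (le_trans h)// ler_nat.
have limg : (\int[mu]_(x in Im n) (g x)%:E)%E @[n --> \oo] --> (\int[mu]_x (g x)%:E)%E.
  under eq_fun do rewrite integral_mkcond.
  have [] := @dominated_convergence _ _ _ mu setT measurableT
    (fun n => (EFin \o g) \_ (Im n)) (EFin \o g)
    (EFin \o (fun x => (K + K) * phi x)) => //.
  - move=> n; have mI : measurable (Im n) by exact: measurable_itv.
    have [h _] := measurable_restrictT (EFin \o g) mI.
    by apply: h; apply: measurable_funTS; exact/measurable_EFinP.
  - exact/measurable_EFinP.
  - apply: aeW => x _; apply: cvg_near_cst; near=> n.
    rewrite patchE ifT//; apply/mem_set; rewrite /Im /= in_itv/= -ler_norml.
    near: n; apply: filterS (nbhs_infty_ger `|x|) => n /= h.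
    by rewrite (le_trans h)// ler_nat.
  - apply: aeW => x n _ /=; rewrite patchE; case: ifP => _ /=.
      by rewrite lee_fin.
    by rewrite normr0 lee_fin mulr_ge0// addr_ge0.
have g0 : (\int[mu]_x (g x)%:E = 0)%E.
  exact: cvg_unique limg lim0.
apply/esym/eqP; rewrite -subr_eq0; apply/eqP.
have ibd (h : R -> R) : measurable_fun setT h -> (forall x, `|h x| <= K) ->
    (normal_prob (0:R) 1).-integrable setT (EFin \o h).
  move=> mh hK; have l := prob_lty (normal_prob (0:R) 1).
  have r := @bounded_integrable _ _ R (normal_prob (0:R) 1) h K l mh hK.
  exact: r.
rewrite -RintegralB//; [|exact: ibd|exact: ibd].
rewrite (@Rintegral_normal_prob _ (K + K))//; last exact: measurable_funB.
by rewrite /Rintegral g0.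
Unshelve. all: by end_near. Qed.
End gaussian.

(** * Functions of polynomial growth against a Gaussian weight *)

Section tame.
Context {R : realType} {I : finType}.
Implicit Types (F G : @coords R I -> R) (y : I -> R).

Definition sumsq y : R := \sum_i y i ^+ 2.

Lemma sumsq_ge0 y : 0 <= sumsq y.
Proof. by apply: sumr_ge0 => i _; exact: sqr_ge0. Qed.

Definition weight (tau : R) y : R := expR (- (tau / 2) * sumsq y).

Lemma weight_gt0 tau y : 0 < weight tau y.
Proof. exact: expR_gt0. Qed.

Definition poly_bounded F :=
  exists C, exists m : nat, forall y, `|F y| <= C * (1 + sumsq y) ^+ m.

(** The class of functions used in integration by parts: it is stable under sums and products, and
    its growth is absorbed by [weight]. The base 1 + [sumsq] in the growth bound is at least 1, so
    exponents may be raised when bounds are combined. *)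
Record tame F : Prop := Tame {
  tame_meas : measurable_fun setT F ;
  tame_cont : forall y i, continuous (fun x => F (upd y i x)) ;
  tame_poly : poly_bounded F }.

Definition bounded_meas F :=
  measurable_fun setT F /\ exists K, forall y, `|F y| <= K.

Let S_ge1 y : 1 <= 1 + sumsq y. Proof. by rewrite lerDl sumsq_ge0. Qed.
Let S_ge0 y : 0 <= 1 + sumsq y. Proof. by rewrite (le_trans ler01). Qed.
Hint Resolve S_ge1 S_ge0 : core.

Lemma poly_bounded_pos F : poly_bounded F ->
  exists2 C, 0 <= C & exists m : nat, forall y, `|F y| <= C * (1 + sumsq y) ^+ m.
Proof.
move=> [C [m FC]]; exists `|C| => //; exists m => y.
by rewrite (le_trans (FC y))// ler_wpM2r ?exprn_ge0// ler_norm.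
Qed.

Lemma tame_cst c : tame (fun=> c).
Proof.
split; first exact: measurable_cst.
  by move=> y i; exact: cst_continuous.
by exists `|c|, 0%N => y; rewrite expr0 mulr1.
Qed.

Lemma tame_coord j : tame (fun y => y j).
Proof.
split; first exact: measurable_coord.
  move=> y i; rewrite /upd; case: eqP => _; last exact: cst_continuous.
  by move=> x; exact: cvg_id.
exists 1, 1%N => y; rewrite mul1r expr1.
have h : y j ^+ 2 <= sumsq y.
  by rewrite /sumsq (bigD1 j)//= lerDl sumr_ge0// => k _; exact: sqr_ge0.
rewrite (@le_trans _ _ (1 + y j ^+ 2))// ?lerD2l//.
rewrite -(real_normK (num_real (y j))); have := sqr_ge0 (`|y j| - 1 / 2); nra.
Qed.

Lemma tameD F G : tame F -> tame G -> tame (fun y => F y + G y).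
Proof.
move=> [mF cF /poly_bounded_pos[C C0 [m FC]]] [mG cG /poly_bounded_pos[C' C'0 [m' GC']]].
split; first exact: measurable_funD.
  by move=> y i x; apply: cvgD; [exact: cF|exact: cG].
exists (C + C'), (m + m')%N => y; rewrite (le_trans (ler_normD _ _))// mulrDl lerD//.
  by rewrite (le_trans (FC y))// ler_wpM2l// ler_weXn2l// leq_addr.
by rewrite (le_trans (GC' y))// ler_wpM2l// ler_weXn2l// leq_addl.
Qed.

Lemma tameM F G : tame F -> tame G -> tame (fun y => F y * G y).
Proof.
move=> [mF cF /poly_bounded_pos[C C0 [m FC]]] [mG cG /poly_bounded_pos[C' C'0 [m' GC']]].
split; first exact: measurable_funM.
  by move=> y i x; apply: cvgM; [exact: cF|exact: cG].
exists (C * C'), (m + m')%N => y; rewrite normrM exprD mulrACA.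
by rewrite ler_pM.
Qed.

Lemma tameN F : tame F -> tame (fun y => - F y).
Proof.
move=> hF; rewrite (_ : (fun _ => _) = fun y => (-1) * F y).
  by apply: tameM => //; exact: tame_cst.
by apply/funext => y; rewrite mulN1r.
Qed.

Lemma tameB F G : tame F -> tame G -> tame (fun y => F y - G y).
Proof. by move=> hF hG; apply: tameD => //; exact: tameN. Qed.

Lemma tame_sum (J : eqType) (r : seq J) (F : J -> @coords R I -> R) :
  (forall j, tame (F j)) -> tame (fun y => \sum_(j <- r) F j y).
Proof.
move=> hF; elim: r => [|j r IH].
  by under eq_fun do rewrite big_nil; exact: tame_cst.
by under eq_fun do rewrite big_cons; exact: tameD.
Qed.

Lemma tame_prod (J : eqType) (r : seq J) (F : J -> @coords R I -> R) :
  (forall j, tame (F j)) -> tame (fun y => \prod_(j <- r) F j y).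
Proof.
move=> hF; elim: r => [|j r IH].
  by under eq_fun do rewrite big_nil; exact: tame_cst.
by under eq_fun do rewrite big_cons; exact: tameM.
Qed.

Lemma tameX F n : tame F -> tame (fun y => F y ^+ n).
Proof.
move=> hF; elim: n => [|n IH]; first exact: tame_cst.
by under eq_fun do rewrite exprS; exact: tameM.
Qed.

(** Negative h is included: for x below 1 the power is at most 1 if h is nonnegative, and at most
    its value at [e] otherwise. *)
Lemma powR_le_poly (e h x : R) (n : nat) : 0 < e -> e <= x -> h <= n%:R ->
  x `^ h <= (1 + e `^ h) * (1 + x) ^+ n.
Proof.
move=> e0 ex hn; have x0 : 0 < x by exact: lt_le_trans ex.
have eh0 : 0 <= e `^ h by exact: powR_ge0.
have p1 : 1 <= (1 + x) ^+ n by rewrite exprn_ege1// lerDl ltW.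
have [x1|x1] := leP 1 x.
  have : x `^ h <= (1 + x) ^+ n.
    rewrite (le_trans (ler_powR x1 hn))// powR_mulrn; last exact: ltW.
    by apply: lerXn2r; rewrite ?nnegrE ?addr_ge0 ?ltW// ltrDr.
  move/le_trans; apply; rewrite ler_peMl// ?(le_trans ler01)//.
  by rewrite lerDl.
have [h0|h0] := leP 0 h.
  have : x `^ h <= 1 `^ h by rewrite ge0_ler_powR// ?nnegrE ltW.
  rewrite powR1.
  move/le_trans; apply; rewrite -[leLHS]mulr1 ler_pM// lerDl//.
have : x `^ h <= e `^ h.
  have [g g0 ->] : exists2 g, 0 <= g & h = - g.
    by exists (- h); rewrite ?opprK// oppr_ge0 ltW.
  rewrite !powRN lef_pV2 ?posrE ?powR_gt0//.
  by rewrite ge0_ler_powR// ?nnegrE ltW.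
move/le_trans; apply; rewrite -[leLHS]mulr1 ler_pM// lerDr//.
Qed.

(** Keeping the base at least [e] makes every real power, also one of negative exponent, continuous
    and of polynomial growth. *)
Lemma tame_powR F (e h : R) : 0 < e -> (forall y, 0 <= F y) -> tame F ->
  tame (fun y => (F y + e) `^ h).
Proof.
move=> e0 F0 hF.
have Fe y : e <= F y + e by rewrite lerDr.
have Fe0 y : 0 < F y + e by rewrite (lt_le_trans e0).
have [n hn] : exists n : nat, h <= n%:R.
  by exists (Num.bound `|h|); rewrite (le_trans (ler_norm _))//; apply: ltW; exact: archi_boundP.
have hFe : tame (fun y => F y + e) by apply: tameD => //; exact: tame_cst.
have [_ _ /poly_bounded_pos[C C0 [m b]]] :
    tame (fun y => (1 + e `^ h) * (1 + (F y + e)) ^+ n).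
  apply: tameM; first exact: tame_cst.
  by apply: tameX; apply: tameD; first exact: tame_cst.
split.
- apply: (measurableT_comp (measurable_powR h)); exact: tame_meas hFe.
- move=> y i x.
  apply: (@continuous_comp _ _ _ (fun x => F (upd y i x) + e) (fun u => u `^ h) x); first exact: (tame_cont hFe).
  exact: powR_continuous_gt0.
- exists C, m => y; apply: le_trans (b y).
  rewrite ger0_norm ?powR_ge0//; apply: le_trans (ler_norm _).
  exact: powR_le_poly.
Qed.

(** In degree m + 1 the weight is the (m + 1)-st power of e^(-cS), where S is [sumsq y], and 1 + S
    <= (1 + 1/c)(1 + cS) <= (1 + 1/c) e^(cS). *)
Lemma poly_weight_bounded (tau : R) (m : nat) : 0 < tau ->
  exists2 K, 0 <= K & forall y, (1 + sumsq y) ^+ m * weight tau y <= K.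
Proof.
move=> tau0; case: m => [|m].
  exists 1 => // y; rewrite expr0 mul1r /weight -[leRHS]expR0 ler_expR mulNr oppr_le0.
  by rewrite mulr_ge0 ?sumsq_ge0// divr_ge0// ltW.
pose c := tau / 2 / m.+1%:R.
have c0 : 0 < c by rewrite !divr_gt0.
pose M := 1 + c^-1.
have M0 : 0 <= M by rewrite addr_ge0// invr_ge0 ltW.
exists (M ^+ m.+1) => [|y]; first exact: exprn_ge0.
rewrite /weight (_ : expR _ = expR (- (c * sumsq y)) ^+ m.+1); last first.
  by rewrite -expRM_natl; congr expR; rewrite /c; field.
rewrite -exprMn; apply: lerXn2r; rewrite ?nnegrE ?mulr_ge0 ?expR_ge0//.
rewrite expRN ler_pdivrMr ?expR_gt0//.
apply: (@le_trans _ _ (M * (1 + c * sumsq y))); last first.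
  by rewrite ler_wpM2l// expR_ge1Dx.
have s0 := sumsq_ge0 y.
rewrite /M mulrDl mul1r mulrDr mulr1 mulrA mulVf ?gt_eqF// mul1r.
have : 0 <= c * sumsq y by rewrite mulr_ge0// ltW.
have : 0 <= c^-1 by rewrite invr_ge0 ltW.
by move=> *; lra.
Qed.

Lemma weight_upd tau y i x :
  weight tau (upd y i x) = expR (- (tau / 2) * (x ^+ 2 + \sum_(j | j != i) y j ^+ 2)).
Proof.
rewrite /weight /sumsq (bigD1 i)//= updE; congr (expR (_ * (_ + _))).
by apply: eq_bigr => j /negbTE ji; rewrite /upd ji.
Qed.

Lemma measurable_weight tau : measurable_fun setT (weight tau : coords -> R).
Proof.
rewrite /weight; apply: (measurableT_comp (@measurable_expR R)); apply: measurable_funM => //.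
by apply: (tame_meas (tame_sum _ _)) => j; apply: tameX; exact: tame_coord.
Qed.

Lemma tame_weight_bounded tau F : 0 < tau -> tame F ->
  bounded_meas (fun y => F y * weight tau y).
Proof.
move=> tau0 [mF _ /poly_bounded_pos[C C0 [m FC]]]; split.
  by apply: measurable_funM => //; exact: measurable_weight.
have [K K0 hK] := poly_weight_bounded m tau0.
exists (C * K) => y; rewrite normrM (ger0_norm (ltW (weight_gt0 _ _))).
apply: (@le_trans _ _ (C * ((1 + sumsq y) ^+ m * weight tau y))); last by rewrite ler_wpM2l.
by rewrite mulrA ler_wpM2r// ltW// weight_gt0.
Qed.

End tame.

Section gaussian_family.
Context {R : realType} {I : finType} d (T : measurableType d) (P : probability T R).
Variable X : I -> {RV P >-> R}.
Hypothesis indepX : mutually_independent P (fun i => (X i : T -> R)).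
Hypothesis normalX : forall i, std_normal P (X i).
Implicit Types (F G : @coords R I -> R).
Local Notation E := (expect X).
Local Notation gam := (normal_prob (0 : R) 1).

Lemma bounded_meas_integrable F : bounded_meas F ->
  P.-integrable setT (EFin \o (fun t => F (sample X t))).
Proof.
move=> [mF [K FK]]; apply: (@bounded_integrable _ _ _ _ _ K).
- exact: prob_lty.
- by apply: measurableT_comp => //; exact: measurable_sample.
- by move=> t; exact: FK.
Qed.

Lemma bounded_measD F G : bounded_meas F -> bounded_meas G ->
  bounded_meas (fun y => F y + G y).
Proof.
move=> [mF [K FK]] [mG [L GL]]; split; first exact: measurable_funD.
by exists (K + L) => y; rewrite (le_trans (ler_normD _ _))// lerD.
Qed.

Lemma bounded_measZ c F : bounded_meas F -> bounded_meas (fun y => c * F y).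
Proof.
move=> [mF [K FK]]; split; first exact: measurable_funM.
by exists (`|c| * K) => y; rewrite normrM ler_wpM2l.
Qed.

Lemma expectD F G : bounded_meas F -> bounded_meas G ->
  E (fun y => F y + G y) = E F + E G.
Proof. by move=> hF hG; rewrite /expect RintegralD//; exact: bounded_meas_integrable. Qed.

Lemma expectZ c F : bounded_meas F -> E (fun y => c * F y) = c * E F.
Proof. by move=> hF; rewrite /expect RintegralZl//; exact: bounded_meas_integrable. Qed.

Lemma expectB F G : bounded_meas F -> bounded_meas G ->
  E (fun y => F y - G y) = E F - E G.
Proof. by move=> hF hG; rewrite /expect RintegralB//; exact: bounded_meas_integrable. Qed.

Lemma expect_cst c : E (fun=> c) = c.
Proof. 
by rewrite /expect Rintegral_cst// [X in _ * fine X](_ : _ = 1%E) ?mulr1//; exact: probability_setT. Qed.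

Lemma expect_sum (J : eqType) (r : seq J) (F : J -> @coords R I -> R) :
  (forall j, bounded_meas (F j)) ->
  E (fun y => \sum_(j <- r) F j y) = \sum_(j <- r) E (F j) /\
  bounded_meas (fun y => \sum_(j <- r) F j y).
Proof.
move=> hF; elim: r => [|j r [IH1 IH2]].
  split; last first.
    under eq_fun do rewrite big_nil.
    by split; [exact: measurable_cst|exists 0 => y; rewrite normr0].
  by rewrite big_nil -[RHS](expect_cst 0); congr expect; apply/funext => y; rewrite big_nil.
split; last by under eq_fun do rewrite big_cons; exact: bounded_measD.
rewrite big_cons -IH1 -expectD//; congr expect.
by apply/funext => y; rewrite big_cons.
Qed.

Lemma expect_le F G : bounded_meas F -> bounded_meas G ->
  (forall y, F y <= G y) -> E F <= E G.
Proof.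
move=> hF hG FG; apply: le_Rintegral => //; by [exact: bounded_meas_integrable|move=> t _].
Qed.

(* the Gaussian identity E[X f(X)] = E[f'(X)] for the coordinate i, the weight
   exp(-tau/2 |y|^2) accounting for the factor 1 + tau *)
Lemma stein_weight (tau : R) (i : I) F F' : 0 < tau -> tame F -> tame F' ->
  (forall y : I -> R, is_derive (y i) (1:R) (fun x => F (upd y i x)) (F' y)) ->
  (1 + tau) * E (fun y => y i * F y * weight tau y) = E (fun y => F' y * weight tau y).
Proof.
move=> tau0 hF hF' dF.
have bw (H : @coords R I -> R) : tame H -> bounded_meas (fun y => H y * weight tau y) by exact: tame_weight_bounded.
have hyF : tame (fun y => y i * F y) by apply: tameM => //; exact: tame_coord.
pose G y := F' y * weight tau y - tau * (y i * F y * weight tau y).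
have bG : bounded_meas G.
  rewrite /G; under eq_fun do rewrite -mulNr.
  by apply: bounded_measD; [exact: bw|apply: bounded_measZ; exact: bw].
suff key : E (fun y => y i * F y * weight tau y) = E G.
  rewrite mulrDl mul1r {1}key /G expectB.
  - by rewrite expectZ; [rewrite subrK|exact: bw].
  - exact: bw.
  - by apply: bounded_measZ; exact: bw.
have [mF1 [K1 hK1]] := bw _ hyF; have [mG [K2 hK2]] := bG.
have [_ [K3 hK3]] := bw _ hF.
rewrite (expect_resample indepX normalX i mF1 hK1) (expect_resample indepX normalX i mG hK2).
rewrite /Rintegral; congr fine; apply: eq_integral => t _; congr (_%:E).
set y := sample X t.
pose f x := F (upd y i x) * weight tau (upd y i x).
transitivity (\int[gam]_x (x * f x)).
  by apply: eq_Rintegral => x _; rewrite updE mulrA.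
have dw x : is_derive x (1:R) (fun x => weight tau (upd y i x)) (- (tau * x) * weight tau (upd y i x)).
  under eq_fun do rewrite weight_upd.
  have h := derM (dercst (- (tau / 2)) x) (derD (derM (derid x) (derid x))
    (dercst (\sum_(j | j != i) y j ^+ 2) x)).
  have := dercomp h (is_derive_expR _).
  move=> /is_derive_eq; apply; rewrite weight_upd; congr (_ * _).
  by field.
pose K := Num.max K1 (Num.max K2 K3).
apply: (@stein1 _ f (fun x => G (upd y i x)) K).
- move=> x; have := dF (upd y i x); rewrite updE => h0.
  have {}h0 : is_derive x (1:R) (fun u => F (upd y i u)) (F' (upd y i x)).
    by move: h0; under eq_fun do rewrite upd_upd.
  have := derM h0 (dw x) => /is_derive_eq; apply.
  by rewrite /G updE; ring.
- have cw : continuous (fun x => weight tau (upd y i x)) by exact: der_continuous dw.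
  move=> x; apply: cvgB; first by apply: cvgM; [exact: (tame_cont hF')|exact: cw].
  apply: cvgM; first exact: cvg_cst.
  by apply: cvgM; [exact: (tame_cont hyF)|exact: cw].
- by move=> x; rewrite (le_trans (hK3 _))// /K !le_max lexx !orbT.
- move=> x; have := hK1 (upd y i x); rewrite updE /f mulrA => /le_trans; apply.
  by rewrite /K !le_max lexx.
- by move=> x; rewrite (le_trans (hK2 _))// /K !le_max lexx !orbT.
Qed.

(** Resampling peels off one coordinate of the list [r] at a time; since [r] has no repetition, the
    remaining factors do not see the resampled coordinate. *)
Lemma expect_weight (tau : R) : 0 < tau ->
  E (weight tau) = (Num.sqrt (1 + tau))^-1 ^+ #|I|.
Proof.
move=> tau0.
pose W (r : seq I) y := \prod_(i <- r) expR (- (tau / 2) * y i ^+ 2) : R.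
suff main r : uniq r -> E (W r) = (Num.sqrt (1 + tau))^-1 ^+ size r.
  rewrite cardE -main ?enum_uniq//; congr expect; apply/funext => y.
  rewrite /W /weight /sumsq mulr_sumr expR_sum big_enum.
  by [].
have w1 x : `|expR (- (tau / 2) * x ^+ 2)| <= 1.
  rewrite ger0_norm ?expR_ge0// -[leRHS]expR0 ler_expR mulNr oppr_le0.
  by rewrite mulr_ge0 ?sqr_ge0// divr_ge0// ltW.
have bW s : bounded_meas (W s).
  split.
    apply: measurable_prod => i _; apply: (measurableT_comp (@measurable_expR R)).
    by apply: measurable_funM => //; apply: measurable_funX; exact: measurable_coord.
  exists 1 => y; rewrite /W normr_prod; elim: s => [|i s IH]; first by rewrite big_nil.
  rewrite big_cons -[leRHS]mulr1.
  by apply: ler_pM; [|by apply: prodr_ge0|exact: w1|exact: IH].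
elim: r => [|i r IH] /=.
  move=> _; rewrite expr0 -[RHS](expect_cst 1); congr expect.
  by apply/funext => y; rewrite /W big_nil.
move=> /andP[ir ur]; have [mW [K hK]] := bW (i :: r).
rewrite (expect_resample indepX normalX i mW hK) exprS -IH//.
rewrite -(expectZ (Num.sqrt (1 + tau))^-1 (bW r)).
apply: eq_Rintegral => t _; rewrite -integral_gauss_weight// mulrC.
rewrite -RintegralZl//; last first.
  have l := prob_lty gam.
  have := @bounded_integrable _ _ R gam (fun x => expR (- (tau / 2) * x ^+ 2)) 1 l _ w1.
  apply; apply: (measurableT_comp (@measurable_expR R)).
  by apply: measurable_funM => //; exact: exprn_measurable.
apply: eq_Rintegral => x _; rewrite /W big_cons updE mulrC; congr (_ * _).
rewrite big_seq [RHS]big_seq; apply: eq_bigr => j jr; rewrite /upd.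
by case: eqP => // ji; rewrite -ji jr in ir.
Qed.

End gaussian_family.

(** * Leading minors of a Gram matrix *)

Section bordered_determinant.

(** Right multiplication by [C] clears the upper right block without dividing by [\det B]. The price
    is the factor [\det C], a power of [\det B], which is nonzero and cancels. *)
Lemma det_bordered_domain (R : idomainType) m (B : 'M[R]_m) (u : 'cV[R]_m) (v : 'rV[R]_m)
    (a : 'M[R]_1) : \det B != 0 ->
  \det (block_mx B u v a) = \det B * a 0 0 - (v *m \adj B *m u) 0 0.
Proof.
move=> B0.
pose C : 'M[R]_(m + 1) := block_mx (\det B)%:M (- (\adj B *m u)) 0 (\det B)%:M.
have : \det (block_mx B u v a) * \det C =
    \det (block_mx (\det B *: B) 0 (\det B *: v) (\det B *: a - v *m \adj B *m u)).
  rewrite -det_mulmx mulmx_block !mulmx0 !addr0; congr (\det (block_mx _ _ _ _)).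
  - by rewrite mul_mx_scalar.
  - by rewrite mulmxN mulmxA mul_mx_adj mul_scalar_mx mul_mx_scalar addNr.
  - by rewrite mul_mx_scalar.
  - by rewrite mulmxN mulmxA mul_mx_scalar addrC.
rewrite det_ublock det_lblock !det_scalar detZ (det_mx11 (_ - _)) expr1.
move=> E; apply: (mulfI (expf_neq0 m.+1 B0)); rewrite exprSr [LHS]mulrC E.
by congr (_ * _); rewrite !mxE.
Qed.

Lemma det_bordered (R : idomainType) m (B : 'M[R]_m) (u : 'cV[R]_m) (v : 'rV[R]_m)
    (a : 'M[R]_1) :
  \det (block_mx B u v a) = \det B * a 0 0 - (v *m \adj B *m u) 0 0.
Proof.
(* perturb B into B + X, whose determinant is a nonzero polynomial, then set X = 0 *)
pose BX := char_poly_mx (- B).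
have BX0 : \det BX != 0.
  by apply: monic_neq0; exact: (char_poly_monic (- B)).
have := det_bordered_domain (map_mx polyC u) (map_mx polyC v) (map_mx polyC a) BX0.
have evB : map_mx (horner_eval 0) BX = B.
  apply/matrixP => i j; rewrite !mxE /horner_eval !hornerE.
  by rewrite hornerMn hornerX mul0rn sub0r opprK.
have evC k l (M : 'M[R]_(k, l)) : map_mx (horner_eval 0) (map_mx polyC M) = M.
  by apply/matrixP => i j; rewrite !mxE /horner_eval hornerC.
move=> /(congr1 (horner_eval 0)); rewrite rmorphB rmorphM /= -!det_map_mx map_block_mx.
rewrite evB !evC => ->; congr (_ - _).
  by rewrite mxE /horner_eval hornerC.
have -> : horner_eval 0 ((map_mx polyC v *m \adj BX *m map_mx polyC u) 0 0) =
  (map_mx (horner_eval 0) (map_mx polyC v *m \adj BX *m map_mx polyC u)) 0 0 by rewrite [RHS]mxE.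
by rewrite !map_mxM map_mx_adj evB !evC.
Qed.

End bordered_determinant.

(** Indexing by natural numbers lets leading blocks of all sizes be cut from one array, without
    casts between ordinals. *)
Definition lead {R : Type} (k : nat) (g : nat -> nat -> R) : 'M[R]_k :=
  \matrix_(a < k, b < k) g a b.

Section leading_minors.
Context {R : comUnitRingType}.
Implicit Types (g : nat -> nat -> R) (k : nat).

Lemma adj_lead g k (a c : 'I_k) :
  \sum_(b < k) \adj (lead k g) a b * g b c = (\det (lead k g)) *+ (a == c).
Proof.
have := mul_adj_mx (lead k g) => /matrixP/(_ a c); rewrite !mxE => <-.
by apply: eq_bigr => b _; rewrite [lead k g b c]mxE.
Qed.

Lemma cofactor_lead g k (a c : 'I_k) :
  \sum_(b < k) cofactor (lead k g) a b * g c b = (\det (lead k g)) *+ (a == c).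
Proof.
have := mul_mx_adj (lead k g) => /matrixP/(_ c a); rewrite !mxE eq_sym => <-.
by apply: eq_bigr => b _; rewrite [lead k g c b]mxE [\adj _ _ _]mxE mulrC.
Qed.

Lemma lead_sym g k : (forall a b, g a b = g b a) -> (lead k g)^T = lead k g.
Proof. by move=> sg; apply/matrixP => a b; rewrite !mxE. Qed.

Lemma cofactor_lead_sym g k (a b : 'I_k) : (forall a b, g a b = g b a) ->
  cofactor (lead k g) a b = cofactor (lead k g) b a.
Proof. by move=> sg; rewrite -[RHS]cofactor_tr lead_sym. Qed.

End leading_minors.

(** A Schur complement with the adjugate in place of the inverse, hence valid for singular leading
    blocks. *)
Lemma det_leadS (R : idomainType) (g : nat -> nat -> R) k :
  \det (lead k.+1 g) = \det (lead k g) * g k k -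
    \sum_(a < k) \sum_(b < k) g k a * \adj (lead k g) a b * g b k.
Proof.
have E : lead (k + 1) g =
   block_mx (lead k g) (\col_(b < k) g b k) (\row_(a < k) g k a) (\matrix_(i < 1, j < 1) g k k).
  apply/matrixP => a b; rewrite [LHS]mxE [RHS]mxE.
  by case: splitP => i ->; rewrite mxE; case: splitP => j -> /=;
    rewrite !mxE ?ord1 ?addn0.
rewrite -addn1 E.
rewrite det_bordered mxE; congr (_ - _); rewrite mxE exchange_big/=.
apply: eq_bigr => b _; rewrite !mxE mulr_suml; apply: eq_bigr => a _.
by rewrite !mxE.
Qed.

Section gram.
Context {R : realFieldType} {n : nat}.
Variable v : 'I_n -> nat -> R.

Definition gramf (a b : nat) : R := \sum_i v i a * v i b.

Lemma gramf_sym a b : gramf a b = gramf b a.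
Proof. by apply: eq_bigr => i _; rewrite mulrC. Qed.

Definition gminor k : R := \det (lead k gramf).

(* up to the factor gminor k, the component of column k orthogonal to the previous ones *)
Definition ortho k (i : 'I_n) : R := gminor k * v i k -
  \sum_(a < k) \sum_(b < k) gramf k a * \adj (lead k gramf) a b * v i b.

Lemma sum_ortho (w : 'I_n -> R) k : \sum_i w i * ortho k i =
  gminor k * (\sum_i w i * v i k) -
  \sum_(a < k) \sum_(b < k) gramf k a * \adj (lead k gramf) a b * (\sum_i w i * v i b).
Proof.
rewrite mulr_sumr; under eq_bigr do rewrite mulrBr mulrCA.
rewrite sumrB; congr (_ - _).
under eq_bigr do rewrite mulr_sumr; rewrite exchange_big/=; apply: eq_bigr => a _.
under eq_bigr do rewrite mulr_sumr; rewrite exchange_big/=; apply: eq_bigr => b _.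
by rewrite mulr_sumr; apply: eq_bigr => i _; rewrite mulrCA.
Qed.

(** Only the inner products of [w] with the columns matter. Besides column k of [v] this covers the
    uncentred data column, which is the one that integration by parts produces. *)
Lemma sum_ortho_self (w : 'I_n -> R) k :
  (forall b, \sum_i w i * v i b = gramf k b) ->
  \sum_i w i * ortho k i = gminor k.+1.
Proof.
move=> wv; rewrite sum_ortho wv /gminor det_leadS; congr (_ - _).
by apply: eq_bigr => a _; apply: eq_bigr => b _; rewrite wv (gramf_sym k b).
Qed.

Lemma sum_ortho_v k c : \sum_i v i c * ortho k i = gminor k * gramf k c -
  \sum_(a < k) \sum_(b < k) gramf k a * \adj (lead k gramf) a b * gramf b c.
Proof.
rewrite sum_ortho; congr (_ * _ - _); first by rewrite gramf_sym.
by apply: eq_bigr => a _; apply: eq_bigr => b _; rewrite (gramf_sym b).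
Qed.

(** The adjugate coefficients solve the normal equations of the projection, up to the factor
    [gminor k]. *)
Lemma sum_ortho_lt k c : (c < k)%N -> \sum_i v i c * ortho k i = 0.
Proof.
move=> ck; rewrite sum_ortho_v.
under eq_bigr => a _ do (under eq_bigr do rewrite -mulrA; rewrite -mulr_sumr
  (adj_lead _ a (Ordinal ck))).
rewrite (bigD1 (Ordinal ck))//= eqxx mulr1n big1 => [|a /negbTE ->]; last by rewrite mulr0.
by rewrite addr0 mulrC subrr.
Qed.

(** By orthogonality to the earlier columns, the square of [ortho k] equals [gminor k] times its
    inner product with column k. *)
Lemma sum_ortho_sqr k : \sum_i ortho k i ^+ 2 = gminor k * gminor k.+1.
Proof.
under eq_bigr => i _ do rewrite expr2.
rewrite sum_ortho; under [X in gminor k * X]eq_bigr do rewrite mulrC.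
rewrite (sum_ortho_self (w := fun i => v i k))//.
rewrite [X in _ - X]big1 ?subr0// => a _; rewrite big1// => b _.
by under eq_bigr do rewrite mulrC; rewrite sum_ortho_lt ?mulr0.
Qed.

(** By induction: if [gminor k] is positive, divide it out of [sum_ortho_sqr]; if it is zero,
    [ortho k] vanishes and with it the next minor, which is the inner product of column k with
    [ortho k]. *)
Lemma gminor_ge0 k : 0 <= gminor k.
Proof.
elim: k => [|k IH]; first by rewrite /gminor det_mx00.
have := sum_ortho_sqr k; move: IH; rewrite le_eqVlt => /predU1P[<-|k0].
  rewrite mul0r => /eqP; rewrite psumr_eq0; last by move=> i _; exact: sqr_ge0.
  move=> /allP o0; rewrite -(sum_ortho_self (w := fun i => v i k))// big1// => i _.
  have := o0 i (mem_index_enum i); rewrite /= sqrf_eq0 => /eqP ->.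
  by rewrite mulr0.
move=> h; rewrite -(pmulr_rge0 _ k0) -h.
by apply: sumr_ge0 => i _; exact: sqr_ge0.
Qed.

(** The second factor will be half the gradient of the determinant in column k. Cofactors of row k
    are orthogonal to every other row of the Gram matrix, so only the term [gminor k * v i k] of
    [ortho] contributes. This is why differentiating a power of D along [ortho] gives back the same
    power. *)
Lemma sum_ortho_cofactor p (k : 'I_p) :
  \sum_i ortho k i * (\sum_(b < p) cofactor (lead p gramf) k b * v i b) =
  gminor k * gminor p.
Proof.
transitivity (\sum_(b < p) cofactor (lead p gramf) k b * \sum_i v i b * ortho k i).
  under eq_bigr do rewrite mulr_sumr; rewrite exchange_big; apply: eq_bigr => b _.
  by rewrite mulr_sumr; apply: eq_bigr => i _ /=; rewrite mulrC -mulrA.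
under eq_bigr do rewrite sum_ortho_v mulrBr mulrCA.
rewrite sumrB -mulr_sumr (cofactor_lead _ k k) eqxx mulr1n -/(gminor p).
rewrite [X in _ - X](_ : _ = 0) ?subr0//.
under eq_bigr do rewrite mulr_sumr.
rewrite exchange_big big1//= => a _.
under eq_bigr do rewrite mulr_sumr.
rewrite exchange_big big1//= => c _.
have cp : (c < p)%N by exact: ltn_trans (ltn_ord c) (ltn_ord k).
have := cofactor_lead gramf k (Ordinal cp).
rewrite (_ : (k == Ordinal cp) = false) => [|]; last first.
  by apply/negbTE/eqP => /(congr1 val)/= kc; have := ltn_ord c; rewrite -kc ltnn.
rewrite mulr0n => h.
transitivity (gramf k a * \adj (lead k gramf) a c * 
  \sum_(b < p) cofactor (lead p gramf) k b * gramf c b); last by rewrite h mulr0.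
by rewrite mulr_sumr; apply: eq_bigr => b _; rewrite mulrCA.
Qed.

Lemma sum_adj_gram k : \sum_(a < k) \sum_(b < k) \adj (lead k gramf) a b * gramf a b =
  gminor k *+ k.
Proof.
rewrite (eq_bigr (fun=> gminor k)); first by rewrite sumr_const card_ord.
move=> a _; under eq_bigr do rewrite gramf_sym.
by rewrite (adj_lead _ a a) eqxx mulr1n.
Qed.

End gram.

(** * Derivatives of the Gram determinant and of the orthogonal components *)

Section det_derivative.
Context {R : realType}.

(** Jacobi's formula: differentiate the products of the Leibniz expansion and group the permutations
    by their value at the differentiated row. *)
Lemma derdet m (M : R -> 'M[R]_m) (dM : 'I_m -> 'I_m -> R) (x : R) :
  (forall a b, is_derive x (1:R) (fun u => M u a b) (dM a b)) ->
  is_derive x (1:R) (fun u => \det (M u))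
    (\sum_a \sum_b dM a b * cofactor (M x) a b).
Proof.
move=> hM; rewrite /determinant.
have h := dersum (index_enum ('S_m : finType)) (fun s : 'S_m => derM (dercst ((-1) ^+ s) x)
  (derprod (index_enum_uniq _) (fun a => hM a (s a)))).
have := h => /is_derive_eq; apply.
under eq_bigr do rewrite mul0r add0r mulr_sumr.
rewrite exchange_big/=; apply: eq_bigr => a _.
rewrite (partition_big (fun s : 'S_m => s a) predT)//=; apply: eq_bigr => b _.
rewrite expand_cofactor mulr_sumr; apply: eq_bigr => s /eqP ->.
rewrite mulrCA; congr (_ * (_ * _)).
by apply: eq_bigl => j; rewrite eq_sym.
Qed.

End det_derivative.

Section sample_gram.
Context {R : realType} (n p : nat).
Hypothesis n0 : (0 < n)%N.
Local Notation I := ('I_n * 'I_p)%type.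
Local Notation coords := (@coords R I).
Implicit Types (y : I -> R) (a b : nat).

(** Columns are indexed by natural numbers to match [gramf]; columns from p on get the default value
    0. *)
Definition entry y (i : 'I_n) a : R := if insub a is Some j then y (i, j) else 0.

Definition centered y (i : 'I_n) a : R := entry y i a - n%:R^-1 * \sum_l entry y l a.

Lemma entry_ord y i (j : 'I_p) : entry y i j = y (i, j).
Proof. by rewrite /entry valK. Qed.

Lemma n_neq0 : (n%:R : R) != 0.
Proof. by rewrite pnatr_eq0 -lt0n. Qed.

Lemma sum_centered y a : \sum_i centered y i a = 0.
Proof.
rewrite sumrB sumr_const card_ord -[X in _ - X]mulr_natl mulrA divff ?mul1r ?subrr//.
exact: n_neq0.
Qed.

(** Centring one of the two factors is enough, because centred columns sum to zero. *)
Lemma sum_entry_centered y a b : \sum_i entry y i a * centered y i b =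
  gramf (centered y) a b.
Proof.
rewrite /gramf; under [RHS]eq_bigr => i _ do rewrite {1}/centered mulrBl.
by rewrite sumrB -mulr_sumr sum_centered mulr0 subr0.
Qed.

Lemma Amat_lead y : Amat (fun i j => y (i, j)) = lead p (gramf (centered y)).
Proof.
apply/matrixP => a b; rewrite !mxE; apply: eq_bigr => i _.
rewrite /centered /xbar !entry_ord; congr (_ * _); congr (_ - _ * _);
  by apply: eq_bigr => l _; rewrite entry_ord.
Qed.

Lemma tame_entry i a : tame (fun y : coords => entry y i a).
Proof.
rewrite /entry; case: insub => [j|]; last exact: tame_cst.
exact: tame_coord.
Qed.

Lemma tame_centered i a : tame (fun y : coords => centered y i a).
Proof.
apply: tameB; first exact: tame_entry.
by apply: tameM; [exact: tame_cst|apply: tame_sum => l; exact: tame_entry].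
Qed.

Lemma tame_gramf a b : tame (fun y : coords => gramf (centered y) a b).
Proof. by apply: tame_sum => i; apply: tameM; exact: tame_centered. Qed.

Lemma tame_det m (M : coords -> 'M[R]_m) : (forall a b : 'I_m, tame (fun y => M y a b)) ->
  tame (fun y => \det (M y)).
Proof.
move=> hM; apply: tame_sum => s; apply: tameM; first exact: tame_cst.
by apply: tame_prod => a; exact: hM.
Qed.

Lemma tame_cofactor m (M : coords -> 'M[R]_m) (a b : 'I_m) : (forall a b : 'I_m, tame (fun y => M y a b)) ->
  tame (fun y => cofactor (M y) a b).
Proof.
move=> hM; apply: tameM; first exact: tame_cst.
by apply: tame_det => a' b'; under eq_fun do rewrite !mxE; exact: hM.
Qed.

Lemma tame_lead k (a b : 'I_k) : tame (fun y : coords => lead k (gramf (centered y)) a b).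
Proof. by under eq_fun do rewrite mxE; exact: tame_gramf. Qed.

Lemma tame_gminor k : tame (fun y : coords => gminor (centered y) k).
Proof. by apply: tame_det => a b; exact: tame_lead. Qed.

Lemma tame_adj k (a b : 'I_k) : tame (fun y : coords => \adj (lead k (gramf (centered y))) a b).
Proof.
by under eq_fun do rewrite mxE; apply: tame_cofactor => a' b'; exact: tame_lead.
Qed.

Lemma tame_ortho k i : tame (fun y : coords => ortho (centered y) k i).
Proof.
apply: tameB; first by apply: tameM; [exact: tame_gminor|exact: tame_centered].
apply: tame_sum => a; apply: tame_sum => b; apply: tameM; last exact: tame_centered.
by apply: tameM; [exact: tame_gramf|exact: tame_adj].
Qed.

Section along_coordinate.
Variables (y : I -> R) (i : 'I_n) (k : 'I_p).
Local Notation line f := (fun x : R => f (upd y (i, k) x)).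
Local Notation deriv_line f df := (is_derive (y (i, k)) (1:R) (line f) df).

Lemma der_entry l a :
  deriv_line (fun y => entry y l a) ((l == i) && (a == k :> nat))%:R.
Proof.
rewrite /entry; case: insubP => [j _ <-|]; last first.
  rewrite -leqNgt => pa; have -> : (a == k :> nat) = false.
    by apply/eqP => ak; have := ltn_ord k; rewrite -ak ltnNge pa.
  by rewrite andbF; exact: dercst.
rewrite /upd xpair_eqE val_eqE; case: ((l == i) && (j == k)); [exact: derid|exact: dercst].
Qed.

(** Column i of the centring projection: moving an entry in row i moves all centred entries of the
    same data column. *)
Definition proj1 (l : 'I_n) : R := (l == i)%:R - n%:R^-1.

Lemma der_centered l a :
  deriv_line (fun y => centered y l a) ((a == k :> nat)%:R * proj1 l).
Proof.
have h := derB (der_entry l a) (derM (dercst n%:R^-1 (y (i, k)))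
  (dersum (index_enum ('I_n : finType)) (fun l' => der_entry l' a))).
apply: (is_derive_eq h); rewrite mul0r add0r /proj1.
case: (a == k :> nat); last first.
  by rewrite mul0r andbF big1 => [|l' _]; rewrite ?andbF// mulr0 subrr.
rewrite mul1r andbT; congr (_ - _).
rewrite (bigD1 i)//= eqxx big1 ?addr0 ?mulr1// => l' /negbTE ->.
by [].
Qed.

Lemma sum_proj1_centered b : \sum_l proj1 l * centered y l b = centered y i b.
Proof.
under eq_bigr do rewrite mulrBl; rewrite sumrB -mulr_sumr sum_centered mulr0 subr0.
rewrite (bigD1 i)//= eqxx mul1r big1 ?addr0// => l /negbTE ->.
by rewrite mul0r.
Qed.

Lemma der_gramf a b : deriv_line (fun y => gramf (centered y) a b)
  ((a == k :> nat)%:R * centered y i b + (b == k :> nat)%:R * centered y i a).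
Proof.
have h := dersum (index_enum ('I_n : finType)) (fun l => derM (der_centered l a) (der_centered l b)).
apply: (is_derive_eq h); rewrite upd_id big_split/=; congr (_ + _).
  by rewrite -sum_proj1_centered mulr_sumr; apply: eq_bigr => l _; rewrite mulrA.
by rewrite -sum_proj1_centered mulr_sumr; apply: eq_bigr => l _; rewrite mulrC -mulrA.
Qed.

(** The product rule gives two terms, equal because the Gram matrix and hence its cofactors are
    symmetric; this is the factor 2. *)
Lemma der_gminor : deriv_line (fun y => gminor (centered y) p)
  (2 * \sum_(b < p) cofactor (lead p (gramf (centered y))) k b * centered y i b).
Proof.
pose dM (a b : 'I_p) : R := (a == k)%:R * centered y i b + (b == k)%:R * centered y i a.
have h := @derdet _ p (line (fun y => lead p (gramf (centered y)))) dM (y (i, k)).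
have {}h : deriv_line (fun y => gminor (centered y) p)
    (\sum_(a < p) \sum_(b < p) dM a b *
      cofactor (lead p (gramf (centered (upd y (i, k) (y (i, k)))))) a b).
  apply: h => a b.
  by under eq_fun do rewrite mxE; exact: der_gramf.
apply: (is_derive_eq h); rewrite upd_id /dM.
under eq_bigr => a _ do (under eq_bigr do rewrite mulrDl; rewrite big_split/=).
rewrite big_split/= mulr_natl mulr2n; congr (_ + _).
  rewrite (bigD1 k)//= [X in _ + X]big1 ?addr0 => [|a /negbTE ->].
    by apply: eq_bigr => b _; rewrite eqxx mul1r mulrC.
  by rewrite big1// => b _; rewrite !mul0r.
apply: eq_bigr => a _; rewrite (bigD1 k)//= [X in _ + X]big1 ?addr0 => [|b /negbTE ->].
  rewrite eqxx mul1r mulrC cofactor_lead_sym//; exact: gramf_sym.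
by rewrite !mul0r.
Qed.

Lemma centered_upd l a x : a != k :> nat -> centered (upd y (i, k) x) l a = centered y l a.
Proof.
move=> ak; have e l' : entry (upd y (i, k) x) l' a = entry y l' a.
  rewrite /entry; case: insubP => // j _ ja; rewrite /upd xpair_eqE.
  by case: (eqVneq j k) => [jk|]; rewrite ?andbF//; rewrite -ja jk eqxx in ak.
by rewrite /centered e; congr (_ - _ * _); apply: eq_bigr => l' _; exact: e.
Qed.

Lemma lead_upd x : lead k (gramf (centered (upd y (i, k) x))) = lead k (gramf (centered y)).
Proof.
apply/matrixP => a b; rewrite !mxE; apply: eq_bigr => l _.
by rewrite !centered_upd// neq_ltn ltn_ord.
Qed.

(** The minors and adjugates of size k involve only columns before k, so [ortho] is linear in column
    k and these coefficients are constants for the derivative. *)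
Definition dortho : R := gminor (centered y) k * (1 - n%:R^-1) -
  \sum_(a < k) \sum_(b < k)
    \adj (lead k (gramf (centered y))) a b * (centered y i a * centered y i b).

Lemma der_ortho : deriv_line (fun y => ortho (centered y) k i) dortho.
Proof.
rewrite /ortho /gminor; under eq_fun do rewrite lead_upd.
have c l (a : 'I_k) : deriv_line (fun y => centered y l a) 0.
  under eq_fun do rewrite centered_upd ?neq_ltn ?ltn_ord//; exact: dercst.
have h := derB (derM (dercst (\det (lead k (gramf (centered y)))) (y (i, k))) (der_centered i k))
  (dersum (index_enum ('I_k : finType)) (fun a : 'I_k => dersum (index_enum ('I_k : finType)) (fun b : 'I_k =>
   derM (derM (der_gramf k a) (dercst (\adj (lead k (gramf (centered y))) a b) (y (i, k)))) (c i b)))).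
apply: (is_derive_eq h); rewrite /dortho eqxx mul0r add0r mul1r /proj1 eqxx; congr (_ - _).
apply: eq_bigr => a _; apply: eq_bigr => b _.
rewrite upd_id mulr0 addr0 mulr0 addr0 mul1r (_ : (_ == _) = false) ?mul0r ?addr0; last first.
  by apply/eqP => ak; have := ltn_ord a; rewrite ak ltnn.
by rewrite mulrAC mulrC.
Qed.

End along_coordinate.

Lemma tame_dortho i k : tame (fun y : coords => dortho y i k).
Proof.
apply: tameB; first by apply: tameM; [exact: tame_gminor|exact: tame_cst].
apply: tame_sum => a; apply: tame_sum => b; apply: tameM; first exact: tame_adj.
by apply: tameM; exact: tame_centered.
Qed.

(** Up to the factor [gminor k], [ortho] projects column k orthogonally to the constants and to the
    k earlier centred columns. Its divergence is the trace of this projection, which is the origin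
    of n - 1 - k. *)
Lemma sum_dortho y (k : 'I_p) :
  \sum_i dortho y i k = (n%:R - 1 - k%:R) * gminor (centered y) k.
Proof.
rewrite sumrB sumr_const card_ord -(mulr_natr (_ * _) n).
have -> : \sum_(i < n) \sum_(a < k) \sum_(b < k)
    \adj (lead k (gramf (centered y))) a b * (centered y i a * centered y i b) =
    gminor (centered y) k *+ k.
  rewrite -sum_adj_gram exchange_big; apply: eq_bigr => a _ /=.
  rewrite exchange_big; apply: eq_bigr => b _ /=.
  by rewrite -mulr_sumr.
by rewrite -(mulr_natr (gminor _ _) k); field; exact: n_neq0.
Qed.

End sample_gram.

(** * Moments of the determinant *)

Section powR_inequalities.
Context {R : realType}.
Implicit Types u h m D a : R.

(** The tangent at u = 1 lies below the convex function u^(-h). *)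
Lemma powR_tangent_le u h : 0 < u -> 0 < h -> u `^ h * (1 + h - h * u) <= 1.
Proof.
move=> u0 h0; rewrite /powR gt_eqF//.
have : 1 + h - h * u <= expR (- (h * ln u)).
  have := expR_ge1Dx (- (h * ln u)); apply: le_trans.
  have : ln u <= u - 1 by rewrite -{1}(subrKC 1 u) le_ln1Dx//; lra.
  nra.
move/(ler_wpM2l (expR_ge0 (h * ln u)))/le_trans; apply.
by rewrite -expRD subrr expR0.
Qed.

(** Bernoulli's inequality for u^(1 + h), again the tangent at u = 1. *)
Lemma powR_tangent_ge u h : 0 < u -> 0 < h -> 1 + (1 + h) * (u - 1) <= u * u `^ h.
Proof.
move=> u0 h0; rewrite /powR gt_eqF//.
have : ln u^-1 <= u^-1 - 1.
  by rewrite -{1}(subrKC 1 u^-1) le_ln1Dx// ltrBrDr addrC subrr invr_gt0.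
rewrite lnV// => lnu.
have hl : h * (1 - u^-1) <= h * ln u by rewrite (ler_wpM2l (ltW h0))//; lra.
have := expR_ge1Dx (h * ln u) => e1.
have : 1 + h * (1 - u^-1) <= expR (h * ln u) by rewrite (le_trans _ e1)// lerD2l.
move/(ler_wpM2l (ltW u0)); apply: le_trans; rewrite le_eqVlt; apply/orP; left; apply/eqP.
by field; rewrite gt_eqF.
Qed.

Lemma powRD_ge0 D a h : 0 <= D -> 0 <= a -> 0 < h -> D `^ (a + h) = D `^ a * D `^ h.
Proof. by move=> D0 a0 h0; rewrite powRD// gt_eqF//= ltr_wpDl. Qed.

(** The tangent inequality at u = D / m, multiplied by D^a. The number m is free; with m the ratio
    of the moments of orders a + h + 1 and a + h, the left-hand bracket integrates to a single
    moment. *)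
Lemma powR_tilt_le D m a h : 0 <= D -> 0 < m -> 0 <= a -> 0 < h ->
  m `^ (- h) * ((1 + h) * D `^ (a + h) - h / m * D `^ (a + h + 1)) <= D `^ a.
Proof.
move=> D0 m0 a0 h0; rewrite (powRD_ge0 D0 (addr_ge0 a0 (ltW h0)) ltr01) (powRD_ge0 D0 a0 h0) powRr1//.
have Da0 := powR_ge0 D a.
move: D0; rewrite le_eqVlt => /predU1P[<-|D0].
  by rewrite (powR0 (lt0r_neq0 h0)) !(mulr0, mul0r) subrr mulr0.
have u0 : 0 < D / m by rewrite divr_gt0.
have := powR_tangent_le u0 h0.
have -> : (D / m) `^ h = D `^ h * m `^ (- h).
  by rewrite powRM ?invr_ge0 ?ltW// -powR_inv1 ?ltW// -powRrM mulN1r.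
move=> /(ler_wpM2l Da0); rewrite mulr1; apply: le_trans.
rewrite le_eqVlt; apply/orP; left; apply/eqP; field.
by rewrite gt_eqF.
Qed.

Lemma powR_tilt_ge D m a h : 0 <= D -> 0 < m -> 0 <= a -> 0 < h ->
  m `^ h * (m * D `^ a + (1 + h) * (D `^ (a + 1) - m * D `^ a)) <= D `^ (a + 1 + h).
Proof.
move=> D0 m0 a0 h0; rewrite (powRD_ge0 D0 (addr_ge0 a0 ler01) h0) (powRD_ge0 D0 a0 ltr01) powRr1//.
have Da0 := powR_ge0 D a; have mh := powR_ge0 m h.
move: D0; rewrite le_eqVlt => /predU1P[<-|D0].
  rewrite (powR0 (lt0r_neq0 h0)) [leRHS]mulr0; set A := 0 `^ a.
  rewrite (_ : m * A + _ = - (h * (m * A))); last by ring.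
  by rewrite mulrN oppr_le0 !mulr_ge0// ?powR_ge0// ltW.
have u0 : 0 < D / m by rewrite divr_gt0.
have := powR_tangent_ge u0 h0.
have -> : (D / m) `^ h = D `^ h / m `^ h.
  by rewrite powRM ?invr_ge0 ?ltW// -powR_inv1 ?ltW// -powRrM mulN1r powRN.
have mh0 : 0 < m `^ h by exact: powR_gt0.
move=> /(ler_wpM2l (mulr_ge0 Da0 (mulr_ge0 (ltW m0) mh))) H.
rewrite (le_trans _ (le_trans H _))// le_eqVlt; apply/orP; left; apply/eqP; field.
- by rewrite gt_eqF.
- by rewrite !gt_eqF.
Qed.

Lemma powR_shift_cvg D h : 0 <= D -> 0 < h ->
  (D + m.+1%:R^-1) `^ h @[m --> \oo] --> D `^ h.
Proof.
move=> D0 h0.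
have e0 : (m.+1%:R^-1 : R) @[m --> \oo] --> 0 by exact: cvg_harmonic.
move: D0; rewrite le_eqVlt => /predU1P[<-|D0].
  rewrite powR0 ?gt_eqF//.
  under eq_fun do rewrite add0r.
  apply: (@cvg_comp _ _ _ (fun m : nat => m.+1%:R^-1 : R) (fun a => a `^ h) _ (0:R)^'+); last exact: powR_cvg0.
  move=> A hA.
  have H : \forall m \near \oo, 0 < (m.+1%:R^-1 : R) -> A m.+1%:R^-1 by exact: (e0 _ hA).
  by apply: (@filterS _ \oo _ _ _ _ H) => m; apply; rewrite invr_gt0.
apply: (@cvg_comp _ _ _ (fun m : nat => D + m.+1%:R^-1) (fun a => a `^ h) _ (nbhs D));
  last exact: powR_continuous_gt0.
suff : D + m.+1%:R^-1 @[m --> \oo] --> D + 0 by rewrite addr0.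
by apply: cvgD => //; exact: cvg_cst.
Qed.

End powR_inequalities.

Section determinant_moments.
Context {R : realType} (n p : nat) d (T : measurableType d) (P : probability T R).
Local Notation I := ('I_n * 'I_p)%type.
Local Notation coords := (@coords R I).
Variable X : I -> {RV P >-> R}.
Hypothesis indepX : mutually_independent P (fun i => (X i : T -> R)).
Hypothesis normalX : forall i, std_normal P (X i).
Hypothesis np : (1 + p < n)%N.
Variable tau : R.
Hypothesis tau0 : 0 < tau.
Local Notation E := (expect X).
Local Notation w := (weight tau).
Implicit Types (F G : coords -> R) (h : R) (y : I -> R).

Let n0 : (0 < n)%N. Proof. by apply: leq_trans np; rewrite addnC. Qed.

Definition gdet y : R := gminor (centered y) p.

Lemma gdet_ge0 y : 0 <= gdet y. Proof. exact: gminor_ge0. Qed.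

Lemma expect_dominated (F_ : nat -> coords -> R) F (K : R) :
  (forall m, bounded_meas (F_ m)) -> bounded_meas F ->
  (forall m y, `|F_ m y| <= K) ->
  (forall y, F_ m y @[m --> \oo] --> F y) ->
  E (F_ m) @[m --> \oo] --> E F.
Proof.
move=> bF_ bF F_K cF.
have iF := bounded_meas_integrable X bF.
have [] := @dominated_convergence _ _ _ P setT measurableT
  (fun m t => (F_ m (sample X t))%:E) (fun t => (F (sample X t))%:E) (cst K%:E).
- move=> m; exact: measurable_int (bounded_meas_integrable X (bF_ m)).
- exact: measurable_int iF.
- by apply: aeW => t _; apply: cvg_EFin; [exact: nearW|exact: cF].
- exact: finite_measure_integrable_cst.
- by apply: aeW => t m _ /=; rewrite lee_fin.
move=> _ _ cE; apply: fine_cvg; rewrite fineK//; exact: integrable_fin_num.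
Qed.

Lemma bounded_meas_le F G : measurable_fun setT F -> bounded_meas G ->
  (forall y, `|F y| <= G y) -> bounded_meas F.
Proof.
move=> mF [_ [K GK]] FG; split=> //; exists K => y.
by rewrite (le_trans (FG y))// (le_trans (ler_norm _)).
Qed.

Lemma measurable_gdet_powR h : measurable_fun setT (fun y : coords => gdet y `^ h).
Proof.
apply: (measurableT_comp (measurable_powR h)); exact: (tame_meas (tame_gminor _ _ p)).
Qed.

Lemma gdet_powR_le y h e : 0 <= h -> 0 <= e -> e <= 1 -> (gdet y + e) `^ h <= (gdet y + 1) `^ h.
Proof.
move=> h0 e0 e1; have D0 := gdet_ge0 y.
by apply: ge0_ler_powR; rewrite ?nnegrE ?addr_ge0 ?lerD2l.
Qed.

Lemma tame_gdet_shift e h : 0 < e -> tame (fun y : coords => (gdet y + e) `^ h).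
Proof. by move=> e0; apply: tame_powR => //; [exact: gdet_ge0|exact: tame_gminor]. Qed.

Lemma bounded_gdet (k : nat) h : 0 <= h ->
  bounded_meas (fun y : coords => gminor (centered y) k * gdet y `^ h * w y).
Proof.
move=> h0.
apply: (bounded_meas_le (G := fun y => gminor (centered y) k * (gdet y + 1) `^ h * w y)).
- apply: measurable_funM; last exact: measurable_weight.
  by apply: measurable_funM; [exact: (tame_meas (tame_gminor _ _ k))|exact: measurable_gdet_powR].
- apply: tame_weight_bounded => //; apply: tameM; first exact: tame_gminor.
  exact: tame_gdet_shift.
- move=> y; rewrite ger0_norm; last first.
    by rewrite !mulr_ge0 ?powR_ge0 ?gminor_ge0// ltW// weight_gt0.
  rewrite ler_wpM2r ?(ltW (weight_gt0 _ _))// ler_wpM2l ?gminor_ge0//.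
  by have := gdet_powR_le y h0 (lexx 0) ler01; rewrite addr0.
Qed.

(** [stein_weight] in the coordinates (i, k), applied to [ortho] times a power of D + e and summed
    over i. The product with the data column is [gminor k.+1], the divergence of [ortho] gives n - 1
    - k, and [ortho] paired with the gradient of D gives 2 D [gminor k]. *)
Lemma stein_ortho (k : 'I_p) (e h : R) : 0 < e ->
  (1 + tau) * E (fun y => gminor (centered y) k.+1 * (gdet y + e) `^ h * w y) =
  (n%:R - 1 - k%:R) * E (fun y => gminor (centered y) k * (gdet y + e) `^ h * w y) +
  2 * h * E (fun y => gminor (centered y) k * gdet y * (gdet y + e) `^ (h - 1) * w y).
Proof.
move=> e0.
pose F i y := ortho (centered y) k i * (gdet y + e) `^ h.
pose grad i y := 2 * \sum_(b < p) cofactor (lead p (gramf (centered y))) k b * centered y i b.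
pose F' i y := dortho y i k * (gdet y + e) `^ h +
  ortho (centered y) k i * (grad i y * (h * (gdet y + e) `^ (h - 1))).
have tF i : tame (F i : coords -> R).
  by apply: tameM; [exact: tame_ortho|exact: tame_gdet_shift].
have tgrad i : tame (grad i : coords -> R).
  apply: tameM; first exact: tame_cst.
  apply: tame_sum => b; apply: tameM; last exact: tame_centered.
  by apply: tame_cofactor => a' b'; exact: tame_lead.
have tF' i : tame (F' i : coords -> R).
  apply: tameD; first by apply: tameM; [exact: tame_dortho|exact: tame_gdet_shift].
  apply: tameM; first exact: tame_ortho.
  apply: tameM; first exact: tgrad.
  by apply: tameM; [exact: tame_cst|exact: tame_gdet_shift].
have dF i y : is_derive (y (i, k)) (1:R) (fun x => F i (upd y (i, k) x)) (F' i y).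
  have h1 := der_ortho n0 y i k.
  have h2 := derD (der_gminor n0 y i k) (dercst e (y (i, k))).
  have D0 : 0 < gminor (centered (upd y (i, k) (y (i, k)))) p + e.
    by rewrite ltr_wpDl// gminor_ge0.
  have h3 := dercomp h2 (is_derive1_powR h D0).
  have := derM h1 h3 => /is_derive_eq; apply.
  by rewrite upd_id addr0.
have bw H : tame (H : coords -> R) -> bounded_meas (fun y => H y * w y).
  exact: tame_weight_bounded.
have st i := stein_weight indepX normalX (i := (i, k)) tau0 (tF i) (tF' i) (dF i).
have t1 i : tame (fun y : coords => y (i, k) * F i y).
  by apply: tameM => //; exact: tame_coord.
have [s1 _] := expect_sum X (index_enum ('I_n : finType)) (fun i => bw _ (t1 i)).
have [s2 _] := expect_sum X (index_enum ('I_n : finType)) (fun i => bw _ (tF' i)).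
have : \sum_i (1 + tau) * E (fun y => y (i, k) * F i y * w y) =
       \sum_i E (fun y => F' i y * w y) by apply: eq_bigr => i _; exact: st.
rewrite -mulr_sumr -s1 -s2.
have -> : (fun y : coords => \sum_i y (i, k) * F i y * w y) =
  (fun y => gminor (centered y) k.+1 * (gdet y + e) `^ h * w y).
  apply/funext => y; rewrite -mulr_suml; congr (_ * _).
  under eq_bigr do rewrite mulrA; rewrite -mulr_suml; congr (_ * _).
  rewrite -(sum_ortho_self (w := fun i => y (i, k)))// => b.
  by rewrite -sum_entry_centered//; apply: eq_bigr => i _; rewrite entry_ord.
have -> : (fun y : coords => \sum_i F' i y * w y) = (fun y =>
    (n%:R - 1 - k%:R) * (gminor (centered y) k * (gdet y + e) `^ h * w y) +
    2 * h * (gminor (centered y) k * gdet y * (gdet y + e) `^ (h - 1) * w y)).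
  apply/funext => y; rewrite -mulr_suml big_split/= -mulr_suml sum_dortho// !mulrA -mulrDl.
  congr (_ * _); congr (_ + _); rewrite -[2 * h * _ * _]mulrA -sum_ortho_cofactor.
  rewrite mulr_sumr mulr_suml; apply: eq_bigr => i _; rewrite /grad; ring.
have bm1 : bounded_meas (fun y : coords => gminor (centered y) k * (gdet y + e) `^ h * w y).
  by apply: bw; apply: tameM; [exact: tame_gminor|exact: tame_gdet_shift].
have bm2 : bounded_meas (fun y : coords =>
    gminor (centered y) k * gdet y * (gdet y + e) `^ (h - 1) * w y).
  apply: bw; apply: tameM; last exact: tame_gdet_shift.
  by apply: tameM; exact: tame_gminor.
by rewrite expectD; [rewrite !expectZ|exact: bounded_measZ|exact: bounded_measZ].
Qed.

(** Let e tend to 0 in [stein_ortho]: D (D + e)^(h - 1) tends to D^h, and the two terms on the right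
    merge into the factor n - 1 - k + 2h. *)
Lemma minor_recursion (k : 'I_p) h : 0 <= h ->
  (1 + tau) * E (fun y => gminor (centered y) k.+1 * gdet y `^ h * w y) =
  (n%:R - 1 - k%:R + 2 * h) * E (fun y => gminor (centered y) k * gdet y `^ h * w y).
Proof.
rewrite le_eqVlt => /predU1P[<-|h0].
  (* For h = 0 all powers are 1, also at D = 0, so e = 1 already gives the claim without a limit. *)
  have := stein_ortho k 0 ltr01; rewrite mulr0 mul0r !addr0 => st.
  have e0 k' : (fun y : coords => gminor (centered y) k' * gdet y `^ 0 * w y) =
               (fun y => gminor (centered y) k' * (gdet y + 1) `^ 0 * w y).
    by apply/funext => y; rewrite !powRr0.
  by rewrite !e0.
pose e (m : nat) : R := m.+1%:R^-1.
have e0 m : 0 < e m by rewrite invr_gt0.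
have e1 m : e m <= 1 by rewrite invf_le1 ?ler1n.
have st m := stein_ortho k h (e0 m).
have cv k' : E (fun y => gminor (centered y) k' * (gdet y + e m) `^ h * w y) @[m --> \oo] -->
    E (fun y => gminor (centered y) k' * gdet y `^ h * w y).
  have [_ [K bK]] : bounded_meas (fun y : coords => gminor (centered y) k' * (gdet y + 1) `^ h * w y).
    by apply: tame_weight_bounded => //; apply: tameM; [exact: tame_gminor|exact: tame_gdet_shift].
  apply: (expect_dominated (K := K)).
  - move=> m; apply: tame_weight_bounded => //.
    by apply: tameM; [exact: tame_gminor|exact: tame_gdet_shift].
  - exact/bounded_gdet/ltW.
  - move=> m y; apply: le_trans (bK y); rewrite !normrM.
    rewrite ler_wpM2r// ler_wpM2l// !ger0_norm ?powR_ge0//.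
    by apply: gdet_powR_le => //; exact: ltW.
  - move=> y; apply: cvgM; last exact: cvg_cst.
    by apply: cvgM; [exact: cvg_cst|apply: powR_shift_cvg => //; exact: gdet_ge0].
have cv2 : E (fun y => gminor (centered y) k * gdet y * (gdet y + e m) `^ (h - 1) * w y) @[m --> \oo] -->
    E (fun y => gminor (centered y) k * gdet y `^ h * w y).
  have [_ [K bK]] : bounded_meas (fun y : coords => gminor (centered y) k * (gdet y + 1) `^ h * w y).
    by apply: tame_weight_bounded => //; apply: tameM; [exact: tame_gminor|exact: tame_gdet_shift].
  apply: (expect_dominated (K := K)).
  - move=> m; apply: tame_weight_bounded => //.
    apply: tameM; last exact: tame_gdet_shift.
    by apply: tameM; exact: tame_gminor.
  - exact/bounded_gdet/ltW.
  - move=> m y; apply: le_trans (bK y); rewrite -(mulrA (gminor _ _)) !normrM.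
    have D0 := gdet_ge0 y.
    rewrite ler_wpM2r// ler_wpM2l// !ger0_norm ?powR_ge0//.
    apply: le_trans (gdet_powR_le y (ltW h0) (ltW (e0 m)) (e1 m)).
    (* The bound D (D + e)^(h - 1) <= (D + e)^h also covers h < 1, where the second factor alone is
       unbounded as e tends to 0. *)
    rewrite -(mulr_powRB1 (x := gdet y + e m) _ h0); last by rewrite addr_ge0// ltW.
    by rewrite ler_wpM2r ?powR_ge0// lerDl ltW.
  - move=> y; apply: cvgM; last exact: cvg_cst.
    under eq_fun do rewrite -mulrA.
    apply: cvgM; first exact: cvg_cst.
    have := gdet_ge0 y; rewrite le_eqVlt => /predU1P[D0|D0].
      rewrite -D0 powR0 ?gt_eqF//; under eq_fun do rewrite mul0r; exact: cvg_cst.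
    rewrite -(mulr_powRB1 (ltW D0) h0); apply: cvgM; first exact: cvg_cst.
    apply: (@cvg_comp _ _ _ (fun m : nat => gdet y + e m) (fun a => a `^ (h - 1)) _ (nbhs (gdet y)));
      last exact: powR_continuous_gt0.
    suff : gdet y + e m @[m --> \oo] --> gdet y + 0 by rewrite addr0.
    by apply: cvgD; [exact: cvg_cst|exact: cvg_harmonic].
have lim1 : (1 + tau) * E (fun y => gminor (centered y) k.+1 * (gdet y + e m) `^ h * w y) @[m --> \oo] -->
  (1 + tau) * E (fun y => gminor (centered y) k.+1 * gdet y `^ h * w y).
  by apply: cvgM; [exact: cvg_cst|exact: cv].
rewrite (funext st) in lim1.
have lim2 : (n%:R - 1 - k%:R) * E (fun y => gminor (centered y) k * (gdet y + e m) `^ h * w y) +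
    2 * h * E (fun y => gminor (centered y) k * gdet y * (gdet y + e m) `^ (h - 1) * w y) @[m --> \oo] -->
    (n%:R - 1 - k%:R) * E (fun y => gminor (centered y) k * gdet y `^ h * w y) +
    2 * h * E (fun y => gminor (centered y) k * gdet y `^ h * w y).
  by apply: cvgD; apply: cvgM; [exact: cvg_cst|exact: cv|exact: cvg_cst|exact: cv2].
by rewrite [RHS]mulrDl; exact: (cvg_unique _ lim1 lim2).
Qed.

Definition detmoment h : R := E (fun y => gdet y `^ h * w y).

Definition momratio h : R := \prod_(k < p) ((n%:R - 1 - k%:R + 2 * h) / (1 + tau)).

Lemma bounded_moment h : 0 <= h -> bounded_meas (fun y : coords => gdet y `^ h * w y).
Proof.
move=> h0; have := bounded_gdet 0 h0.
by under eq_fun do rewrite /gminor det_mx00 mul1r.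
Qed.

(** Climbing through the leading minors with h fixed: [gminor] of order 0 is 1, that of order p is
    D, and each order contributes one factor. *)
Lemma detmomentS h : 0 <= h -> detmoment (h + 1) = momratio h * detmoment h.
Proof.
move=> h0; have t1 : 1 + tau != 0 by rewrite gt_eqF// addr_gt0.
have main k : (k <= p)%N -> E (fun y => gminor (centered y) k * gdet y `^ h * w y) =
    \prod_(j < k) ((n%:R - 1 - j%:R + 2 * h) / (1 + tau)) * detmoment h.
  elim: k => [_|k IH kp].
    rewrite big_ord0 mul1r; congr expect; apply/funext => y.
    by rewrite /gminor det_mx00 mul1r.
  rewrite big_ord_recr/= mulrAC -IH; last exact: ltnW.
  by apply: (mulfI t1); rewrite (minor_recursion (Ordinal kp) h0)/=; field.
rewrite /momratio -main//; congr expect; apply/funext => y.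
congr (_ * _); have D0 := gdet_ge0 y.
by rewrite addrC powRD ?powRr1// gt_eqF// ltr_wpDr.
Qed.

Lemma detmoment0 : detmoment 0 = (Num.sqrt (1 + tau))^-1 ^+ (n * p).
Proof.
rewrite -[X in _ ^+ (X * _)]card_ord -[X in _ ^+ (_ * X)]card_ord -card_prod.
rewrite -(expect_weight indepX normalX tau0); congr expect; apply/funext => y.
by rewrite powRr0 mul1r.
Qed.

Lemma momratio_factor_gt0 h (k : 'I_p) : 0 <= h -> 0 < n%:R - 1 - k%:R + 2 * h.
Proof.
move=> h0; rewrite ltr_wpDr// ?mulr_ge0// subr_gt0 ltrBrDr.
rewrite -[1]/(1%:R) -natrD ltr_nat addn1; have := ltn_ord k => kp.
by rewrite (leq_trans _ np)// add1n ltnS ltnW.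
Qed.

Lemma momratio_gt0 h : 0 <= h -> 0 < momratio h.
Proof.
move=> h0; apply: prodr_gt0 => k _; apply: divr_gt0; last by rewrite addr_gt0.
exact: momratio_factor_gt0.
Qed.

(** [powR_tilt_le] with m = [momratio (a + h)]. Together with [detmoment_ge] it takes the place of
    Hoelder's inequality, that is, of log-convexity of the moments. *)
Lemma detmoment_le a h : 0 <= a -> 0 < h ->
  detmoment (a + h) <= momratio (a + h) `^ h * detmoment a.
Proof.
move=> a0 h0; have ah0 : 0 <= a + h by rewrite addr_ge0// ltW.
set m := momratio (a + h); have m0 : 0 < m by exact: momratio_gt0.
have b1 := bounded_moment a0; have b2 := bounded_moment ah0.
have b3 := bounded_moment (addr_ge0 ah0 ler01).
suff : m `^ (- h) * detmoment (a + h) <= detmoment a.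
  by rewrite powRN mulrC ler_pdivrMr ?powR_gt0// mulrC.
have -> : m `^ (- h) * detmoment (a + h) =
   E (fun y => m `^ (- h) * ((1 + h) * (gdet y `^ (a + h) * w y) + (- (h / m)) * (gdet y `^ (a + h + 1) * w y))).
  rewrite expectZ; last by apply: bounded_measD; exact: bounded_measZ.
  rewrite expectD; [|exact: bounded_measZ|exact: bounded_measZ].
  rewrite !expectZ// -!/(detmoment _) detmomentS// -/m; congr (_ * _); field.
  by rewrite gt_eqF.
apply: expect_le => //.
  by apply: bounded_measZ; apply: bounded_measD; exact: bounded_measZ.
move=> y; have := powR_tilt_le (gdet_ge0 y) m0 a0 h0.
move/(ler_wpM2r (ltW (weight_gt0 tau y))); apply: le_trans.
by rewrite le_eqVlt; apply/orP; left; apply/eqP; ring.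
Qed.

(** With m = [momratio a] the first-order term of [powR_tilt_ge] integrates to zero, because Psi(a +
    1) = m Psi(a). *)
Lemma detmoment_ge a h : 0 <= a -> 0 < h ->
  momratio a `^ h * detmoment (a + 1) <= detmoment (a + 1 + h).
Proof.
move=> a0 h0; have a10 : 0 <= a + 1 by rewrite addr_ge0.
set m := momratio a; have m0 : 0 < m by exact: momratio_gt0.
have b1 := bounded_moment a0; have b2 := bounded_moment a10.
have b3 := bounded_moment (addr_ge0 a10 (ltW h0)).
have -> : m `^ h * detmoment (a + 1) =
   E (fun y => m `^ h * ((- (h * m)) * (gdet y `^ a * w y) + (1 + h) * (gdet y `^ (a + 1) * w y))).
  rewrite expectZ; last by apply: bounded_measD; exact: bounded_measZ.
  rewrite expectD; [|exact: bounded_measZ|exact: bounded_measZ].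
  rewrite !expectZ// -!/(detmoment _) detmomentS// -/m; congr (_ * _); ring.
apply: expect_le => //.
  by apply: bounded_measZ; apply: bounded_measD; exact: bounded_measZ.
move=> y; have := powR_tilt_ge (gdet_ge0 y) m0 a0 h0.
move/(ler_wpM2r (ltW (weight_gt0 tau y))); apply: le_trans.
by rewrite le_eqVlt; apply/orP; left; apply/eqP; ring.
Qed.

End determinant_moments.

(** * Logarithm of the moments *)

Section logarithm_bounds.
Context {R : realType}.
Implicit Types x a h H : R.

Lemma ge0_derive_le (f f' : R -> R) x : 0 <= x ->
  (forall u : R, 0 <= u -> is_derive u (1:R) f (f' u)) ->
  (forall u : R, 0 <= u -> 0 <= f' u) -> f 0 <= f x.
Proof.
rewrite le_eqVlt => /predU1P[<-//|x0] df f'0.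
have cf : {within `[0, x], continuous f}.
  apply: derivable_oo_LRcontinuous_within.
  split=> [u /[!in_itv]/= /andP[u0 _]||].
  - by case: (df u (ltW u0)).
  - exact/cvg_at_right_filter/(dercont1 (df _ _)).
  - exact/cvg_at_left_filter/(dercont1 (df _ (ltW x0))).
have [|c /[!in_itv]/= /andP[c0 cx] E] := @MVT _ f f' 0 x x0 _ cf.
  by move=> u /[!in_itv]/= /andP[u0 _]; exact/df/ltW.
by rewrite -subr_ge0 E subr0 mulr_ge0//; [apply: f'0|]; exact: ltW.
Qed.

Let der_ln1D (u : R) : 0 <= u -> is_derive u (1:R) (fun x => ln (1 + x)) (1 + u)^-1.
Proof.
move=> u0; have u1 : 0 < 1 + u by rewrite ltr_wpDr.
have := dercomp (derD (dercst 1 u) (derid u)) (is_derive1_ln u1).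
by move/is_derive_eq; apply; rewrite add0r mul1r.
Qed.

Lemma ln1D_ge x : 0 <= x -> x - x ^+ 2 / 2 <= ln (1 + x).
Proof.
move=> x0; rewrite -subr_ge0.
pose f x : R := ln (1 + x) - (x - x * x * 2^-1).
have -> : ln (1 + x) - (x - x ^+ 2 / 2) = f x by [].
have f0 : f 0 = 0 by rewrite /f addr0 ln1 !mul0r subr0 subrr.
have df (u : R) : 0 <= u -> is_derive u (1:R) f (u ^+ 2 / (1 + u)).
  move=> u0; have u1 : 1 + u != 0 by rewrite gt_eqF// ltr_wpDr.
  have := derB (der_ln1D u0) (derB (derid u) (derM (derM (derid u) (derid u)) (dercst 2^-1 u))).
  by move/is_derive_eq; apply; field.
rewrite -[leLHS]f0; apply: (ge0_derive_le x0 df) => u u0.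
by rewrite divr_ge0 ?sqr_ge0// addr_ge0.
Qed.

Lemma ln1D_le x : 0 <= x -> ln (1 + x) <= x - x ^+ 2 / 2 + x ^+ 3 / 3.
Proof.
move=> x0; rewrite -subr_ge0.
pose f x : R := (x - x * x * 2^-1 + x * x * x * 3^-1) - ln (1 + x).
have -> : x - x ^+ 2 / 2 + x ^+ 3 / 3 - ln (1 + x) = f x.
  by rewrite /f; congr (_ - _ + _ * _ - _); ring.
have f0 : f 0 = 0 by rewrite /f addr0 ln1 !mul0r !subr0 addr0.
have df (u : R) : 0 <= u -> is_derive u (1:R) f (u ^+ 3 / (1 + u)).
  move=> u0; have u1 : 1 + u != 0 by rewrite gt_eqF// ltr_wpDr.
  have := derB (derD (derB (derid u) (derM (derM (derid u) (derid u)) (dercst 2^-1 u)))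
    (derM (derM (derM (derid u) (derid u)) (derid u)) (dercst 3^-1 u))) (der_ln1D u0).
  by move/is_derive_eq; apply; field.
rewrite -[leLHS]f0; apply: (ge0_derive_le x0 df) => u u0.
by rewrite divr_ge0 ?exprn_ge0// addr_ge0.
Qed.

Lemma ln1D_le_id x : 0 <= x -> ln (1 + x) <= x.
Proof. by move=> x0; apply: le_ln1Dx; rewrite (lt_le_trans _ x0)// ltrN10. Qed.

(* two-term expansion of ln (Gamma(a + h) / Gamma(a)) *)
Definition gammalog a h : R := h * ln a + (h ^+ 2 - h) / (2 * a).

Lemma lnD1 a h : 0 < a -> 0 <= h -> ln (a + h) = ln a + ln (1 + h / a).
Proof.
move=> a0 h0; have ah : 0 < 1 + h / a by rewrite ltr_wpDr// divr_ge0// ltW.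
by rewrite -lnM ?posrE//; congr ln; field; rewrite gt_eqF.
Qed.

(** For the exact logarithm of Gamma(a + h)/Gamma(a) the expression inside the norm would be zero.
    The a priori bound [H] serves to keep one factor h in the error, which the final estimate
    needs. *)
Lemma gammalog_step a h H : 1 <= a -> 0 <= h -> h <= H ->
  `|gammalog a h - gammalog (a + 1) h + ln (1 + h / a)| <= (H ^+ 2 + H + 1) * h / a ^+ 3.
Proof.
move=> a1 h0 hH; have a0 : 0 < a by exact: lt_le_trans a1.
rewrite /gammalog (lnD1 a0 ler01).
set x := a^-1; have x0 : 0 < x by rewrite invr_gt0.
have ha0 : 0 <= h * x by rewrite mulr_ge0// ltW.
have l1 := ln1D_ge ha0; have l2 := ln1D_le ha0.
have l3 := ln1D_ge (ltW x0); have l4 := ln1D_le (ltW x0).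
rewrite -[1 / a]/(1 * x) mul1r.
have -> : (h ^+ 2 - h) / (2 * (a + 1)) = (h ^+ 2 - h) / 2 * x - (h ^+ 2 - h) / 2 * x ^+ 2 + (h ^+ 2 - h) / 2 * (x ^+ 2 / (a + 1)).
  by rewrite /x; field; rewrite !gt_eqF// addr_gt0.
have -> : (h ^+ 2 - h) / (2 * a) = (h ^+ 2 - h) / 2 * x by rewrite /x; field; rewrite gt_eqF.
have -> : (H ^+ 2 + H + 1) * h / a ^+ 3 = (H ^+ 2 + H + 1) * h * x ^+ 3 by rewrite /x exprVn.
set z := x ^+ 2 / (a + 1).
have z0 : 0 <= z by rewrite divr_ge0 ?sqr_ge0// addr_ge0// ltW.
have zx : z <= x ^+ 3.
  rewrite /z [leRHS]exprSr ler_wpM2l ?sqr_ge0// /x lef_pV2 ?posrE ?addr_gt0//; lra.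
have hl3 := ler_wpM2l h0 l3; have hl4 := ler_wpM2l h0 l4.
have x3 : 0 <= x ^+ 3 by rewrite exprn_ge0// ltW.
have H0 : 0 <= H by exact: le_trans hH.
have h2 : h ^+ 2 <= H ^+ 2 by apply: lerXn2r.
have h3x : h ^+ 3 * x ^+ 3 <= H ^+ 2 * h * x ^+ 3 by rewrite ler_wpM2r// [leLHS]exprSr ler_wpM2r.
have hz : h * z <= h * x ^+ 3 by rewrite ler_wpM2l.
have h2z : h ^+ 2 * z <= H * h * x ^+ 3.
  rewrite expr2 -[leLHS]mulrA -[leRHS]mulrA; apply: ler_pM => //; exact: mulr_ge0.
have hz0 : 0 <= h * z by rewrite mulr_ge0.
have h2z0 : 0 <= h ^+ 2 * z by rewrite mulr_ge0 ?sqr_ge0.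
have Hh : 0 <= H ^+ 2 * h * x ^+ 3.
  by apply: mulr_ge0 => //; apply: mulr_ge0 => //; exact: sqr_ge0.
have Hh1 : 0 <= H * h * x ^+ 3 by apply: mulr_ge0 => //; exact: mulr_ge0.
have Hh2 : 0 <= h * x ^+ 3 by exact: mulr_ge0.
rewrite ler_norml; apply/andP; split; lra.
Qed.

(** Makes the sum of the errors of [gammalog_step] over a, a + 1, ... telescope. *)
Lemma inv_cube_le (b : R) : 1 <= b -> (b ^+ 3)^-1 <= 2 * ((b ^+ 2)^-1 - ((b + 1) ^+ 2)^-1).
Proof.
move=> b1; have b0 : 0 < b by exact: lt_le_trans b1.
have -> : 2 * ((b ^+ 2)^-1 - ((b + 1) ^+ 2)^-1) = (b ^+ 3)^-1 * (2 * b * (2 * b + 1) / (b + 1) ^+ 2).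
  by field; rewrite !gt_eqF// addr_gt0.
have c0 : 0 <= (b ^+ 3)^-1 by rewrite invr_ge0 exprn_ge0// ltW.
rewrite (ler_peMr c0)// ler_pdivlMr; last by rewrite exprn_gt0// addr_gt0.
by nra.
Qed.

Lemma gammalog_telescope a h H (N : nat) : 1 <= a -> 0 <= h -> h <= H ->
  `|gammalog a h - gammalog (a + N%:R) h + \sum_(j < N) ln (1 + h / (a + j%:R))| <=
  (H ^+ 2 + H + 1) * h * 2 / a ^+ 2.
Proof.
move=> a1 h0 hH; set C := _ * h * 2.
have H0 : 0 <= H by exact: le_trans hH.
have C0 : 0 <= (H ^+ 2 + H + 1) * h by rewrite mulr_ge0// !addr_ge0// sqr_ge0.
have pos m : 1 <= a + m%:R by rewrite (le_trans a1)// lerDl.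
suff : `|gammalog a h - gammalog (a + N%:R) h + \sum_(j < N) ln (1 + h / (a + j%:R))| <=
    C * ((a ^+ 2)^-1 - ((a + N%:R) ^+ 2)^-1).
  move/le_trans; apply; apply: ler_wpM2l; first exact: mulr_ge0.
  by rewrite gerBl invr_ge0 sqr_ge0.
elim: N => [|N IH]; first by rewrite big_ord0 !addr0 !subrr normr0 mulr0.
rewrite big_ord_recr/= -natr1 [a + (_ + _)]addrA.
set b := a + N%:R in IH *; have b1 : 1 <= b by exact: pos.
have st := gammalog_step b1 h0 hH.
have cb := ler_wpM2l C0 (inv_cube_le b1).
rewrite (_ : _ + (_ + _) = (gammalog a h - gammalog b h + \sum_(i < N) ln (1 + h / (a + i%:R))) +
   (gammalog b h - gammalog (b + 1) h + ln (1 + h / b))); last by ring.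
rewrite (le_trans (ler_normD _ _))// (le_trans (lerD IH st))// /C; lra.
Qed.

End logarithm_bounds.

Section log_moment.
Context {R : realType}.

Lemma ln_prodr (I : eqType) (r : seq I) (f : I -> R) : (forall i, 0 < f i) ->
  ln (\prod_(i <- r) f i) = \sum_(i <- r) ln (f i).
Proof.
move=> f0; elim: r => [|i r IH]; first by rewrite !big_nil ln1.
by rewrite !big_cons lnM ?posrE ?IH// prodr_gt0.
Qed.

Lemma le0_of_harmonic (x K : R) : (forall N : nat, x <= K / N.+1%:R) -> x <= 0.
Proof.
move=> xK; rewrite leNgt; apply/negP => x0.
have [N hN] : exists N : nat, `|K / x| < N%:R.
  by exists (Num.bound `|K / x|); exact: archi_boundP.
have := xK N; rewrite ler_pdivlMr// leNgt => /negP; apply.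
rewrite mulrC -ltr_pdivrMr// (le_lt_trans (ler_norm _))// (lt_trans hN)//.
by rewrite ltr_nat.
Qed.

Variables (p : nat) (a : 'I_p -> R) (c : R) (Psi : R -> R).
Hypothesis a1 : forall k, 1 <= a k.
Hypothesis c0 : 0 < c.
Let ratio x := \prod_(k < p) (c * (a k + x)).
Hypothesis Psi0 : 0 < Psi 0.
Hypothesis PsiS : forall h, 0 <= h -> Psi (h + 1) = ratio h * Psi h.
Hypothesis Psi_le : forall b h, 0 <= b -> 0 < h ->
  Psi (b + h) <= ratio (b + h) `^ h * Psi b.
Hypothesis Psi_ge : forall b h, 0 <= b -> 0 < h ->
  ratio b `^ h * Psi (b + 1) <= Psi (b + 1 + h).

Let factor_gt0 x k : 0 <= x -> 0 < c * (a k + x).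
Proof. by move=> x0; rewrite mulr_gt0// ltr_wpDr// (lt_le_trans ltr01). Qed.

Let ratio_gt0 x : 0 <= x -> 0 < ratio x.
Proof. by move=> x0; apply: prodr_gt0 => k _; exact: factor_gt0. Qed.

Let lratio x := \sum_(k < p) (ln c + ln (a k + x)).

Let ln_ratio x : 0 <= x -> ln (ratio x) = lratio x.
Proof.
move=> x0; rewrite ln_prodr => [|k]; last exact: factor_gt0.
by apply: eq_bigr => k _; rewrite lnM ?posrE// ltr_wpDr// (lt_le_trans ltr01).
Qed.

Let Psi_shift h (N : nat) : 0 <= h -> 0 < Psi h ->
  0 < Psi (h + N%:R) /\ ln (Psi (h + N%:R)) = ln (Psi h) + \sum_(j < N) lratio (h + j%:R).
Proof.
move=> h0 Ph; elim: N => [|N [IH1 IH2]]; first by rewrite addr0 big_ord0 addr0.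
have hN : 0 <= h + N%:R by rewrite addr_ge0.
rewrite -natr1 addrA PsiS//; split; first by rewrite mulr_gt0// ratio_gt0.
by rewrite lnM ?posrE ?ratio_gt0// IH2 ln_ratio// big_ord_recr/=; ring.
Qed.

(** [Psi_ge] at b = 0 bounds Psi(1 + h) = ratio(h) Psi(h) below by a positive multiple of Psi(1). *)
Lemma log_moment_gt0 h : 0 < h -> 0 < Psi h.
Proof.
move=> h0; have := Psi_ge (lexx 0) h0; rewrite add0r addrC (PsiS (ltW h0)) => H.
rewrite -(pmulr_rgt0 _ (ratio_gt0 (ltW h0))); apply: (lt_le_trans _ H).
have P1 : 0 < Psi 1 by rewrite -[1]add0r PsiS// mulr_gt0// ratio_gt0.
by rewrite mulr_gt0// powR_gt0// ratio_gt0.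
Qed.

Let sum_diff h (N : nat) : 0 <= h ->
  \sum_(j < N) (lratio (h + j%:R) - lratio j%:R) =
  \sum_(k < p) \sum_(j < N) ln (1 + h / (a k + j%:R)).
Proof.
move=> h0; rewrite exchange_big/=; apply: eq_bigr => j _.
rewrite -sumrB; apply: eq_bigr => k _.
have akj : 0 < a k + j%:R by rewrite ltr_wpDr// (lt_le_trans ltr01).
rewrite (_ : a k + (h + j%:R) = a k + j%:R + h); last by ring.
by rewrite lnD1//; ring.
Qed.

(** Shift both h and 0 by a large integer through the recursion. [Psi_le] and [Psi_ge] squeeze the
    quotient of the shifted values, and [gammalog_telescope] sums the logarithms collected on the
    way. In the limit only the error of the expansion at [a k] is left. *)
Lemma log_moment_bound h H : 0 < h -> h <= H ->
  `|ln (Psi h) - ln (Psi 0) - \sum_(k < p) (h * ln c + gammalog (a k) h)| <=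
  \sum_(k < p) (H ^+ 2 + H + 1) * h * 2 / a k ^+ 2.
Proof.
move=> h0 hH; have hh := ltW h0; have Ph := log_moment_gt0 h0.
set S := \sum_(k < p) (h * ln c + _); set B := \sum_(k < p) _ * _ * _ / _.
(* In both directions the terms of order 1/(a k + N) add up to at most K / N. *)
pose K := p%:R * (2 * (h ^+ 2 + h)).
have tel k (N : nat) := gammalog_telescope N (a1 k) hh hH.
have hsq : 0 <= h ^+ 2 by exact: sqr_ge0.
have bd k (N : nat) : 0 < N%:R :> R -> 0 < (a k + N%:R)^-1 /\ (a k + N%:R)^-1 <= N%:R^-1.
  move=> N0; have akN : 0 < a k + N%:R by rewrite addr_gt0// (lt_le_trans ltr01).
  rewrite invr_gt0 akN; split=> //; rewrite lef_pV2 ?posrE// lerDr.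
  by rewrite (le_trans ler01).
rewrite ler_norml; apply/andP; split; last first.
- rewrite -subr_le0; apply: (@le0_of_harmonic _ K) => M; set N := M.+1.
  have [] := Psi_shift N hh Ph; have [PN EN] := Psi_shift N (lexx 0) Psi0.
  move=> PhN EhN; have N0 : 0 < N%:R :> R by rewrite ltr0n.
  have le1 := Psi_le (ltW N0) h0.
  have r0 : 0 < ratio (N%:R + h) by rewrite ratio_gt0// addr_ge0.
  have {le1} : ln (Psi (h + N%:R)) <= h * lratio (N%:R + h) + ln (Psi (0 + N%:R)).
    rewrite -ln_ratio ?addr_ge0// -ln_powR -lnM ?posrE ?powR_gt0//.
    by rewrite ler_ln ?posrE ?mulr_gt0 ?powR_gt0// (addrC h) add0r.
  rewrite EhN EN => le2.
  have : ln (Psi h) - ln (Psi 0) <= h * lratio (N%:R + h) - \sum_(j < N) (lratio (h + j%:R) - lratio j%:R).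
    rewrite sumrB; under [X in _ - (_ - X)]eq_bigr do rewrite -[X in lratio X]add0r.
    by lra.
  rewrite sum_diff// /lratio mulr_sumr -sumrB => le3.
  suff : \sum_(k < p) (h * (ln c + ln (a k + (N%:R + h))) - \sum_(j < N) ln (1 + h / (a k + j%:R)))
      <= S + B + K / N%:R.
    by move=> H1; have := le_trans le3 H1; lra.
  have KE : K / N%:R = \sum_(k < p) (2 * (h ^+ 2 + h) / N%:R).
    by rewrite sumr_const card_ord -[RHS]mulr_natl /K [RHS]mulrA.
  rewrite KE /S /B -!big_split/=.
  apply: ler_sum => k _; have [b0 b1] := bd k N N0.
  have akN : 0 < a k + N%:R by rewrite -invr_gt0.
  have := tel k N; rewrite ler_norml => /andP[t1 t2].
  rewrite addrA lnD1//.
  have l1 : ln (1 + h / (a k + N%:R)) <= h / (a k + N%:R).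
    by apply: ln1D_le_id; rewrite divr_ge0// ltW.
  have := ler_wpM2l hh l1.
  rewrite {2}/gammalog in t1.
  rewrite (_ : (h ^+ 2 - h) / (2 * (a k + N%:R)) = (h ^+ 2 - h) / 2 * (a k + N%:R)^-1) in t1;
    last by rewrite invfM mulrA.
  have := ler_wpM2l hsq b1; have := ler_wpM2l hh b1; have := mulr_ge0 hsq (ltW b0).
  have := mulr_ge0 hh (ltW b0).
  move: t1; set G := gammalog _ _; set Bk := _ * 2 / _; set x := (a k + N%:R)^-1.
  set z := N%:R^-1; set L1 := ln (1 + _); set L2 := ln (a k + _); set Sm := \sum_(j < N) _.
  by move=> *; lra.
- rewrite -subr_ge0 opprK -oppr_le0; apply: (@le0_of_harmonic _ K) => M; set N := M.+1.
  (* [Psi_ge] at b = N speaks of Psi(N + 1), so the shift is by N + 1 here and by N above. *)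
  have [] := Psi_shift N.+1 hh Ph; have [PN EN] := Psi_shift N.+1 (lexx 0) Psi0.
  move=> PhN EhN; have N0 : 0 < N%:R :> R by rewrite ltr0n.
  have r0 : 0 < ratio N%:R by rewrite ratio_gt0// ltW.
  have le1 := Psi_ge (ltW N0) h0.
  have {le1} : h * lratio N%:R + ln (Psi (0 + N.+1%:R)) <= ln (Psi (h + N.+1%:R)).
    rewrite -(ln_ratio (ltW N0)) -ln_powR -lnM ?posrE ?powR_gt0//.
    rewrite ler_ln ?posrE ?mulr_gt0 ?powR_gt0//.
    by rewrite add0r [in leRHS]addrC -natr1.
  rewrite EhN EN => le2.
  have : h * lratio N%:R - \sum_(j < N.+1) (lratio (h + j%:R) - lratio j%:R) <= ln (Psi h) - ln (Psi 0).
    rewrite sumrB; under [X in _ - (_ - X)]eq_bigr do rewrite -[X in lratio X]add0r.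
    by lra.
  rewrite sum_diff// /lratio mulr_sumr -sumrB => le3.
  suff : S <= \sum_(k < p) (h * (ln c + ln (a k + N%:R)) - \sum_(j < N.+1) ln (1 + h / (a k + j%:R)))
      + B + K / N%:R by lra.
  have KE : K / N%:R = \sum_(k < p) (2 * (h ^+ 2 + h) / N%:R).
    by rewrite sumr_const card_ord -[RHS]mulr_natl /K [RHS]mulrA.
  rewrite KE /S /B -!big_split/=.
  apply: ler_sum => k _; have [b0 b1] := bd k N N0.
  have akN : 0 < a k + N%:R by rewrite -invr_gt0.
  have := tel k N.+1; rewrite ler_norml => /andP[t1 t2].
  rewrite {2}/gammalog in t2.
  rewrite -natr1 addrA lnD1// in t2.
  have l1 : ln (1 + 1 / (a k + N%:R)) <= 1 / (a k + N%:R).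
    by apply: ln1D_le_id; rewrite divr_ge0// ltW.
  have := ler_wpM2l hh l1.
  have b2 : (a k + N%:R + 1)^-1 <= (a k + N%:R)^-1.
    by rewrite lef_pV2 ?posrE//; [rewrite lerDl|exact: addr_gt0].
  have b3 : 0 < (a k + N%:R + 1)^-1 by rewrite invr_gt0 addr_gt0.
  rewrite (_ : (h ^+ 2 - h) / (2 * (a k + N%:R + 1)) = (h ^+ 2 - h) / 2 * (a k + N%:R + 1)^-1) in t2;
    last by rewrite invfM mulrA.
  have := ler_wpM2l hsq (le_trans b2 b1); have := ler_wpM2l hh b1; have := mulr_ge0 hsq (ltW b3).
  have := ler_wpM2l hh (le_trans b2 b1).
  have := mulr_ge0 hh (ltW b3); have := mulr_ge0 hsq (ltW b3).
  move: t2; rewrite div1r; set G := gammalog _ _; set Bk := _ * 2 / _; set x := (a k + N%:R)^-1.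
  set x' := (a k + N%:R + 1)^-1.
  set z := N%:R^-1; set L1 := ln (1 + _); set L2 := ln (a k + _); set Sm := \sum_(j < N.+1) _.
  have : 0 <= h ^+ 2 * z by rewrite mulr_ge0// invr_ge0 ltW.
  by move=> *; lra.
Qed.

End log_moment.

(** * Stirling asymptotics *)

Section asymptotics.
Context {R : realType}.
Implicit Types (N q h H t : R).

(* ln (m!) is stirling m up to a constant and O(1/m) *)
Definition stirling (m : R) : R := (m + 2^-1) * ln m - m.

Lemma lnS q : 0 < q -> ln (q + 1) = ln q + ln (1 + q^-1).
Proof. by move=> q0; rewrite lnD1// div1r. Qed.

Lemma inv_sq_le q : 1 <= q -> q^-1 ^+ 2 <= 2 * (q^-1 - (q + 1)^-1).
Proof.
move=> q1; have q0 : 0 < q by exact: lt_le_trans q1.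
have -> : 2 * (q^-1 - (q + 1)^-1) = q^-1 ^+ 2 * (2 * q / (q + 1)).
  by field; rewrite !gt_eqF// addr_gt0.
rewrite ler_peMr ?sqr_ge0// ler_pdivlMr ?addr_gt0//; lra.
Qed.

(** The quantity is 1 - (q + 1/2) ln(1 + 1/q). The summand 1/2 cancels the term in 1/q, and what
    remains has order q^(-2), which telescopes by [inv_sq_le]. *)
Lemma stirling_step q : 1 <= q ->
  `|ln (q + 1) - (stirling (q + 1) - stirling q)| <= q^-1 - (q + 1)^-1.
Proof.
move=> q1; have q0 : 0 < q by exact: lt_le_trans q1.
have := inv_sq_le q1; rewrite /stirling lnS//.
set x := q^-1; have x0 : 0 < x by rewrite invr_gt0.
have x1 : x <= 1 by rewrite invf_le1.
have qx : q * x = 1 by rewrite divff// gt_eqF.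
move=> h1.
have qh : 0 <= q + 2^-1 by rewrite addr_ge0// ltW.
have l1 := ler_wpM2l qh (ln1D_ge (ltW x0)); have l2 := ler_wpM2l qh (ln1D_le (ltW x0)).
have e1 : (q + 2^-1) * (x - x ^+ 2 / 2) = 1 - x ^+ 2 / 4.
  transitivity (q * x - (q * x) * x / 2 + x / 2 - x ^+ 2 / 4); first by field.
  by rewrite qx; field.
have e2 : (q + 2^-1) * (x - x ^+ 2 / 2 + x ^+ 3 / 3) = 1 - x ^+ 2 / 4 + x ^+ 2 / 3 + x ^+ 3 / 6.
  transitivity (q * x - (q * x) * x / 2 + x / 2 - x ^+ 2 / 4 + (q * x) * x ^+ 2 / 3 + x ^+ 3 / 6); first by field.
  by rewrite qx; field.
rewrite e1 in l1; rewrite e2 in l2.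
have x3 : x ^+ 3 <= x ^+ 2 by rewrite exprS ler_piMl ?sqr_ge0.
have x2 : 0 <= x ^+ 2 by exact: sqr_ge0.
have -> : ln q + ln (1 + x) - ((q + 1 + 2^-1) * (ln q + ln (1 + x)) - (q + 1) -
   ((q + 2^-1) * ln q - q)) = 1 - (q + 2^-1) * ln (1 + x) by ring.
by rewrite ler_norml; apply/andP; split; lra.
Qed.

Lemma harmonic_step q : 1 <= q ->
  `|(q + 1)^-1 - (ln (q + 1) - ln q)| <= 2 * (q^-1 - (q + 1)^-1).
Proof.
move=> q1; have q0 : 0 < q by exact: lt_le_trans q1.
have := inv_sq_le q1; rewrite lnS//.
set x := q^-1; have x0 : 0 < x by rewrite invr_gt0.
have x1 : x <= 1 by rewrite invf_le1.
have -> : (q + 1)^-1 = x / (1 + x) by rewrite /x; field; rewrite !gt_eqF// addr_gt0.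
move=> h1; have l1 := ln1D_ge (ltW x0); have l2 := ln1D_le_id (ltW x0).
have u0 : 0 < 1 + x by rewrite addr_gt0.
have e1 : x / (1 + x) = x - x ^+ 2 / (1 + x) by field; rewrite gt_eqF.
have e2 : x ^+ 2 / (1 + x) <= x ^+ 2 by rewrite ler_pdivrMr// ler_peMr ?sqr_ge0//; lra.
have e3 : x ^+ 2 / 2 <= x ^+ 2 / (1 + x).
  by rewrite ler_wpM2l ?sqr_ge0// lef_pV2 ?posrE//; lra.
rewrite ler_norml; apply/andP; split; lra.
Qed.

(** The numbers N - k run down to N - p + 1, so the telescoped errors stop at 1/(N - p), whatever
    the number of terms. *)
Lemma log_sums N (p : nat) : 1 <= N - p%:R ->
  [/\ `|\sum_(k < p) ln (N - k%:R) - (stirling N - stirling (N - p%:R))| <=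
        (N - p%:R)^-1 - N^-1,
      `|\sum_(k < p) (N - k%:R)^-1 - (ln N - ln (N - p%:R))| <=
        2 * ((N - p%:R)^-1 - N^-1) &
      \sum_(k < p) ((N - k%:R)^-1 ^+ 2) <= 2 * ((N - p%:R)^-1 - N^-1)].
Proof.
elim: p => [|p IH] q1.
  by rewrite !big_ord0 subr0 !subrr mulr0 normr0.
set q := N - p.+1%:R in q1 *.
have pq : N - p%:R = q + 1 by rewrite /q -natr1; ring.
have [] := IH _; first by rewrite pq; lra.
rewrite !big_ord_recr/= pq => i1 i2 i3.
have s1 := stirling_step q1; have s2 := harmonic_step q1; have s3 := inv_sq_le q1.
have q0 : 0 < q by exact: lt_le_trans q1.
have s4 : (q + 1)^-1 ^+ 2 <= q^-1 ^+ 2.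
  apply: lerXn2r.
  - by rewrite nnegrE invr_ge0 addr_ge0// ltW.
  - by rewrite nnegrE invr_ge0 ltW.
  - by rewrite lef_pV2 ?posrE//; [rewrite lerDl|exact: addr_gt0].
split.
- rewrite (_ : _ - _ = (\sum_(i < p) ln (N - i%:R) - (stirling N - stirling (q + 1))) +
    (ln (q + 1) - (stirling (q + 1) - stirling q))); last by ring.
  by rewrite (le_trans (ler_normD _ _))// (le_trans (lerD i1 s1))//; lra.
- rewrite (_ : _ - (_ - _) = (\sum_(i < p) (N - i%:R)^-1 - (ln N - ln (q + 1))) +
    ((q + 1)^-1 - (ln (q + 1) - ln q))); last by ring.
  by rewrite (le_trans (ler_normD _ _))// (le_trans (lerD i2 s2))//; lra.
- lra.
Qed.

Lemma ln1D_mul_bound t : 0 <= t -> t <= 1 ->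
  `|(1 + t) * ln (1 + t) - (t + t ^+ 2 / 2)| <= t ^+ 3.
Proof.
move=> t0 t1; have u0 : 0 <= 1 + t by rewrite addr_ge0.
have l1 := ler_wpM2l u0 (ln1D_ge t0); have l2 := ler_wpM2l u0 (ln1D_le t0).
have t3 : 0 <= t ^+ 3 by rewrite exprn_ge0.
have t4 : t * t ^+ 3 <= t ^+ 3 by rewrite ler_piMl.
rewrite (_ : (1 + t) * (t - t ^+ 2 / 2) = t + t ^+ 2 / 2 - t ^+ 3 / 2) in l1; last by field.
rewrite (_ : (1 + t) * (t - t ^+ 2 / 2 + t ^+ 3 / 3) =
  t + t ^+ 2 / 2 - t ^+ 3 / 2 + t ^+ 3 / 3 + t * t ^+ 3 / 3) in l2; last by field.
by rewrite ler_norml; apply/andP; split; lra.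
Qed.

(** The sum of the coefficients of h/q in the bounds [b1] to [b6] of the next proof. *)
Definition asym_const H : R := 16 * (H ^+ 2 + H + 1) + 4 * H ^+ 2 + 3 * H + 4.

(** [lP] stands for the logarithm of the moment of order h, known only through the assumed estimate.
    With h = s/(2 sigma), the term 2 h^2 sigma^2 is the Gaussian exponent s^2/2. *)
Lemma log_mgf_bound (n p : nat) (h H lP : R) : (1 + p < n)%N -> 0 < h -> h <= H ->
  2 * h <= n%:R ->
  let t := 2 * h / n%:R in
  let q := n%:R - 1 - p%:R in
  `|lP - - (n%:R * p%:R / 2 * ln (1 + t)) -
    \sum_(k < p) (h * ln (2 / (1 + t)) + gammalog ((n%:R - 1 - k%:R) / 2) h)| <=
    \sum_(k < p) (H ^+ 2 + H + 1) * h * 2 / ((n%:R - 1 - k%:R) / 2) ^+ 2 ->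
  `|- t * mu_n n p + h * p%:R * (1 - ln n%:R) + lP - 2 * h ^+ 2 * sigma2_n n p| <=
  asym_const H * (h / q).
Proof.
move=> pn h0 hH hn t q; set N : R := n%:R - 1.
have q1 : 1 <= q.
  rewrite /q -addrA -opprD lerBrDr -[1]/(1%:R) -!natrD ler_nat.
  by move: pn; rewrite -ltnS; lia.
have q0 : 0 < q by exact: lt_le_trans q1.
have p0 : 0 <= p%:R :> R by [].
have N0 : 0 < N by rewrite /N; move: q0 p0; rewrite /q; lra.
have n0 : 0 < n%:R :> R by move: N0; rewrite /N; lra.
have qN : q = N - p%:R by [].
have [s1 s2 s3] := log_sums (N := N) (p := p) q1.
rewrite -qN in s1 s2 s3.
have t0 : 0 <= t by rewrite divr_ge0// ltW// mulr_gt0.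
have t1 : t <= 1 by rewrite ler_pdivrMr// mul1r.
have u0 : 0 < 1 + t by rewrite ltr_wpDr.
have Nk (k : 'I_p) : 0 < N - k%:R.
  have : (k%:R : R) <= p%:R by rewrite ler_nat ltnW.
  by move: q0; rewrite qN; lra.
set S1 := \sum_(k < p) ln (N - k%:R) in s1.
set S2 := \sum_(k < p) (N - k%:R)^-1 in s2.
set S3 := \sum_(k < p) _ in s3.
have -> : \sum_(k < p) (h * ln (2 / (1 + t)) + gammalog ((N - k%:R) / 2) h) =
    - (h * p%:R * ln (1 + t)) + h * S1 + (h ^+ 2 - h) * S2.
  transitivity (\sum_(k < p) (- (h * ln (1 + t)) + h * ln (N - k%:R) + (h ^+ 2 - h) * (N - k%:R)^-1)).
    apply: eq_bigr => k _; rewrite /gammalog ln_div ?posrE// ln_div ?posrE//.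
    have -> : (h ^+ 2 - h) / (2 * ((N - k%:R) / 2)) = (h ^+ 2 - h) * (N - k%:R)^-1.
      by field; rewrite gt_eqF.
    by ring.
  rewrite !big_split/= -!mulr_sumr; congr (_ + _ + _).
  by rewrite sumr_const card_ord -mulr_natl; ring.
have -> : \sum_(k < p) (H ^+ 2 + H + 1) * h * 2 / ((N - k%:R) / 2) ^+ 2 =
    8 * (H ^+ 2 + H + 1) * h * S3.
  rewrite /S3 mulr_sumr; apply: eq_bigr => k _; field.
  by rewrite gt_eqF.
set T := ln (1 + t); set E1 := _ - _ - _ => hE1.
have hT := ln1D_mul_bound t0 t1; rewrite -/T in hT.
(* As h = nt/2, the logarithms of 1 + t coming from the moment of order 0 and from the ratios
   combine to (np/2)(1 + t) ln(1 + t); [rho] is its cubic remainder. *)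
set rho := (1 + t) * T - _ in hT.
pose A := ln N; pose B := ln q; pose l := ln (n%:R : R).
have lE : l = A + ln (1 + N^-1).
  by rewrite /l /A -lnS// /N subrK.
have mu : mu_n n p = - (1/4) * (n%:R * (2 * n%:R - 2 * p%:R - 3) * (B - A) + 2 * (n%:R + 1) * p%:R).
  rewrite /mu_n -/N; congr (- (1/4) * (_ * _ + _)).
  by rewrite -ln_div ?posrE//; congr ln; rewrite qN; field; rewrite gt_eqF.
have sg : sigma2_n n p = - (1/2) * (p%:R / N + (B - A)).
  rewrite /sigma2_n -/N; congr (- (1/2) * (_ + _)).
  by rewrite -ln_div ?posrE//; congr ln; rewrite qN; field; rewrite gt_eqF.
(* An exact identity: once the Stirling terms are inserted, all main terms cancel against [mu_n] and
   [sigma2_n], and six errors remain. *)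
have key : - t * mu_n n p + h * p%:R * (1 - ln n%:R) + lP - 2 * h ^+ 2 * sigma2_n n p =
   E1 + h * (S1 - (stirling N - stirling q)) + (h ^+ 2 - h) * (S2 - (A - B)) -
   n%:R * p%:R / 2 * rho + h * p%:R * (n%:R^-1 - ln (1 + N^-1)) + h ^+ 2 * p%:R / (n%:R * N).
  rewrite mu sg -/l lE /E1 /rho /stirling -/A -/B /t qN.
  have -> : n%:R = N + 1 by rewrite /N subrK.
  field.
  by rewrite !gt_eqF// addr_gt0.
rewrite key.
have hq : 0 <= h / q by rewrite divr_ge0// ltW.
set z := q^-1 in s1 s2 s3 *.
have z0 : 0 < z by rewrite invr_gt0.
have Ni : 0 < N^-1 by rewrite invr_gt0.
have Nz : N^-1 <= z by rewrite lef_pV2 ?posrE// qN; lra.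
have pN : p%:R <= N by move: q0; rewrite qN; lra.
have H0 : 0 < H by exact: lt_le_trans hH.
have hz : 0 < h * z by rewrite mulr_gt0.
have b1 : `|E1| <= 16 * (H ^+ 2 + H + 1) * (h * z).
  apply: le_trans hE1 _.
  have : S3 <= 2 * z by lra.
  have C0 : 0 <= 8 * (H ^+ 2 + H + 1) * h.
    apply: mulr_ge0; last exact: ltW.
    by apply: mulr_ge0 => //; rewrite !addr_ge0 ?sqr_ge0// ltW.
  by move/(ler_wpM2l C0); lra.
have b2 : `|h * (S1 - (stirling N - stirling q))| <= h * z.
  by rewrite normrM (gtr0_norm h0) ler_wpM2l ?(ltW h0)//; lra.
have b3 : `|(h ^+ 2 - h) * (S2 - (A - B))| <= 2 * (H + 1) * (h * z).
  have : `|S2 - (A - B)| <= 2 * z by rewrite /A /B; lra.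
  have : `|h ^+ 2 - h| <= h * (H + 1).
    rewrite (_ : h ^+ 2 - h = h * (h - 1)); last by ring.
    rewrite normrM (gtr0_norm h0) ler_wpM2l ?(ltW h0)//.
    by rewrite (le_trans (ler_normB _ _))// normr1 gtr0_norm// lerD2r.
  move=> c1 c2; rewrite normrM (le_trans (ler_pM _ _ c1 c2))//; lra.
have ni : n%:R^-1 <= z by rewrite lef_pV2 ?posrE//; move: N0; rewrite qN /N; lra.
have pn1 : p%:R / n%:R <= 1 :> R.
  by rewrite ler_pdivrMr// mul1r; move: pN N0; rewrite /N; lra.
have pn0 : 0 <= p%:R / n%:R :> R by rewrite divr_ge0// ltW.
have hh2 : h ^+ 2 <= H ^+ 2 by apply: lerXn2r => //; rewrite nnegrE; exact: ltW.
have b4 : `|n%:R * p%:R / 2 * rho| <= 4 * H ^+ 2 * (h * z).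
  rewrite normrM ger0_norm; last by rewrite !mulr_ge0// ltW.
  have c0 : 0 <= n%:R * p%:R / 2 :> R by rewrite !mulr_ge0// ltW.
  apply: le_trans (ler_wpM2l c0 hT) _.
  have -> : n%:R * p%:R / 2 * t ^+ 3 = 4 * ((p%:R / n%:R) * (n%:R^-1 * (h ^+ 2 * h))).
    by rewrite /t; field; rewrite gt_eqF.
  have d1 : h ^+ 2 * h <= H ^+ 2 * h by rewrite ler_wpM2r ?(ltW h0).
  have d0 : 0 <= h ^+ 2 * h by rewrite mulr_ge0 ?sqr_ge0 ?(ltW h0).
  have n1 : 0 <= n%:R^-1 :> R by rewrite invr_ge0 ltW.
  have d2 : n%:R^-1 * (h ^+ 2 * h) <= z * (H ^+ 2 * h) by apply: ler_pM.
  have d3 : p%:R / n%:R * (n%:R^-1 * (h ^+ 2 * h)) <= 1 * (z * (H ^+ 2 * h)).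
    by apply: ler_pM => //; exact: mulr_ge0.
  lra.
have b5 : `|h * p%:R * (n%:R^-1 - ln (1 + N^-1))| <= h * z.
  rewrite -mulrA normrM (gtr0_norm h0) ler_wpM2l ?(ltW h0)//.
  have l1 := ln1D_ge (ltW Ni); have l2 := ln1D_le_id (ltW Ni).
  have e : n%:R^-1 = N^-1 - n%:R^-1 * N^-1 :> R.
    have -> : n%:R = N + 1 by rewrite /N subrK.
    by field; rewrite !gt_eqF// addr_gt0.
  have nN : n%:R^-1 <= N^-1 :> R by rewrite lef_pV2 ?posrE// /N; lra.
  have nN2 : n%:R^-1 * N^-1 <= N^-1 ^+ 2 by rewrite expr2 ler_wpM2r ?(ltW Ni).
  have nN0 : 0 <= n%:R^-1 * N^-1 by rewrite mulr_ge0 ?invr_ge0// ltW.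
  have : `|n%:R^-1 - ln (1 + N^-1)| <= N^-1 ^+ 2.
    by rewrite e ler_norml; have := sqr_ge0 N^-1; move=> ?; apply/andP; split; lra.
  move=> c1; rewrite normrM ger0_norm//.
  apply: le_trans (ler_pM p0 (normr_ge0 _) pN c1) _.
  by rewrite expr2 mulrA divff ?gt_eqF// mul1r.
have b6 : `|h ^+ 2 * p%:R / (n%:R * N)| <= H * (h * z).
  rewrite ger0_norm; last by rewrite divr_ge0 ?mulr_ge0 ?sqr_ge0// ltW.
  have -> : h ^+ 2 * p%:R / (n%:R * N) = h * (h * ((p%:R / n%:R) * N^-1)).
    by field; rewrite !gt_eqF.
  have -> : H * (h * z) = h * (H * (1 * z)) by ring.
  rewrite ler_wpM2l ?(ltW h0)//; apply: ler_pM => //; first exact: ltW.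
    by rewrite mulr_ge0// ltW.
  by apply: ler_pM => //; exact: ltW.
rewrite /asym_const -[h / q]/(h * z).
move: b1 b2 b3 b4 b5 b6; set X1 := E1; set X2 := h * (S1 - _); set X3 := _ * (S2 - _).
set X4 := _ / 2 * rho; set X5 := h * p%:R * _; set X6 := _ / (n%:R * N).
rewrite !ler_norml => /andP[? ?] /andP[? ?] /andP[? ?] /andP[? ?] /andP[? ?] /andP[? ?].
apply/andP; split; lra.
Qed.

End asymptotics.

(** * Convergence of one-sided exponential moments *)

Section trigonometric_bounds.
Context {R : realType}.
Implicit Types x y d : R.

Lemma expR_sub1_bound y : `|expR y - 1 - y| <= y ^+ 2 * expR `|y|.
Proof.
have e1 := expR_ge1Dx y.
have e2 : expR y - 1 <= y * expR y.
  have := ler_wpM2l (expR_ge0 y) (expR_ge1Dx (- y)).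
  by rewrite -expRD subrr expR0; lra.
rewrite ger0_norm; last lra.
have [y0|y0] := leP 0 y.
  rewrite ger0_norm//; have := ler_wpM2l y0 e2; rewrite mulrA -expr2; lra.
have := ler_wnM2l (ltW y0) e1 => h1.
have : y ^+ 2 <= y ^+ 2 * expR `|y|.
  by rewrite ler_peMr ?sqr_ge0// -[leLHS]expR0 ler_expR.
apply: le_trans; rewrite expr2; lra.
Qed.

Lemma ge0_derive_ge0 (f f' : R -> R) x : 0 <= x -> f 0 = 0 ->
  (forall u : R, 0 <= u -> is_derive u (1:R) f (f' u)) ->
  (forall u : R, 0 <= u -> 0 <= f' u) -> 0 <= f x.
Proof. by move=> x0 f0 df f'0; rewrite -[leLHS]f0; exact: (ge0_derive_le x0 df f'0). Qed.

Lemma sin_le_id x : 0 <= x -> sin x <= x.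
Proof.
move=> x0; rewrite -subr_ge0.
have df (u : R) : 0 <= u -> is_derive u (1:R) (fun u => u - sin u) (1 - cos u).
  by move=> _; have := derB (derid u) (is_derive_sin u).
apply: (ge0_derive_ge0 x0 _ df); first by rewrite sin0 subrr.
by move=> u _; rewrite subr_ge0 cos_le1.
Qed.

Lemma cos_ge_quad x : 0 <= x -> 1 - x ^+ 2 / 2 <= cos x.
Proof.
move=> x0; rewrite -subr_ge0 expr2.
have df (u : R) : 0 <= u ->
    is_derive u (1:R) (fun u => cos u - (1 - u * u * 2^-1)) (u - sin u).
  move=> _; have := derB (is_derive_cos u) (derB (dercst 1 u)
    (derM (derM (derid u) (derid u)) (dercst 2^-1 u))).
  by move/is_derive_eq; apply; field.
apply: (ge0_derive_ge0 x0 _ df); first by rewrite cos0 !mul0r subr0 subrr.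
by move=> u u0; rewrite subr_ge0; exact: sin_le_id.
Qed.

Lemma sin_ge_third x : 0 <= x -> x <= 2 -> x / 3 <= sin x.
Proof.
move=> x0 x2.
have : x - x * x * x * 6^-1 <= sin x.
  rewrite -subr_ge0.
  have df (u : R) : 0 <= u -> is_derive u (1:R)
      (fun u => sin u - (u - u * u * u * 6^-1)) (cos u - (1 - u ^+ 2 / 2)).
    move=> _; have := derB (is_derive_sin u) (derB (derid u)
      (derM (derM (derM (derid u) (derid u)) (derid u)) (dercst 6^-1 u))).
    by move/is_derive_eq; apply; field.
  apply: (ge0_derive_ge0 x0 _ df); first by rewrite sin0 !mul0r !subr0.
  by move=> u u0; rewrite subr_ge0; exact: cos_ge_quad.
apply: le_trans; have : x * x * x <= 4 * x; last lra.
by rewrite ler_wpM2r//; nra.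
Qed.

Lemma pi_half_le2 : pi / 2 <= 2 :> R.
Proof. by have /andP[_ /ltW] := pihalf_02 R. Qed.

(* For a > b in [-pi/2, pi/2], sin a - sin b = 2 cos((a+b)/2) sin((a-b)/2) and
   the cosine is at least sin((a-b)/2). *)
Lemma sin_diff_ge (a b : R) : - (pi / 2) <= b -> b <= a -> a <= pi / 2 ->
  (a - b) ^+ 2 / 18 <= sin a - sin b.
Proof.
move=> b1 ba a1.
pose m := (a + b) / 2; pose d := (a - b) / 2.
have d0 : 0 <= d by rewrite /d; lra.
have ph := pi_half_le2.
have d2 : d <= 2 by rewrite /d; lra.
have -> : sin a - sin b = 2 * (cos m * sin d).
  have -> : a = m + d by rewrite /m /d; field.
  have -> : b = m - d by rewrite /m /d; field.
  by rewrite sinD sinB; ring.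
have sd := sin_ge_third d0 d2.
have p0 : 0 < pi / 2 :> R by have /andP[] := pihalf_02 R.
have cmono (u v : R) : 0 <= u -> u <= v -> v <= pi / 2 -> cos v <= cos u.
  move=> u0 uv v1; rewrite leNgt ltr_cos ?in_itv/= -?leNgt//; apply/andP; split; lra.
have cm : sin d <= cos m.
  rewrite -cosBpihalf -cosN opprB.
  have [m0|m0] := leP 0 m; first by apply: cmono => //; rewrite /m /d; lra.
  by rewrite -(cosN m); apply: cmono; move: m0; rewrite /m /d; lra.
have sd0 : 0 <= sin d by apply: le_trans sd; rewrite divr_ge0.
have : sin d * sin d <= cos m * sin d by rewrite ler_wpM2r.
have d3 : 0 <= d / 3 by rewrite divr_ge0.
have : d / 3 * (d / 3) <= sin d * sin d by rewrite ler_pM.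
have -> : (a - b) ^+ 2 = 4 * d ^+ 2 by rewrite /d; field.
by rewrite expr2; lra.
Qed.

(** Either x = |a - b| is at most e, or x <= x^4 / e^3, which [sin_diff_ge] bounds by the second
    term; 324 is 18^2. The square of a difference of sines is the form that a Bernstein variance can
    integrate. *)
Lemma sin_modulus (e a b : R) : 0 < e -> `|a| <= pi / 2 -> `|b| <= pi / 2 ->
  `|a - b| <= e + 324 / e ^+ 3 * (sin a - sin b) ^+ 2.
Proof.
move=> e0; wlog ba : a b / b <= a.
  move=> H ha hb; have [|ab] := leP b a; first by move=> h; exact: H.
  by rewrite distrC -sqrrN opprB; apply: H => //; exact: ltW.
rewrite 2!ler_norml => /andP[a1 a2] /andP[b1 b2].
have := sin_diff_ge b1 ba a2; set D := sin a - sin b.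
rewrite ger0_norm ?subr_ge0//; set x := a - b => h.
have x0 : 0 <= x by rewrite subr_ge0.
have [xe|ex] := leP x e.
  rewrite (le_trans xe)// lerDl; apply: mulr_ge0; last exact: sqr_ge0.
  by apply: divr_ge0; [exact: ler0n|apply: exprn_ge0; exact: ltW].
have : x <= 324 / e ^+ 3 * D ^+ 2; last by lra.
have h2 : (x ^+ 2 / 18) ^+ 2 <= D ^+ 2.
  by apply: lerXn2r => //; rewrite nnegrE ?divr_ge0 ?sqr_ge0// (le_trans _ h)// divr_ge0 ?sqr_ge0.
rewrite mulrAC ler_pdivlMr ?exprn_gt0//.
have : x * e ^+ 3 <= x * x ^+ 3.
  by rewrite ler_wpM2l//; apply: lerXn2r; rewrite ?nnegrE// ltW.
move: h2; rewrite (_ : (x ^+ 2 / 18) ^+ 2 = x * x ^+ 3 / 324); last by field.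
by lra.
Qed.

(** For i >= m, |y|^i <= 2^(-m) (2|y|)^i. The error is thus small uniformly, at the cost of
    exponential growth only, which the tilt can absorb. *)
Lemma sin_taylor y (m : nat) :
  `|sin y - \sum_(0 <= i < m) sin_coeff y i| <= 2^-1 ^+ m * expR (2 * `|y|).
Proof.
have cv : series (sin_coeff y) M @[M --> \oo] --> sin y.
  by rewrite sin.unlock; exact: is_cvg_series_sin_coeff.
have bd M : (m <= M)%N ->
    `|series (sin_coeff y) M - series (sin_coeff y) m| <= 2^-1 ^+ m * expR (2 * `|y|).
  move=> mM; rewrite sub_series_geq// (le_trans (ler_norm_sum _ _ _))//.
  have c i : (m <= i)%N -> `|sin_coeff y i| <= 2^-1 ^+ m * exp_coeff (2 * `|y|) i.
    move=> mi; pose A := `|y| ^+ i / i`!%:R.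
    have A0 : 0 <= A by rewrite divr_ge0// exprn_ge0.
    have h1 : `|sin_coeff y i| <= A.
      rewrite /sin_coeff/= normrM normrM normrM normfV !normrX normrN normr1 expr1n.
      rewrite mulr1 !normr_nat -mulrA -/A; case: (odd i); first by rewrite mul1r.
      by rewrite mul0r.
    have -> : exp_coeff (2 * `|y|) i = 2 ^+ i * A.
      by rewrite /exp_coeff /= exprMn mulrA.
    rewrite mulrA (le_trans h1)// ler_peMl// exprVn mulrC ler_pdivlMr ?exprn_gt0// mul1r.
    by rewrite ler_eXn2l// ltr1n.
  apply: (@le_trans _ _ (\sum_(m <= i < M) 2^-1 ^+ m * exp_coeff (2 * `|y|) i)).
    by apply: ler_sum_nat => i /andP[mi _]; exact: c.
  rewrite -mulr_sumr ler_wpM2l ?exprn_ge0//.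
  have e0 i : 0 <= exp_coeff (2 * `|y|) i by rewrite exp_coeff_ge0// mulr_ge0.
  apply: (@le_trans _ _ (series (exp_coeff (2 * `|y|)) M)).
    by rewrite -[leRHS](subrKC (series (exp_coeff (2 * `|y|)) m)) sub_series_geq// lerDr /series/= sumr_ge0.
  rewrite /expR; apply: nondecreasing_cvgn_le; last exact: is_cvg_series_exp_coeff.
  exact: nondecreasing_series.
have cvn : `|series (sin_coeff y) M - series (sin_coeff y) m| @[M --> \oo] -->
    `|sin y - series (sin_coeff y) m|.
  by apply: cvg_norm; apply: cvgB => //; exact: cvg_cst.
rewrite -(cvg_lim _ cvn)//; apply: limr_le; first by apply/cvg_ex; eexists; exact: cvn.
by near=> M; apply: bd; near: M; exact: nbhs_infty_ge.
Unshelve. all: by end_near. Qed.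

End trigonometric_bounds.

(** * Monotone linear functionals and the test functions on which they converge *)

Section weighted_functionals.
Context {R : realType}.
Implicit Types (f g q : R -> R) (a b s x : R).

Definition expw a b x : R := expR (a * x) + expR (b * x).

Lemma expw_gt0 a b x : 0 < expw a b x.
Proof. by rewrite addr_gt0// expR_gt0. Qed.

(** Only positive exponents are allowed, since these are the only moments known to converge. Such
    functions decay exponentially on the left, and nonzero constants are excluded. *)
Definition exp_dominated f := measurable_fun setT f /\
  exists C a b, [/\ 0 < a, 0 < b & forall x, `|f x| <= C * expw a b x].

Lemma expw_le a b a' b' x : a' <= a -> a <= b' -> a' <= b -> b <= b' ->
  expw a b x <= 2 * expw a' b' x.
Proof.
have key c : a' <= c -> c <= b' -> expR (c * x) <= expw a' b' x.
  move=> c1 c2; have [x0|x0] := leP 0 x.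
    have : expR (c * x) <= expR (b' * x) by rewrite ler_expR ler_wpM2r.
    by move/le_trans; apply; rewrite lerDr expR_ge0.
  have : expR (c * x) <= expR (a' * x) by rewrite ler_expR ler_wnM2r// ltW.
  by move/le_trans; apply; rewrite lerDl expR_ge0.
move=> h1 h2 h3 h4; have := key a h1 h2; have := key b h3 h4.
by rewrite /expw; lra.
Qed.

Lemma exp_dominatedP f : exp_dominated f ->
  exists C a b, [/\ 0 <= C, 0 < a, 0 < b & forall x, `|f x| <= C * expw a b x].
Proof.
move=> [_ [C [a [b [a0 b0 h]]]]]; exists `|C|, a, b; split=> // x.
by rewrite (le_trans (h x))// ler_wpM2r ?ler_norm// ltW// expw_gt0.
Qed.

Lemma exp_dominatedD f g : exp_dominated f -> exp_dominated g ->
  exp_dominated (fun x => f x + g x).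
Proof.
move=> hf hg; split; first by apply: measurable_funD; [exact: hf.1|exact: hg.1].
have [C [a [b [C0 a0 b0 h]]]] := exp_dominatedP hf.
have [C' [a' [b' [C'0 a'0 b'0 h']]]] := exp_dominatedP hg.
exists (2 * (C + C')), (Num.min (Num.min a b) (Num.min a' b')), (Num.max (Num.max a b) (Num.max a' b')).
split=> [||x]; [by rewrite !lt_min a0 b0 a'0 b'0|by rewrite !lt_max a0|].
rewrite (le_trans (ler_normD _ _))// (le_trans (lerD (h x) (h' x)))//.
rewrite (mulrC 2) -mulrA mulrDl.
by apply: lerD; apply: ler_wpM2l => //; apply: expw_le;
  rewrite ?ge_min ?le_max ?lexx ?orbT.
Qed.

Lemma exp_dominatedZ c f : exp_dominated f -> exp_dominated (fun x => c * f x).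
Proof.
move=> [mf [C [a [b [a0 b0 h]]]]]; split; first exact: measurable_funM.
by exists (`|c| * C), a, b; split=> // x; rewrite normrM -mulrA ler_wpM2l.
Qed.

Lemma measurable_expRM s : measurable_fun setT (fun x : R => expR (s * x)).
Proof.
by apply: (measurableT_comp (@measurable_expR R)); apply: measurable_funM.
Qed.

Lemma exp_dominated_expR s : 0 < s -> exp_dominated (fun x => expR (s * x)).
Proof.
move=> s0; split; first exact: measurable_expRM.
exists 1, s, s; split=> // x; rewrite ger0_norm ?expR_ge0// mul1r.
by rewrite /expw lerDl expR_ge0.
Qed.

(** The properties of integration that are used, shared by the restricted laws of the statistics and
    by the Gaussian limit. *)
Record is_functional (L : (R -> R) -> R) : Prop := IsFunctional {
  functionalD : forall f g, exp_dominated f -> exp_dominated g ->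
    L (fun x => f x + g x) = L f + L g ;
  functionalZ : forall c f, exp_dominated f -> L (fun x => c * f x) = c * L f ;
  functional_le : forall f g, exp_dominated f -> exp_dominated g ->
    (forall x, f x <= g x) -> L f <= L g }.

Lemma exp_dominatedB f g : exp_dominated f -> exp_dominated g ->
  exp_dominated (fun x => f x - g x).
Proof.
move=> hf hg; have := exp_dominatedD hf (exp_dominatedZ (-1) hg).
by under eq_fun do rewrite mulN1r.
Qed.

Lemma functionalB L f g : is_functional L -> exp_dominated f -> exp_dominated g ->
  L (fun x => f x - g x) = L f - L g.
Proof.
move=> hL hf hg; have h := exp_dominatedZ (-1) hg.
have := functionalD hL hf h; rewrite functionalZ// mulN1r => <-.
by congr L; apply/funext => x; rewrite mulN1r.
Qed.

Lemma functional_norm L f g : is_functional L -> exp_dominated f -> exp_dominated g ->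
  (forall x, `|f x| <= g x) -> `|L f| <= L g.
Proof.
move=> hL hf hg fg; rewrite ler_norml; apply/andP; split.
  rewrite -mulN1r -(functionalZ hL)//; apply: (functional_le hL) => //.
    exact: exp_dominatedZ.
  by move=> x; rewrite mulN1r; have := fg x; rewrite ler_norml => /andP[].
by apply: (functional_le hL) => // x; rewrite (le_trans (ler_norm _)).
Qed.

Variables (L : nat -> (R -> R) -> R) (L0 : (R -> R) -> R).
Hypothesis functionalL : forall n, is_functional (L n).
Hypothesis functionalL0 : is_functional L0.
Hypothesis cvg_expR : forall s, 0 < s ->
  L n (fun x => expR (s * x)) @[n --> \oo] --> L0 (fun x => expR (s * x)).

Definition cvgf f := exp_dominated f /\ L n f @[n --> \oo] --> L0 f.

Lemma cvgf_expR s : 0 < s -> cvgf (fun x => expR (s * x)).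
Proof. by move=> s0; split; [exact: exp_dominated_expR|exact: cvg_expR]. Qed.

Lemma cvgfD f g : cvgf f -> cvgf g -> cvgf (fun x => f x + g x).
Proof.
move=> [hf cf] [hg cg]; split; first exact: exp_dominatedD.
rewrite functionalD//; under eq_fun do rewrite functionalD//.
exact: cvgD.
Qed.

Lemma cvgfZ c f : cvgf f -> cvgf (fun x => c * f x).
Proof.
move=> [hf cf]; split; first exact: exp_dominatedZ.
rewrite functionalZ//; under eq_fun do rewrite functionalZ//.
by apply: cvgM => //; exact: cvg_cst.
Qed.

Lemma cvgfB f g : cvgf f -> cvgf g -> cvgf (fun x => f x - g x).
Proof.
move=> hf hg; have := cvgfD hf (cvgfZ (-1) hg).
by under eq_fun do rewrite mulN1r.
Qed.

Lemma cvgf_sum (r : seq nat) (F : nat -> R -> R) : (forall i, cvgf (F i)) ->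
  cvgf (fun x => \sum_(i <- r) F i x).
Proof.
move=> hF; elim: r => [|i r IH].
  under eq_fun do rewrite big_nil.
  by have := cvgfZ 0 (cvgf_expR ltr01); under eq_fun do rewrite mul0r.
by under eq_fun do rewrite big_cons; exact: cvgfD.
Qed.

(** Convergence on [expw a b] bounds the values there by M + 1 for large n, so an approximation in
    the norm weighted by [expw] is uniform in n. *)
Lemma cvgf_approx f a b : exp_dominated f -> 0 < a -> 0 < b ->
  (forall e, 0 < e -> exists2 g, cvgf g & forall x, `|f x - g x| <= e * expw a b x) ->
  cvgf f.
Proof.
move=> hf a0 b0 happ; split=> //.
have [hW cW] : cvgf (expw a b) by apply: cvgfD; exact: cvgf_expR.
set M := L0 (expw a b).
have M0 : 0 <= M.
  by have := functional_norm functionalL0 hW hW _; move=> /(_ (fun x => _)) h;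
    apply: le_trans (normr_ge0 _) (h _) => x; rewrite ger0_norm// ltW// expw_gt0.
apply/cvgrPdist_le => e e0.
pose e' := e / (3 * (M + 1)).
have e'0 : 0 < e' by rewrite divr_gt0// mulr_gt0// ltr_wpDl.
have [g [hg cg] fg] := happ _ e'0.
have bound K : is_functional K -> `|K f - K g| <= e' * K (expw a b).
  move=> hK; rewrite -(functionalB hK)// -(functionalZ hK)//.
  apply: functional_norm => //; [exact: exp_dominatedB|exact: exp_dominatedZ].
have e3 : e' * (M + 1) = e / 3.
  by rewrite /e'; field; rewrite gt_eqF// ltr_wpDl.
move/cvgrPdist_le : cg => /(_ (e / 3)) cg.
near=> n.
have h1 := bound _ functionalL0; have h2 := bound _ (functionalL n).
have h3 : L n (expw a b) <= M + 1.
  have : `|M - L n (expw a b)| <= 1.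
    by near: n; move/cvgrPdist_le : cW; apply.
  by rewrite ler_norml => /andP[]; lra.
have h4 : `|L0 g - L n g| <= e / 3 by near: n; apply: cg; rewrite divr_gt0.
have h5 := ler_wpM2l (ltW e'0) h3.
have -> : L0 f - L n f = (L0 f - L0 g) + (L0 g - L n g) - (L n f - L n g) by ring.
rewrite (le_trans (ler_normB _ _))// (le_trans (lerD (ler_normD _ _) (lexx _)))//.
by rewrite -/M in h1; lra.
Unshelve. all: by end_near. Qed.

Definition subexp q := measurable_fun setT q /\
  forall z, 0 < z -> exists2 C, 0 <= C & forall x, `|q x| <= C * expR (z * `|x|).

(** The condition s >= 1 leaves room to move the exponent by 1/2 either way and keep it positive;
    the approximations below spend this margin. *)
Definition tilted_cvg q := subexp q /\
  forall s, 1 <= s -> cvgf (fun x => expR (s * x) * q x).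

Lemma expR_abs_le s z x : 0 <= z -> expR (s * x) * expR (z * `|x|) <= expw (s - z) (s + z) x.
Proof.
move=> z0; rewrite -expRD /expw; have [x0|x0] := leP 0 x.
  by rewrite ger0_norm// -mulrDl lerDr expR_ge0.
by rewrite ltr0_norm// mulrN -mulrBl lerDl expR_ge0.
Qed.

Lemma subexp_dominated q s : subexp q -> 1 <= s -> exp_dominated (fun x => expR (s * x) * q x).
Proof.
move=> [mq hq] s1; split; first by apply: measurable_funM => //; exact: measurable_expRM.
have [C C0 h] := hq 2^-1 ltac:(by []).
exists C, (s - 2^-1), (s + 2^-1); split=> [||x]; [lra|lra|].
rewrite normrM (ger0_norm (expR_ge0 _)) mulrC.
apply: (@le_trans _ _ (C * (expR (s * x) * expR (2^-1 * `|x|)))).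
  rewrite [leRHS](_ : _ = C * expR (2^-1 * `|x|) * expR (s * x)); last by ring.
  by rewrite ler_wpM2r ?expR_ge0.
by rewrite ler_wpM2l// expR_abs_le.
Qed.

Lemma abs_le_expR z x : 0 < z -> `|x| <= z^-1 * expR (z * `|x|).
Proof.
move=> z0; rewrite -ler_pdivrMl ?invr_gt0// invrK.
by apply: le_trans (expR_ge1Dx _); rewrite lerDr.
Qed.

Lemma subexp_mulx q : subexp q -> subexp (fun x => x * q x).
Proof.
move=> [mq hq]; split; first exact: measurable_funM.
move=> z z0; have z2 : 0 < z / 2 by rewrite divr_gt0.
have [C C0 h] := hq _ z2; exists ((z / 2)^-1 * C) => [|x].
  by rewrite mulr_ge0// invr_ge0 ltW.
have := abs_le_expR x z2 => hx; rewrite normrM (le_trans (ler_pM _ _ hx (h x)))//.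
rewrite mulrACA -expRD; rewrite le_eqVlt; apply/orP; left; apply/eqP.
by congr (_ * expR _); field.
Qed.

(** Multiplication by x is differentiation in s: difference quotients of e^(sx) q(x) in s converge
    in the weighted norm. *)
Lemma tilted_cvg_mulx q : tilted_cvg q -> tilted_cvg (fun x => x * q x).
Proof.
move=> [sq cq]; split=> [|s s1]; first exact: subexp_mulx.
have [mq hq] := sq.
have [C C0 h] := hq 4^-1 ltac:(by []).
apply: (@cvgf_approx _ (s - 2^-1) (s + 2^-1)).
- by apply: subexp_dominated => //; exact: subexp_mulx.
- lra.
- lra.
move=> e e0.
have [c c0 x2] : exists2 c : R, 0 < c & forall x, x ^+ 2 <= c * expR (8^-1 * `|x|).
  have h16 : 0 < 16^-1 :> R by rewrite invr_gt0.
  exists (16^-1^-1 ^+ 2) => [|x]; first by rewrite exprn_gt0// invr_gt0.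
  have hx := abs_le_expR x h16.
  rewrite -real_normK ?num_real// expr2.
  apply: le_trans (ler_pM (normr_ge0 _) (normr_ge0 _) hx hx) _.
  rewrite mulrACA -expRD le_eqVlt; apply/orP; left; apply/eqP.
  by congr (_ * expR _); field.
have C1 : 0 < C + 1 by rewrite ltr_wpDl.
have cC : 0 < c * (C + 1) by rewrite mulr_gt0.
(* The margin of 1/2 is spent as 1/4 on q, 1/8 on x^2 and 1/8 on e^(dl |x|). The second argument of
   the minimum makes the factor [c * C * dl] at most e. *)
pose dl := Num.min 8^-1 (e / (c * (C + 1))).
have d0 : 0 < dl.
  by rewrite lt_min; apply/andP; split; [rewrite invr_gt0|exact: divr_gt0].
exists (fun x => dl^-1 * (expR ((s + dl) * x) * q x - expR (s * x) * q x)).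
  by apply: cvgfZ; apply: cvgfB; apply: cq => //; lra.
move=> x; have d8 : dl <= 8^-1 by rewrite ge_min lexx.
have de : c * C * dl <= e.
  have : dl <= e / (c * (C + 1)) by rewrite ge_min lexx orbT.
  rewrite ler_pdivlMr// => H; apply: le_trans H.
  by have := mulr_ge0 (ltW d0) (ltW c0); lra.
have -> : expR (s * x) * (x * q x) - dl^-1 * (expR ((s + dl) * x) * q x - expR (s * x) * q x) =
   - (expR (s * x) * q x * (dl^-1 * (expR (dl * x) - 1 - dl * x))).
  by rewrite mulrDl expRD; field; exact: lt0r_neq0.
have b1 : `|dl^-1 * (expR (dl * x) - 1 - dl * x)| <= c * dl * expR (4^-1 * `|x|).
  rewrite normrM gtr0_norm ?invr_gt0//.
  rewrite ler_pdivrMl// (le_trans (expR_sub1_bound _))//.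
  rewrite normrM (gtr0_norm d0) exprMn.
  have ed : expR (dl * `|x|) <= expR (8^-1 * `|x|) by rewrite ler_expR ler_wpM2r.
  have := ler_pM (sqr_ge0 x) (expR_ge0 _) (x2 x) ed.
  rewrite -[leRHS]mulrA -expRD -mulrDl (_ : 8^-1 + 8^-1 = 4^-1); last by field.
  move/(ler_wpM2l (sqr_ge0 dl)) => H; rewrite -[leLHS]mulrA; apply: (le_trans H).
  by rewrite le_eqVlt; apply/orP; left; apply/eqP; ring.
rewrite normrN !normrM (ger0_norm (expR_ge0 _)).
have b2 := ler_pM (normr_ge0 _) (normr_ge0 _) (h x) b1.
rewrite normrM in b2.
rewrite -mulrA; apply: le_trans (ler_wpM2l (expR_ge0 _) b2) _.
have -> : expR (s * x) * (C * expR (4^-1 * `|x|) * (c * dl * expR (4^-1 * `|x|))) =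
   (c * C * dl) * (expR (s * x) * expR (2^-1 * `|x|)).
  rewrite (_ : 2^-1 * `|x| = 4^-1 * `|x| + 4^-1 * `|x|); last by field.
  by rewrite expRD; ring.
have h12 : 0 <= 2^-1 :> R by rewrite invr_ge0.
have cd : 0 <= c * C * dl by rewrite !mulr_ge0// ltW.
by apply: ler_pM; rewrite // ?mulr_ge0 ?expR_ge0 ?expR_abs_le.
Qed.

Lemma tilted_cvg_exp q k : tilted_cvg q -> tilted_cvg (fun x => x ^+ k * q x).
Proof.
move=> hq; elim: k => [|k IH]; first by under eq_fun do rewrite expr0 mul1r.
by under eq_fun do rewrite exprS -mulrA; exact: tilted_cvg_mulx.
Qed.

(** Taylor polynomials reduce the sine to powers of x. The bound v <= 1/8 keeps their error within
    e^(|x|/4), so that together with 1/4 for q the margin of 1/2 suffices. *)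
Lemma tilted_cvg_sin q v : 0 <= v -> v <= 8^-1 -> tilted_cvg q ->
  tilted_cvg (fun x => sin (v * x) * q x).
Proof.
move=> v0 v8 hq; have [sq cq] := hq; have [mq gq] := sq.
have ss : subexp (fun x => sin (v * x) * q x).
  split.
    apply: measurable_funM => //.
    apply: (measurableT_comp (f := @sin R)); last by apply: measurable_funM.
    by apply: continuous_measurable_fun => x; exact: continuous_sin.
  move=> z z0; have [C C0 h] := gq z z0; exists C => // x.
  by rewrite normrM (le_trans _ (h x))// ler_piMl// sin_max.
split=> // s s1.
have [C C0 h] := gq 4^-1 ltac:(by []).
apply: (@cvgf_approx _ (s - 2^-1) (s + 2^-1)).
- exact: subexp_dominated.
- lra.
- lra.
move=> e e0.
have [m hm] : exists m : nat, 2^-1 ^+ m * C <= e.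
  have : (2^-1 ^+ m * C : R) @[m --> \oo] --> 0 * C.
    apply: cvgM; last exact: cvg_cst.
    by apply: cvg_expr; rewrite ger0_norm// invf_lt1// ltr1n.
  rewrite mul0r => /cvgrPdist_le/(_ _ e0)[m _ H].
  exists m; have := H m (leqnn m) => /=; rewrite sub0r normrN; apply: le_trans.
  exact: ler_norm.
pose c i : R := (odd i)%:R * (-1) ^+ i.-1./2 * v ^+ i / i`!%:R.
exists (fun x => \sum_(i <- index_iota 0 m) c i * (expR (s * x) * (x ^+ i * q x))).
  by apply: cvgf_sum => i; apply: cvgfZ; exact: (tilted_cvg_exp i hq).2.
move=> x.
have -> : \sum_(i <- index_iota 0 m) c i * (expR (s * x) * (x ^+ i * q x)) =
    expR (s * x) * q x * \sum_(0 <= i < m) sin_coeff (v * x) i.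
  rewrite mulr_sumr; apply: eq_bigr => i _.
  by rewrite /c /sin_coeff/= exprMn; ring.
rewrite (_ : _ - _ = expR (s * x) * q x * (sin (v * x) - \sum_(0 <= i < m) sin_coeff (v * x) i));
  last by ring.
have b1 := sin_taylor (v * x) m.
have b2 : expR (2 * `|v * x|) <= expR (4^-1 * `|x|).
  rewrite ler_expR normrM (ger0_norm v0) mulrA ler_wpM2r//; lra.
have h2m : 0 <= 2^-1 ^+ m :> R by rewrite exprn_ge0.
have b3 := le_trans b1 (ler_wpM2l h2m b2).
rewrite !normrM (ger0_norm (expR_ge0 _)) -mulrA.
have b4 := ler_pM (normr_ge0 _) (normr_ge0 _) (h x) b3.
apply: le_trans (ler_wpM2l (expR_ge0 _) b4) _.
have -> : expR (s * x) * (C * expR (4^-1 * `|x|) * (2^-1 ^+ m * expR (4^-1 * `|x|))) =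
   (2^-1 ^+ m * C) * (expR (s * x) * expR (2^-1 * `|x|)).
  rewrite (_ : 2^-1 * `|x| = 4^-1 * `|x| + 4^-1 * `|x|); last by field.
  by rewrite expRD; ring.
have h12 : 0 <= 2^-1 :> R by rewrite invr_ge0.
have cd : 0 <= 2^-1 ^+ m * C by rewrite mulr_ge0.
by apply: ler_pM; rewrite // ?mulr_ge0 ?expR_ge0 ?expR_abs_le.
Qed.

End weighted_functionals.

(** * Bernstein polynomials and approximation of Lipschitz functions *)

Section bernstein.
Context {R : realType}.
Implicit Types (u w c : R).

Definition bern N u k : R := 'C(N, k)%:R * (u ^+ k * (1 - u) ^+ (N - k)).

Lemma bern_ge0 N u k : 0 <= u -> u <= 1 -> 0 <= bern N u k.
Proof. by move=> u0 u1; rewrite !mulr_ge0 ?exprn_ge0 ?subr_ge0. Qed.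

(** Pascal's rule: a binomial mean with N + 1 trials, conditioned on the outcome of one trial. *)
Lemma bern_step N u (f : nat -> R) :
  \sum_(0 <= k < N.+2) f k * bern N.+1 u k =
  u * (\sum_(0 <= k < N.+1) f k.+1 * bern N u k) +
  (1 - u) * (\sum_(0 <= k < N.+1) f k * bern N u k).
Proof.
rewrite !mulr_sumr.
have -> : \sum_(0 <= k < N.+1) (1 - u) * (f k * bern N u k) =
    \sum_(0 <= k < N.+2) (1 - u) * (f k * bern N u k).
  by rewrite [RHS]big_nat_recr//= /bern bin_small// !mul0r !mulr0 addr0.
rewrite [LHS]big_nat_recl// [X in _ = _ + X]big_nat_recl// [RHS]addrCA.
congr (_ + _).
  by rewrite /bern !bin0 !subn0 exprS; ring.
rewrite -big_split/= !big_nat; apply: eq_bigr => k /andP[_ kN].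
rewrite /bern binS natrD subSS.
have [kN'|kN'] := ltnP k N.
  by rewrite -(subnSK kN') !exprS; ring.
by rewrite bin_small// exprS; ring.
Qed.

Lemma bern_sum N u : \sum_(0 <= k < N.+1) bern N u k = 1.
Proof.
elim: N => [|N IH]; first by rewrite big_nat1 /bern bin0 !expr0 !mulr1.
under eq_bigr do rewrite -[bern _ _ _]mul1r.
rewrite (bern_step N u (fun=> 1)); under eq_bigr do rewrite mul1r.
by rewrite IH; ring.
Qed.

(** Binomial variance plus squared bias. The centre [c] is arbitrary because the induction shifts it
    by one. *)
Lemma bern_sqr N u c : \sum_(0 <= k < N.+1) (k%:R - c) ^+ 2 * bern N u k =
  N%:R * u * (1 - u) + (N%:R * u - c) ^+ 2.
Proof.
elim: N c => [|N IH] c.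
  by rewrite big_nat1 /bern bin0 !expr0; ring.
rewrite (bern_step N u (fun k => (k%:R - c) ^+ 2)) IH.
have E k : k.+1%:R - c = k%:R - (c - 1) by rewrite -addn1 natrD; ring.
under eq_bigr => k _ do rewrite E.
by rewrite IH (_ : N.+1%:R = N%:R + 1 :> R) ?natr1//; ring.
Qed.

Lemma bern_var N u : (0 < N)%N -> 0 <= u -> u <= 1 ->
  \sum_(0 <= k < N.+1) (k%:R / N%:R - u) ^+ 2 * bern N u k <= (4 * N%:R)^-1.
Proof.
move=> N0 u0 u1; have N0' : 0 < N%:R :> R by rewrite ltr0n.
have -> : \sum_(0 <= k < N.+1) (k%:R / N%:R - u) ^+ 2 * bern N u k =
    (N%:R ^+ 2)^-1 * \sum_(0 <= k < N.+1) (k%:R - N%:R * u) ^+ 2 * bern N u k.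
  rewrite mulr_sumr; apply: eq_bigr => k _.
  by field; rewrite gt_eqF.
rewrite bern_sqr subrr expr0n/= addr0.
have -> : (N%:R ^+ 2)^-1 * (N%:R * u * (1 - u)) = N%:R^-1 * (u * (1 - u)).
  by field; rewrite gt_eqF.
rewrite invfM mulrC ler_wpM2r ?invr_ge0 ?(ltW N0')//.
by have := sqr_ge0 (2 * u - 1); rewrite expr2; lra.
Qed.

End bernstein.

Section tilted_lipschitz.
Context {R : realType}.
Variables (L : nat -> (R -> R) -> R) (L0 : (R -> R) -> R).
Hypothesis functionalL : forall n, is_functional (L n).
Hypothesis functionalL0 : is_functional L0.
Hypothesis cvg_expR : forall s, 0 < s ->
  L n (fun x => expR (s * x)) @[n --> \oo] --> L0 (fun x => expR (s * x)).
Notation cvgf := (cvgf L L0).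
Notation tilted_cvg := (tilted_cvg L L0).

Lemma tilted_cvg1 : tilted_cvg (fun=> 1).
Proof.
split=> [|s s1]; last first.
  by under eq_fun do rewrite mulr1; apply: cvgf_expR => //; exact: lt_le_trans s1.
split=> // z z0; exists 1 => // x; rewrite normr1 mul1r -[leLHS]expR0 ler_expR.
by rewrite mulr_ge0// ltW.
Qed.

Lemma tilted_cvgZ c q : tilted_cvg q -> tilted_cvg (fun x => c * q x).
Proof.
move=> [[mq hq] cq]; split=> [|s s1]; last first.
  under eq_fun do rewrite mulrCA.
  by apply: cvgfZ => //; exact: cq.
split=> [|z z0]; first exact: measurable_funM.
have [C C0 h] := hq z z0; exists (`|c| * C) => [|x]; first by rewrite mulr_ge0.
by rewrite normrM -mulrA ler_wpM2l.
Qed.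

Lemma tilted_cvgD q q' : tilted_cvg q -> tilted_cvg q' ->
  tilted_cvg (fun x => q x + q' x).
Proof.
move=> [[mq hq] cq] [[mq' hq'] cq']; split=> [|s s1]; last first.
  under eq_fun do rewrite mulrDr.
  by apply: cvgfD => //; [exact: cq|exact: cq'].
split=> [|z z0]; first exact: measurable_funD.
have [C C0 h] := hq z z0; have [C' C'0 h'] := hq' z z0.
exists (C + C') => [|x]; first by rewrite addr_ge0.
by rewrite mulrDl (le_trans (ler_normD _ _))// lerD.
Qed.

Definition sinu (v x : R) : R := (1 + sin (v * x)) / 2.

Lemma sinu01 v x : 0 <= sinu v x <= 1.
Proof.
have := sin_max (v * x); rewrite ler_norml => /andP[h1 h2].
by rewrite /sinu; apply/andP; split; lra.
Qed.

Lemma tilted_cvg_sinu v q : 0 <= v -> v <= 8^-1 -> tilted_cvg q ->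
  tilted_cvg (fun x => sinu v x * q x).
Proof.
move=> v0 v8 hq.
have := tilted_cvgZ 2^-1 (tilted_cvgD hq
  (tilted_cvg_sin functionalL functionalL0 cvg_expR v0 v8 hq)).
by congr tilted_cvg; apply/funext => x; rewrite /sinu; ring.
Qed.

Lemma tilted_cvg_cosinu v q : 0 <= v -> v <= 8^-1 -> tilted_cvg q ->
  tilted_cvg (fun x => (1 - sinu v x) * q x).
Proof.
move=> v0 v8 hq; have := tilted_cvgD hq (tilted_cvgZ (-1) (tilted_cvg_sinu v0 v8 hq)).
by congr tilted_cvg; apply/funext => x; ring.
Qed.

Lemma tilted_cvg_bern v N k : 0 <= v -> v <= 8^-1 ->
  tilted_cvg (fun x => bern N (sinu v x) k).
Proof.
move=> v0 v8; apply: tilted_cvgZ; elim: k (N - k)%N => [|k IH] m.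
  under eq_fun do rewrite expr0 mul1r.
  elim: m => [|m IH]; first exact: tilted_cvg1.
  by under eq_fun do rewrite exprS; exact: tilted_cvg_cosinu.
by under eq_fun do rewrite exprS -mulrA; exact: tilted_cvg_sinu.
Qed.

(* Off [-M, M] the tilt e^x is small compared with e^(x/2) + e^(2x); on
   [-M, M] the function G is approximated by a Bernstein polynomial in
   (1 + sin (v x)) / 2 with v = pi / (2 M). *)
Lemma cvgf_lipschitz (G : R -> R) (B K : R) : 0 <= B -> 0 <= K ->
  measurable_fun setT G ->
  (forall x, `|G x| <= B) -> (forall x y, `|G x - G y| <= K * `|x - y|) ->
  cvgf (fun x => expR x * G x).
Proof.
move=> B0 K0 mG GB GK.
have hd : exp_dominated (fun x => expR x * G x).
  split; first by apply: measurable_funM => //; exact: measurable_expR.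
  exists B, 1, 1; split=> // x; rewrite normrM ger0_norm ?expR_ge0// mulrC.
  rewrite ler_pM// ?expR_ge0// /expw mul1r; have := expR_ge0 x; lra.
apply: (@cvgf_approx _ _ _ functionalL functionalL0 cvg_expR _ 2^-1 2) => // e e0.
(* The term 16 gives v <= 1/8, as pi/2 <= 2; the term 4B/e makes e^(-M/2) 2B at most e. *)
pose M := 16 + 4 * B / e.
have M16 : 16 <= M by rewrite lerDl divr_ge0 ?mulr_ge0// ltW.
have M0 : 0 < M by lra.
pose v : R := pi / 2 / M.
have p0 : 0 < pi / 2 :> R by have /andP[] := pihalf_02 R.
have v0 : 0 < v by rewrite divr_gt0.
have vM : v * M = pi / 2 by rewrite /v divfK// gt_eqF.
have v8 : v <= 8^-1.
  rewrite ler_pdivrMr//; have : pi / 2 <= 2 :> R := pi_half_le2; lra.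
(* [sin_modulus] costs ep twice, once as threshold and once through the variance, for which N is
   taken large; K/v times 2 ep is then at most e/2. *)
pose ep := e * v / (4 * (K + 1)).
have K1 : 0 < K + 1 by lra.
have ep0 : 0 < ep.
  rewrite /ep; apply: divr_gt0; apply: mulr_gt0 => //.
have Kep : K / v * (2 * ep) <= e / 2.
  have -> : K / v * (2 * ep) = e / 2 * (K / (K + 1)).
    by rewrite /ep; field; rewrite !gt_eqF.
  rewrite ler_piMr ?ler_pdivrMr ?mul1r ?lerDl// ltW// divr_gt0//.
pose c := 324 / ep ^+ 3.
have c0 : 0 < c by apply: divr_gt0; [rewrite ltr0n|exact: exprn_gt0].
pose N := (Num.truncn (c / ep)).+1.
have N0 : 0 < N%:R :> R by rewrite ltr0n.
have cN : c / N%:R <= ep.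
  rewrite ler_pdivrMr// mulrC -ler_pdivrMr// ltW//.
  by have /andP[_] := truncn_itv (ltW (divr_gt0 c0 ep0)).
(* The nodes are chosen so that [sinu v] takes the value k/N at [y k / v]. *)
pose y k : R := asin (2 * (k%:R / N%:R) - 1).
have yk k : (k < N.+1)%N -> -1 <= 2 * (k%:R / N%:R : R) - 1 <= 1.
  move=> kN; have : 0 <= (k%:R / N%:R : R) <= 1.
    apply/andP; split; first by apply: divr_ge0; exact: ler0n.
    by rewrite ler_pdivrMr// mul1r ler_nat -ltnS.
  by move=> /andP[h1 h2]; apply/andP; split; lra.
exists (fun x => \sum_(0 <= k < N.+1) G (y k / v) * (expR (1 * x) * bern N (sinu v x) k)).
  apply: cvgf_sum => // k; apply: cvgfZ => //.
  by apply: (tilted_cvg_bern N k (ltW v0) v8).2.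
move=> x; have /andP[u0 u1] := sinu01 v x; set u := sinu v x in u0 u1 *.
have b0 k := bern_ge0 N k u0 u1.
have -> : expR x * G x - \sum_(0 <= k < N.+1) G (y k / v) * (expR (1 * x) * bern N u k)
    = expR x * \sum_(0 <= k < N.+1) (G x - G (y k / v)) * bern N u k.
  under [in RHS]eq_bigr do rewrite mulrBl.
  rewrite sumrB -mulr_sumr bern_sum mulr1 mulrBr; congr (_ - _).
  by rewrite mulr_sumr; apply: eq_bigr => k _; rewrite mul1r; ring.
rewrite normrM (ger0_norm (expR_ge0 _)).
have E0 : 0 < expw 2^-1 2 x by exact: expw_gt0.
have [xM|Mx] := leP `|x| M.
  have h : `|\sum_(0 <= k < N.+1) (G x - G (y k / v)) * bern N u k| <= e / 2.
    rewrite (le_trans (ler_norm_sum _ _ _))//.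
    have hk k : (k < N.+1)%N -> `|(G x - G (y k / v)) * bern N u k| <=
        K / v * (ep * bern N u k + 4 * c * ((k%:R / N%:R - u) ^+ 2 * bern N u k)).
      move=> kN; rewrite normrM (ger0_norm (b0 k)).
      have yk' := yk k kN.
      have py : `|y k| <= pi / 2.
        by rewrite ler_norml asin_geNpi2//= asin_lepi2.
      have px : `|v * x| <= pi / 2.
        by rewrite normrM (gtr0_norm v0) -vM ler_wpM2l// ltW.
      have := sin_modulus ep0 px py; rewrite asinK ?in_itv//= -/c => h1.
      have -> : 4 * c * ((k%:R / N%:R - u) ^+ 2 * bern N u k) =
          c * (sin (v * x) - (2 * (k%:R / N%:R) - 1)) ^+ 2 * bern N u k.
        by rewrite /u /sinu; field; rewrite gt_eqF.
      rewrite -mulrDl [leRHS]mulrA; apply: ler_wpM2r => //.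
      apply: (le_trans (GK _ _)).
      have -> : x - y k / v = v^-1 * (v * x - y k) by field; rewrite gt_eqF.
      rewrite normrM gtr0_norm ?invr_gt0// [leLHS]mulrA.
      by apply: ler_wpM2l => //; rewrite divr_ge0// ltW.
    apply: (@le_trans _ _ (\sum_(0 <= k < N.+1)
       K / v * (ep * bern N u k + 4 * c * ((k%:R / N%:R - u) ^+ 2 * bern N u k)))).
      by apply: ler_sum_nat => k /andP[_ kN]; exact: hk.
    rewrite -mulr_sumr big_split/= -!mulr_sumr bern_sum mulr1.
    apply: le_trans Kep; apply: ler_wpM2l; first by rewrite divr_ge0// ltW.
    have bv := bern_var (ltn0Sn _) u0 u1 : _ <= (4 * N%:R)^-1.
    have := ler_wpM2l (mulr_ge0 (ler0n R 4) (ltW c0)) bv.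
    have -> : 4 * c * (4 * N%:R)^-1 = c / N%:R by field; rewrite gt_eqF.
    lra.
  have k2 : expR x <= 2 * expw 2^-1 2 x.
    have : expw 1 1 x <= 2 * expw 2^-1 2 x by apply: expw_le; lra.
    by rewrite /expw mul1r; have := expR_ge0 x; lra.
  apply: (le_trans (ler_pM (expR_ge0 _) (normr_ge0 _) k2 h)).
  by rewrite le_eqVlt; apply/orP; left; apply/eqP; field.
have h : `|\sum_(0 <= k < N.+1) (G x - G (y k / v)) * bern N u k| <= 2 * B.
  rewrite (le_trans (ler_norm_sum _ _ _))//.
  apply: (@le_trans _ _ (\sum_(0 <= k < N.+1) 2 * B * bern N u k)).
    apply: ler_sum => k _; rewrite normrM (ger0_norm (b0 k)) ler_wpM2r//.
    rewrite (le_trans (ler_normB _ _))//.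
    by have := GB x; have := GB (y k / v); lra.
  by rewrite -mulr_sumr bern_sum mulr1.
have eM : expR (- (M / 2)) * (2 * B) <= e.
  have := expR_ge1Dx (M / 2) => h1.
  rewrite expRN mulrC ler_pdivrMr ?expR_gt0//.
  have := ler_wpM2l (ltW e0) h1; apply: le_trans.
  have : e * (M / 2) = 8 * e + 2 * B by rewrite /M; field; rewrite gt_eqF.
  lra.
have k2 : expR x <= expR (- (M / 2)) * expw 2^-1 2 x.
  rewrite /expw mulrDr -!expRD; have [x0|x0] := leP 0 x.
    move: Mx; rewrite ger0_norm// => Mx.
    have : expR x <= expR (- (M / 2) + 2 * x) by rewrite ler_expR; lra.
    by have := expR_ge0 (- (M / 2) + 2^-1 * x); lra.
  move: Mx; rewrite ltr0_norm// => Mx.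
  have : expR x <= expR (- (M / 2) + 2^-1 * x) by rewrite ler_expR; lra.
  by have := expR_ge0 (- (M / 2) + 2 * x); lra.
apply: (le_trans (ler_pM (expR_ge0 _) (normr_ge0 _) k2 h)).
rewrite mulrAC ler_wpM2r ?(ltW E0)//.
Qed.

End tilted_lipschitz.

(** * From ramps to tail probabilities *)

Section tails.
Context {R : realType}.
Implicit Types a b x y : R.

Definition clamp01 x : R := Num.min 1 (Num.max 0 x).

Lemma clamp01_bounds x : 0 <= clamp01 x <= 1.
Proof. by rewrite /clamp01 ge_min lexx/= le_min ler01/= le_max lexx. Qed.

Lemma clamp01_lipschitz x y : `|clamp01 x - clamp01 y| <= `|x - y|.
Proof.
wlog xy : x y / x <= y.
  move=> H; have [xy|yx] := leP x y; first exact: H.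
  by rewrite distrC [leRHS]distrC; apply: H; exact: ltW.
rewrite distrC [leRHS]distrC (ger0_norm (_ : 0 <= y - x)) ?subr_ge0//.
have cl u : [\/ u <= 0 /\ clamp01 u = 0, (0 <= u /\ u <= 1) /\ clamp01 u = u |
    1 <= u /\ clamp01 u = 1].
  rewrite /clamp01; have [u0|u0] := leP 0 u.
    by have [u1|u1] := leP 1 u; [constructor 3|constructor 2; rewrite (ltW u1)].
  by constructor 1; rewrite (ltW u0) min_r.
by rewrite ler_norml; case: (cl x) => -[hx ->]; case: (cl y) => -[hy ->];
  apply/andP; split; lra.
Qed.

Definition ramp a b x : R := clamp01 ((x - a) / (b - a)).

Definition step a x : R := \1_(`]a, +oo[%classic) x.

Lemma stepE a x : step a x = (a < x)%R%:R.
Proof. by rewrite /step indicE mem_setE in_itv/= andbT. Qed.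

Lemma step_le_ramp a b x : a < b -> step b x <= ramp a b x.
Proof.
move=> ab; rewrite stepE; have /andP[c0 _] := clamp01_bounds ((x - a) / (b - a)).
have [bx|//] := ltP b x.
have : 1 <= (x - a) / (b - a) by rewrite ler_pdivlMr ?subr_gt0//; lra.
by rewrite /ramp /clamp01 le_min lexx/= le_max => ->; rewrite orbT.
Qed.

Lemma ramp_le_step a b x : a < b -> ramp a b x <= step a x.
Proof.
move=> ab; rewrite stepE; have /andP[_ c1] := clamp01_bounds ((x - a) / (b - a)).
have [//|xa] := ltP a x.
have : (x - a) / (b - a) <= 0 by rewrite ler_pdivrMr ?subr_gt0//; lra.
by rewrite /ramp /clamp01 ge_min ge_max lexx/= => ->; rewrite orbT.
Qed.

Lemma measurable_clamp01 : measurable_fun setT clamp01.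
Proof.
by apply: measurable_minr => //; exact: measurable_maxr.
Qed.

Lemma expR_max_lipschitz a x y :
  `|expR (- Num.max x a) - expR (- Num.max y a)| <= expR (- a) * `|x - y|.
Proof.
have key s t : a <= s -> s <= t -> `|expR (- s) - expR (- t)| <= expR (- a) * (t - s).
  move=> as_ st; rewrite ger0_norm ?subr_ge0 ?ler_expR; last lra.
  have -> : expR (- s) - expR (- t) = expR (- s) * (1 - expR (- (t - s))).
    by rewrite mulrBr mulr1 -expRD; congr (_ - expR _); ring.
  apply: ler_pM; rewrite ?expR_ge0//.
  - by rewrite subr_ge0 -[leRHS]expR0 ler_expR; lra.
  - by rewrite ler_expR; lra.
  - by have := expR_ge1Dx (- (t - s)); lra.
wlog xy : x y / x <= y.
  move=> H; have [xy|yx] := leP x y; first exact: H.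
  by rewrite distrC [`|x - y|]distrC; apply: H; exact: ltW.
apply: (@le_trans _ _ (expR (- a) * (Num.max y a - Num.max x a))).
  apply: key; first by rewrite le_max lexx orbT.
  by rewrite ge_max !le_max xy lexx orbT.
apply: ler_wpM2l; first exact: expR_ge0.
rewrite distrC ger0_norm ?subr_ge0//.
by case: (leP x a) => h1; case: (leP y a) => h2; lra.
Qed.

Variables (L : nat -> (R -> R) -> R) (L0 : (R -> R) -> R).
Hypothesis functionalL : forall n, is_functional (L n).
Hypothesis functionalL0 : is_functional L0.
Hypothesis cvg_expR : forall s, 0 < s ->
  L n (fun x => expR (s * x)) @[n --> \oo] --> L0 (fun x => expR (s * x)).

(** Undoing the tilt by e^(-x) would give a function unbounded on the left. The ramp vanishes up to
    [a], so the exponent may be cut there, which makes G bounded and Lipschitz. *)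
Lemma cvgf_ramp a b : a < b -> cvgf L L0 (ramp a b).
Proof.
move=> ab; pose G x := expR (- Num.max x a) * ramp a b x.
have ba : 0 < b - a by rewrite subr_gt0.
have rG x : expR x * G x = ramp a b x.
  have [xa|ax] := leP a x; first by rewrite /G (max_idPl xa) mulrA -expRD subrr expR0 mul1r.
  have -> : G x = 0.
    have := ramp_le_step x ab; rewrite stepE ltNge (ltW ax)/= => h.
    have /andP[c0 _] := clamp01_bounds ((x - a) / (b - a)).
    by rewrite /G (_ : ramp a b x = 0) ?mulr0//; apply/eqP; rewrite eq_le h.
  have := ramp_le_step x ab; rewrite stepE ltNge (ltW ax)/= => h.
  have /andP[c0 _] := clamp01_bounds ((x - a) / (b - a)).
  by rewrite mulr0; apply/eqP; rewrite eq_le h c0.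
have -> : ramp a b = fun x => expR x * G x by apply/funext => x; rewrite rG.
have Ea x : expR (- Num.max x a) <= expR (- a).
  by rewrite ler_expR lerN2 le_max lexx orbT.
apply: (@cvgf_lipschitz _ _ _ functionalL functionalL0 cvg_expR G (expR (- a))
  (expR (- a) * (b - a)^-1 + expR (- a))).
- exact: expR_ge0.
- by rewrite addr_ge0 ?mulr_ge0 ?expR_ge0// invr_ge0 ltW.
- apply: measurable_funM.
    apply: (measurableT_comp (@measurable_expR R)); apply: measurable_funN.
    exact: measurable_maxr.
  apply: (measurableT_comp measurable_clamp01).
  by apply: measurable_funM => //; exact: measurable_funB.
- move=> x; have /andP[c0 c1] := clamp01_bounds ((x - a) / (b - a)).
  rewrite normrM !ger0_norm ?expR_ge0//.
  by rewrite -[leRHS]mulr1 ler_pM ?expR_ge0.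
move=> x y; have /andP[c0 c1] := clamp01_bounds ((y - a) / (b - a)).
have -> : G x - G y = expR (- Num.max x a) * (ramp a b x - ramp a b y) +
   (expR (- Num.max x a) - expR (- Num.max y a)) * ramp a b y by rewrite /G; ring.
rewrite (le_trans (ler_normD _ _))// [leRHS]mulrDl; apply: lerD; rewrite normrM.
  rewrite (ger0_norm (expR_ge0 _)) -mulrA; apply: ler_pM; rewrite ?expR_ge0//.
  apply: (le_trans (clamp01_lipschitz _ _)).
  have -> : (x - a) / (b - a) - (y - a) / (b - a) = (b - a)^-1 * (x - y) by ring.
  by rewrite normrM gtr0_norm ?invr_gt0.
rewrite (ger0_norm c0) (le_trans _ (expR_max_lipschitz a x y))//.
by rewrite ler_piMr.
Qed.

Lemma step_dominated a : exp_dominated (step a).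
Proof.
split; first exact: measurable_indic.
exists (expR (- a)), 1, 1; split=> // x; rewrite stepE.
rewrite ger0_norm// /expw mul1r mulrDr -expRD.
have [ax|_] := ltP a x; last by rewrite addr_ge0// ?mulr_ge0 ?expR_ge0.
have : 1 <= expR (- a + x) by rewrite -[leLHS]expR0 ler_expR; lra.
by rewrite /= mulr1n; have := expR_ge0 (- a + x); lra.
Qed.

Hypothesis lipL0 : exists2 K, 0 < K & forall a b, a < b ->
  L0 (step a) - L0 (step b) <= K * (b - a).

(** The ramps over [a - d, a] and [a, a + d] enclose the step at [a]; in the limit they differ from
    it by at most K d, because the limit has a Lipschitz tail. *)
Lemma cvg_step a : L n (step a) @[n --> \oo] --> L0 (step a).
Proof.
have [K K0 lip] := lipL0.
apply/cvgrPdist_le => e e0.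
have [d d0 Kd] : exists2 d : R, 0 < d & K * d = e / 2.
  exists (e / (2 * K)); first by rewrite divr_gt0// mulr_gt0.
  by field; rewrite gt_eqF.
have ad : a < a + d by lra.
have da : a - d < a by lra.
have [dr cr] := cvgf_ramp ad; have [dl cl] := cvgf_ramp da.
have l1 := lip _ _ ad; have l2 := lip _ _ da.
have e2 : 0 < e / 2 by lra.
move/cvgrPdist_le : cr => /(_ _ e2) cr; move/cvgrPdist_le : cl => /(_ _ e2) cl.
have m1 : L0 (step (a + d)) <= L0 (ramp a (a + d)).
  apply: (functional_le functionalL0) => //; first exact: step_dominated.
  by move=> x; exact: step_le_ramp.
have m2 : L0 (ramp (a - d) a) <= L0 (step (a - d)).
  apply: (functional_le functionalL0) => //; first exact: step_dominated.
  by move=> x; exact: ramp_le_step.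
near=> n.
have m3 : L n (ramp a (a + d)) <= L n (step a).
  apply: (functional_le (functionalL n)) => //; first exact: step_dominated.
  by move=> x; exact: ramp_le_step.
have m4 : L n (step a) <= L n (ramp (a - d) a).
  apply: (functional_le (functionalL n)) => //; first exact: step_dominated.
  by move=> x; exact: step_le_ramp.
have : `|L0 (ramp a (a + d)) - L n (ramp a (a + d))| <= e / 2 by near: n.
have : `|L0 (ramp (a - d) a) - L n (ramp (a - d) a)| <= e / 2 by near: n.
have d1 : a + d - a = d by ring.
have d2 : a - (a - d) = d by ring.
rewrite d1 Kd in l1; rewrite d2 Kd in l2.
by rewrite !ler_norml => /andP[? ?] /andP[? ?]; apply/andP; split; lra.
Unshelve. all: by end_near. Qed.

End tails.

(** * Exponential moments on an event and convergence of distribution functions *)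

Section restricted_law.
Context {R : realType} d (T : measurableType d) (P : probability T R).
Variables (E : set T) (X : T -> R).
Hypothesis measurableE : measurable E.
Hypothesis measurableX : measurable_fun setT X.
Hypothesis integrableX : forall s, 0 < s ->
  P.-integrable E (fun t => (expR (s * X t))%:E).

Definition law (f : R -> R) : R := \int[P]_(t in E) f (X t).

Lemma exp_dominated_integrable f : exp_dominated f ->
  P.-integrable E (EFin \o (fun t => f (X t))).
Proof.
move=> hf; have [C [a [b [C0 a0 b0 h]]]] := exp_dominatedP hf.
have iW : P.-integrable E
    (fun t => (C%:E * ((expR (a * X t))%:E + (expR (b * X t))%:E))%E).
  by apply: integrableZl => //; apply: integrableD => //; exact: integrableX.
apply: (le_integrable measurableE _ _ iW).
  apply/measurable_EFinP; apply: measurable_funTS.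
  by apply: measurableT_comp => //; exact: hf.1.
move=> t _; rewrite -EFinD -EFinM /= lee_fin [leRHS]ger0_norm; first exact: h.
by rewrite mulr_ge0// ltW// expw_gt0.
Qed.

Lemma law_functional : is_functional law.
Proof.
split.
- by move=> f g hf hg; rewrite /law RintegralD//; exact: exp_dominated_integrable.
- by move=> c f hf; rewrite /law RintegralZl//; exact: exp_dominated_integrable.
- move=> f g hf hg fg; rewrite /law le_Rintegral//;
    by [exact: exp_dominated_integrable|move=> t _; exact: fg].
Qed.

Lemma law_step a : law (step a) = fine (P (E `&` [set t | a < X t])).
Proof.
rewrite /law /Rintegral; congr fine.
rewrite (eq_integral (fun t => (\1_[set t | a < X t] t)%:E)); last first.
  by move=> t _; rewrite stepE indicE mem_setE.
rewrite integral_indic// 1?setIC//.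
rewrite (_ : [set t | _] = X @^-1` `]a, +oo[%classic).
  by rewrite -[X in measurable X]setTI; exact: measurableX.
by apply/seteqP; split => t /=; rewrite in_itv/= andbT.
Qed.

End restricted_law.

Section gaussian_law.
Context {R : realType}.
Let gauss : probability (measurableTypeR R) R := normal_prob 0 1.
Definition gaussL (f : R -> R) : R := law gauss setT id f.

Lemma gauss_exp_integrable (s : R) :
  gauss.-integrable setT (fun x => (expR (s * x))%:E).
Proof.
apply/integrableP; split; first by apply/measurable_EFinP; exact: measurable_expRM.
under eq_integral do rewrite gee0_abs ?lee_fin ?expR_ge0//.
by rewrite mgf_normal_prob ltry.
Qed.

Lemma gaussL_functional : is_functional gaussL.
Proof.
by apply: law_functional => // s s0; exact: gauss_exp_integrable.
Qed.

Lemma gaussL_expR (s : R) : gaussL (fun x => expR (s * x)) = expR (s ^+ 2 / 2).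
Proof. by rewrite /gaussL /law /Rintegral mgf_normal_prob. Qed.

Lemma gaussL_step (a : R) : gaussL (step a) = fine (gauss `]a, +oo[%classic).
Proof.
rewrite /gaussL law_step// setTI; congr (fine (gauss _)).
by apply/seteqP; split => t /=; rewrite in_itv/= andbT.
Qed.

Lemma gaussL_lipschitz : exists2 K : R, 0 < K & forall a b, a < b ->
  gaussL (step a) - gaussL (step b) <= K * (b - a).
Proof.
exists (normal_peak 1) => [|a b ab]; first by apply: normal_peak_gt0; exact: oner_neq0.
rewrite !gaussL_step.
have mitv (i : interval R) : measurable [set` i] by exact: measurable_itv.
have fn (i : interval R) : gauss [set` i] \is a fin_num by exact: fin_num_measure.
have -> : `]a, +oo[%classic = `]a, b]%classic `|` `]b, +oo[%classic :> set R.
  by rewrite -itv_bndbnd_setU// bnd_simp ?ltW.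
rewrite measureU//; last first.
  by apply/seteqP; split => x //= []; rewrite !in_itv/= andbT => /andP[_ /le_lt_trans h] /h; rewrite ltxx.
rewrite fineD; [|exact: fn|exact: fn].
rewrite addrK -lee_fin fineK; last exact: fn.
apply: (@le_trans _ _ (\int[lebesgue_measure]_(x in `]a, b]) (normal_peak 1)%:E)%E).
  apply: ge0_le_integral => //=.
  - by move=> x _; rewrite lee_fin normal_pdf_ge0.
  - by apply/measurable_EFinP; apply: measurable_funTS; exact: measurable_normal_pdf.
  - by move=> x _; rewrite lee_fin normal_pdf_ub// oner_neq0.
by rewrite integral_cst//= lebesgue_measure_itv/= lte_fin ab -EFinD -EFinM.
Qed.

Lemma gauss_tail_to1 : fine (gauss `](- n%:R), +oo[%classic) @[n --> \oo] --> (1 : R).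
Proof.
pose F (n : nat) : set R := `](- n%:R), +oo[%classic.
have mF n : measurable (F n) by exact: measurable_itv.
have UF : \bigcup_n F n = setT.
  apply/seteqP; split=> // x _; exists (Num.truncn `|x|).+1 => //.
  rewrite /F /= in_itv/= andbT.
  have /andP[_] := truncn_itv (normr_ge0 x).
  by have := ler_norm (- x); rewrite normrN; lra.
have := @nondecreasing_cvg_mu _ _ _ gauss F mF.
rewrite UF => /(_ measurableT) H.
have : gauss (F n) @[n --> \oo] --> 1%E.
  rewrite -(@probability_setT _ _ _ gauss); apply: H => m n mn.
  apply/subsetPset => x; rewrite /F /= !in_itv/= !andbT; apply: le_lt_trans.
  by rewrite lerN2 ler_nat.
by move/fine_cvg.
Qed.

End gaussian_law.

Section gaussian_limit.
Context {R : realType} d (T : measurableType d) (P : probability T R).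
Variables (E : nat -> set T) (X : nat -> T -> R).
Hypothesis measurableE : forall n, measurable (E n).
Hypothesis measurableX : forall n, measurable_fun setT (X n).
Hypothesis integrableX : forall n s, 0 < s ->
  P.-integrable (E n) (fun t => (expR (s * X n t))%:E).
Hypothesis mgf_cvg : forall s, 0 < s ->
  \int[P]_(t in E n) expR (s * X n t) @[n --> \oo] --> expR (s ^+ 2 / 2).

Lemma tail_cvg a : fine (P (E n `&` [set t | a < X n t])) @[n --> \oo] -->
  fine (normal_prob 0 1 `]a, +oo[%classic).
Proof.
rewrite -gaussL_step.
under eq_fun do rewrite -law_step//.
apply: (cvg_step (L := fun n => law P (E n) (X n))).
- by move=> n; apply: law_functional => // s s0; exact: integrableX.
- exact: gaussL_functional.
- by move=> s s0; rewrite gaussL_expR; exact: mgf_cvg.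
- exact: gaussL_lipschitz.
Qed.

Lemma measurable_upper n a : measurable [set t | a < X n t].
Proof.
rewrite (_ : [set t | _] = X n @^-1` `]a, +oo[%classic).
  by rewrite -[X in measurable X]setTI; exact: measurableX.
by apply/seteqP; split => t /=; rewrite in_itv/= andbT.
Qed.

(** P(E n) is at least the probability of E n with X n > -m, whose limit is a Gaussian tail as close
    to 1 as desired. *)
Lemma support_prob_cvg : fine (P (E n)) @[n --> \oo] --> (1 : R).
Proof.
apply/cvgrPdist_le => e e0.
have e2 : 0 < e / 2 by lra.
have /cvgrPdist_le/(_ _ e2)[m _ hm] := @gauss_tail_to1 R.
have := hm m (leqnn m) => /=; rewrite ler_norml => /andP[_ h1].
move/cvgrPdist_le : (@tail_cvg (- m%:R)) => /(_ _ e2).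
apply: filterS => n; rewrite ler_norml => /andP[_ h2].
have fE : P (E n) \is a fin_num by exact: fin_num_measure.
have h3 : fine (P (E n)) <= 1 by rewrite -lee_fin fineK// probability_le1.
have h4 : fine (P (E n `&` [set t | - m%:R < X n t])) <= fine (P (E n)).
  apply: fine_le => //; first by apply: fin_num_measure; apply: measurableI => //; exact: measurable_upper.
  by apply: le_measure; rewrite ?inE//; apply: measurableI => //; exact: measurable_upper.
by rewrite ler_norml; apply/andP; split; lra.
Qed.

Lemma upper_prob_cvg a : fine (P [set t | a < X n t]) @[n --> \oo] -->
  fine (normal_prob 0 1 `]a, +oo[%classic).
Proof.
have mU n := measurable_upper n a.
have mI n : measurable (E n `&` [set t | a < X n t]) by exact: measurableI.
have fn (A : set T) : measurable A -> P A \is a fin_num by exact: fin_num_measure.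
apply: (@squeeze_cvgr _ _ _ _ (fun n => fine (P (E n `&` [set t | a < X n t])))
  (fun n => fine (P (E n `&` [set t | a < X n t])) + (1 - fine (P (E n))))).
- near=> n; apply/andP; split.
    apply: fine_le; [exact: fn|exact: fn|].
    by apply: le_measure; rewrite ?inE.
  have mC : measurable (~` E n) by exact: measurableC.
  rewrite -lee_fin EFinD EFinB !fineK ?fn//.
  rewrite -(probability_setC _ (measurableE n)) -measureU//; last first.
    by apply/seteqP; split => t //= [[]].
  apply: le_measure; rewrite ?inE//; first exact: measurableU.
  by move=> t /= h; have [Et|Et] := pselect (E n t); [left|right].
- exact: tail_cvg.
- rewrite -[X in _ --> X]addr0; apply: cvgD; first exact: tail_cvg.
  rewrite -(subrr 1); apply: cvgB; [exact: cvg_cst|exact: support_prob_cvg].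
Unshelve. all: by end_near. Qed.

Lemma cdf_cvg a : P [set t | X n t <= a] @[n --> \oo] --> normal_prob 0 1 `]-oo, a].
Proof.
have mU n := measurable_upper n a.
have cP n : P [set t | X n t <= a] = (1 - fine (P [set t | a < X n t]))%:E.
  rewrite (_ : [set t | X n t <= a] = ~` [set t | a < X n t]); last first.
    by apply/seteqP; split => t /=; [move=> h /(le_lt_trans h); rewrite ltxx|move/negP; rewrite -leNgt].
  by rewrite probability_setC// EFinB fineK ?fin_num_measure.
pose gauss : probability (measurableTypeR R) R := normal_prob 0 1.
have mG : measurable (`]a, +oo[%classic : set R) by exact: measurable_itv.
have cG : normal_prob 0 1 `]-oo, a] = (1 - fine (normal_prob 0 1 `]a, +oo[%classic))%:E.
  rewrite (_ : `]-oo, a]%classic = ~` `]a, +oo[%classic); last first.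
    by rewrite setCitvr.
  by rewrite (probability_setC gauss mG) EFinB fineK// (@fin_num_measure _ _ _ gauss).
under eq_fun do rewrite cP; rewrite cG.
apply: cvg_EFin; first exact: nearW.
by apply: cvgB; [exact: cvg_cst|exact: upper_prob_cvg].
Qed.

End gaussian_limit.

(** * The likelihood ratio *)

Section likelihood_ratio.
Context {R : realType} (n p : nat) d (T : measurableType d) (P : probability T R).
Local Notation I := ('I_n * 'I_p)%type.
Local Notation coords := (@coords R I).
Variable X : I -> {RV P >-> R}.
Hypothesis indepX : mutually_independent P (fun i => (X i : T -> R)).
Hypothesis normalX : forall i, std_normal P (X i).
Hypothesis np : (1 + p < n)%N.
Implicit Types y : coords.

Let n0 : 0 < n%:R :> R.
Proof. by rewrite ltr0n (leq_trans _ np). Qed.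

Definition LR y : R := Lambda (fun i j => y (i, j)).

Lemma trace_mean_sumsq y :
  \tr (Amat (fun i j => y (i, j))) + n%:R * \sum_(j < p) xbar (fun i j => y (i, j)) j ^+ 2
  = sumsq y.
Proof.
have -> : sumsq y = \sum_(j < p) \sum_(i < n) y (i, j) ^+ 2.
  by rewrite exchange_big /sumsq pair_big/=; apply: eq_bigr => -[].
rewrite /mxtrace mulr_sumr -big_split/=; apply: eq_bigr => j _.
rewrite mxE; set m := xbar _ j.
have sm : \sum_(i < n) y (i, j) = n%:R * m by rewrite /m /xbar mulrA divff ?mul1r// gt_eqF.
rewrite (eq_bigr (fun i => y (i, j) ^+ 2 - (2 * m) * y (i, j) + m ^+ 2)); last first.
  by move=> i _; ring.
rewrite big_split/= sumrB sumr_const card_ord -mulr_sumr sm.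
by rewrite -[m ^+ 2 *+ n]mulr_natl; ring.
Qed.

Let K : R := (expR 1 / n%:R) `^ (n%:R * p%:R / 2).

Let K0 : 0 < K.
Proof. by rewrite powR_gt0// divr_gt0// expR_gt0. Qed.

Lemma LR_gdet y : LR y = K * (gdet y `^ (n%:R / 2) * weight 1 y).
Proof.
rewrite /LR /Lambda -/K Amat_lead -/(gminor (centered y) p) -/(gdet y) -!mulrA.
congr (_ * (_ * _)); rewrite -expRD /weight -trace_mean_sumsq Amat_lead.
by congr expR; ring.
Qed.

Lemma ln_LR y : 0 < gdet y ->
  ln (LR y) = n%:R * p%:R / 2 * (1 - ln n%:R) + n%:R / 2 * ln (gdet y) - sumsq y / 2.
Proof.
move=> g0; have pg : 0 < gdet y `^ (n%:R / 2) by rewrite powR_gt0.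
have wg := weight_gt0 1 y.
rewrite LR_gdet lnM ?posrE ?mulr_gt0// lnM ?posrE// !ln_powR ln_div ?posrE ?expR_gt0//.
by rewrite !expRK; ring.
Qed.

Definition lrt_stat y : R := (ln (LR y) - mu_n n p) / (n%:R * Num.sqrt (sigma2_n n p)).

Hypothesis sigma0 : 0 < sigma2_n n p :> R.
Variable s : R.
Hypothesis s0 : 0 < s.
Let sg : R := Num.sqrt (sigma2_n n p).
Let sg0 : 0 < sg. Proof. by rewrite sqrtr_gt0. Qed.
Let h : R := s / (2 * sg).
Let t : R := 2 * h / n%:R.
Let h0 : 0 < h. Proof. by rewrite divr_gt0// mulr_gt0. Qed.
Let t0 : 0 < t. Proof. by rewrite divr_gt0// mulr_gt0. Qed.
Let C : R := - t * mu_n n p + h * p%:R * (1 - ln n%:R).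

(** Here t = s/(n sigma), so s times the statistic is t (ln Lambda - mu), with all that does not
    depend on the data in [C]. At D = 0 the ratio vanishes and its logarithm is only a default
    value. *)
Lemma lrt_tilt y : 0 < gdet y ->
  expR (s * lrt_stat y) = expR C * (gdet y `^ h * weight t y).
Proof.
move=> g0; rewrite /lrt_stat ln_LR// -/sg.
have -> : gdet y `^ h = expR (h * ln (gdet y)) by rewrite /powR gt_eqF.
rewrite /weight -!expRD; congr expR.
by rewrite /C /t /h; field; rewrite !gt_eqF.
Qed.

Definition nondegenerate : set T := [set x | 0 < gdet (sample X x)].

Lemma measurable_nondegenerate : measurable nondegenerate.
Proof.
have m : measurable_fun setT (fun x => gdet (sample X x)).
  apply: (measurableT_comp (f := fun y : coords => gdet y)); last exact: measurable_sample.
  exact: (tame_meas (tame_gminor _ _ p)).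
rewrite (_ : nondegenerate = (fun x => gdet (sample X x)) @^-1` `]0, +oo[%classic).
  by rewrite -[X in measurable X]setTI; exact: m.
by apply/seteqP; split => x; rewrite /nondegenerate/= in_itv/= andbT.
Qed.

Lemma measurable_lrt_stat : measurable_fun setT (fun x => lrt_stat (sample X x)).
Proof.
apply: measurable_funM => //; apply: measurable_funB => //.
apply: (measurableT_comp (@measurable_ln R)).
apply: (measurableT_comp (f := fun y : coords => LR y)); last exact: measurable_sample.
rewrite (_ : (fun y => LR y) = fun y => K * (gdet y `^ (n%:R / 2) * weight 1 y)).
  apply: measurable_funM => //; apply: measurable_funM; last exact: measurable_weight.
  exact: measurable_gdet_powR.
by apply/funext => y; exact: LR_gdet.
Qed.

Let F y := expR C * (gdet y `^ h * weight t y).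

Let bF : bounded_meas F.
Proof. by apply: bounded_measZ; exact: (bounded_moment _ _ t0 (ltW h0)). Qed.

Lemma lrt_integrable :
  P.-integrable nondegenerate (fun x => (expR (s * lrt_stat (sample X x)))%:E).
Proof.
have := bounded_meas_integrable X bF.
move/(integrableS measurableT measurable_nondegenerate (@subsetT _ _)).
apply: eq_integrable; first exact: measurable_nondegenerate.
by move=> x; rewrite inE => gx; rewrite lrt_tilt.
Qed.

(** Off the event D > 0 the power D^h is 0, because h > 0; restricting the integral therefore loses
    nothing of the moment. *)
Lemma lrt_mgf : \int[P]_(x in nondegenerate) expR (s * lrt_stat (sample X x)) =
  expR C * detmoment X t h.
Proof.
transitivity (\int[P]_(x in nondegenerate) F (sample X x)).
  by apply: eq_Rintegral => x; rewrite inE => gx; rewrite lrt_tilt.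
rewrite Rintegral_mkcond /detmoment -expectZ /expect; last first.
  exact: (bounded_moment _ _ t0 (ltW h0)).
apply: eq_Rintegral => x _; rewrite patchE; case: ifPn => // /negP; rewrite inE => gx.
have -> : gdet (sample X x) = 0.
  by apply/eqP; rewrite eq_le (gminor_ge0 (centered _)) andbT leNgt; apply/negP.
by rewrite powR0 ?gt_eqF// mul0r mulr0.
Qed.

Variable H : R.
Hypothesis hH : h <= H.
Hypothesis hn : 2 * h <= n%:R.

Lemma lrt_mgf_estimate : exists2 D : R, `|D| <= asym_const H * (h / (n%:R - 1 - p%:R)) &
  \int[P]_(x in nondegenerate) expR (s * lrt_stat (sample X x)) = expR (s ^+ 2 / 2 + D).
Proof.
(* Halving the degrees of freedom writes each factor of [momratio] as c (a_k + x), the form expected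
   by the abstract bound. *)
pose a (k : 'I_p) : R := (n%:R - 1 - k%:R) / 2.
pose c := 2 / (1 + t).
have t1 : 0 < 1 + t by rewrite addr_gt0.
(* The assumption n > 1 + p gives n - 1 - k >= 2 for every k < p. *)
have a1 k : 1 <= a k.
  have : (k.+2 < n)%N by rewrite (leq_trans _ np)// ltnS add1n ltnS ltn_ord.
  rewrite -(ler_nat R) /a -addn3 natrD => ?; lra.
have c0 : 0 < c by rewrite divr_gt0.
have rE x : momratio n p t x = \prod_(k < p) (c * (a k + x)).
  by apply: eq_bigr => k _; rewrite /c /a; field; rewrite gt_eqF.
have P0 : 0 < detmoment X t 0.
  by rewrite (detmoment0 indepX normalX t0) exprn_gt0// invr_gt0 sqrtr_gt0.
have PS x : 0 <= x -> detmoment X t (x + 1) = \prod_(k < p) (c * (a k + x)) * detmoment X t x.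
  by move=> x0; rewrite -rE; exact: (detmomentS indepX normalX np t0).
have Ple b x : 0 <= b -> 0 < x ->
    detmoment X t (b + x) <= (\prod_(k < p) (c * (a k + (b + x)))) `^ x * detmoment X t b.
  by move=> b0 x0; rewrite -rE; exact: (detmoment_le indepX normalX np t0).
have Pge b x : 0 <= b -> 0 < x ->
    (\prod_(k < p) (c * (a k + b))) `^ x * detmoment X t (b + 1) <= detmoment X t (b + 1 + x).
  by move=> b0 x0; rewrite -rE; exact: (detmoment_ge indepX normalX np t0).
have Ph := log_moment_gt0 a1 c0 P0 PS Pge h0.
have lP0 : ln (detmoment X t 0) = - (n%:R * p%:R / 2 * ln (1 + t)).
  rewrite (detmoment0 indepX normalX t0) lnXn ?invr_gt0 ?sqrtr_gt0//.
  have sq0 : 0 < Num.sqrt (1 + t) by rewrite sqrtr_gt0.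
  rewrite lnV ?posrE// -[LHS]mulr_natl natrM.
  have -> : ln (1 + t) = 2 * ln (Num.sqrt (1 + t)).
    by rewrite -[in LHS](@sqr_sqrtr _ (1 + t)) ?(ltW t1)// lnXn// mulr_natl.
  by field.
have := log_moment_bound a1 c0 P0 PS Ple Pge h0 hH; rewrite lP0 => lb.
have := log_mgf_bound np h0 hH hn lb; rewrite -/t.
set D := (X in `|X|) => hD; exists D => //.
rewrite lrt_mgf -[detmoment X t h]lnK ?posrE// -expRD; congr expR.
have -> : s ^+ 2 / 2 = 2 * h ^+ 2 * sigma2_n n p.
  have -> : sigma2_n n p = sg ^+ 2 by rewrite sqr_sqrtr// ltW.
  by rewrite /h; field; rewrite gt_eqF.
by rewrite /D /C; ring.
Qed.

End likelihood_ratio.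

(** * Size of the variance and passage to the limit *)

Section variance_bounds.
Context {R : realType} (n p : nat).
Hypothesis np : (1 + p < n)%N.
Let N : R := n%:R - 1.
Let q : R := n%:R - 1 - p%:R.

Let q1 : 1 <= q.
Proof. by have := np; rewrite -(ler_nat R) -addnS add1n -addn2 !natrD /q; lra. Qed.

Let N0 : 0 < N.
Proof. by have := q1; rewrite /q /N; have := ler0n R p; lra. Qed.

Let zE : 1 - p%:R / N = q / N.
Proof. by rewrite (_ : q = N - p%:R)//; field; rewrite gt_eqF. Qed.

(* ln (1 - z) = 2 ln r <= 2 (r - 1) with r = sqrt (1 - z), and
   z + 2 (r - 1) = - (1 - r)^2 = - (z / (1 + r))^2. *)
Lemma sigma2_ge_sqr : (p%:R / N) ^+ 2 / 8 <= sigma2_n n p :> R.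
Proof.
rewrite /sigma2_n -/N; set z := p%:R / N.
have z1 : 0 < 1 - z by rewrite zE divr_gt0//; have := q1; lra.
have z0 : 0 <= z by rewrite divr_ge0// ltW.
pose r := Num.sqrt (1 - z).
have r0 : 0 < r by rewrite sqrtr_gt0.
have r2 : r ^+ 2 = 1 - z by rewrite sqr_sqrtr// ltW.
have r1 : r <= 1 by rewrite -[leRHS]sqrtr1 ler_wsqrtr//; lra.
have -> : ln (1 - z) = 2 * ln r by rewrite -r2 lnXn// mulr_natl.
have : ln r <= r - 1 by have := @le_ln1Dx _ (r - 1) ltac:(lra); rewrite addrC subrK.
have zr : z = (1 - r) * (1 + r) by have := r2; rewrite expr2; lra.
have : z ^+ 2 / 4 <= (1 - r) ^+ 2.
  rewrite zr exprMn -mulrA ler_piMr ?sqr_ge0//.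
  rewrite ler_pdivrMr// mul1r expr2; nra.
rewrite !expr2; nra.
Qed.

(** Useful when q stays bounded while n grows: then N/q, and with it the variance, tends to
    infinity. *)
Lemma sigma2_ge_ln : (ln (N / q) - 1) / 2 <= sigma2_n n p :> R.
Proof.
have q0 : 0 < q by have := q1; lra.
rewrite /sigma2_n -/N zE -[q / N]invf_div lnV ?posrE ?divr_gt0//.
have : p%:R / N <= 1 by rewrite ler_pdivrMr// mul1r; have := q1; rewrite /q /N; lra.
lra.
Qed.

End variance_bounds.

Section clt.
Context {R : realType} (p : nat -> nat) (y : R).
Hypothesis np : forall n, (3 <= n)%N -> (1 + p n < n)%N.
Hypothesis y0 : 0 < y.
Hypothesis cvgp : (fun n : nat => (p n)%:R / n%:R : R) @ \oo --> y.

(** Eventually p/n exceeds 9y/10, and [sigma2_ge_sqr] leaves ample room; 36 is chosen for its square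
    root. *)
Lemma sigma2_near : \forall n \near \oo, y ^+ 2 / 36 <= sigma2_n n (p n) :> R.
Proof.
have y3 : y * 9 / 10 < y by have := y0; lra.
near=> n.
have n3 : (3 <= n)%N by near: n; exact: nbhs_infty_ge.
have n0 : 3 <= n%:R :> R by rewrite ler_nat.
have h : y * 9 / 10 < (p n)%:R / n%:R by near: n; apply: (cvgr_gt _ cvgp).
have := @sigma2_ge_sqr R _ _ (np n3); apply: le_trans.
set z := _ / (_ - 1).
have hz : y * 9 / 10 <= z.
  apply: (le_trans (ltW h)); rewrite /z ler_wpM2l// lef_pV2 ?posrE; lra.
have := ler_pM (_ : 0 <= y * 9 / 10) (_ : 0 <= y * 9 / 10) hz hz.
rewrite -!expr2 => /(_ _ _) H.
have : (y * 9 / 10) ^+ 2 <= z ^+ 2 by apply: H; lra.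
have := sqr_ge0 y; rewrite !expr2; lra.
Unshelve. all: by end_near. Qed.

Lemma exponent_le (s S : R) : 0 < s -> y ^+ 2 / 36 <= S -> s / (2 * Num.sqrt S) <= 3 * s / y.
Proof.
move=> s0 Sy; have S0 : 0 < S by apply: lt_le_trans Sy; rewrite divr_gt0// exprn_gt0.
have sg0 : 0 < Num.sqrt S by rewrite sqrtr_gt0.
have h6 : y / 6 <= Num.sqrt S.
  rewrite -(@ger0_norm _ (y / 6)) ?divr_ge0 ?(ltW y0)// -sqrtr_sqr ler_wsqrtr//.
  by rewrite exprMn exprVn (_ : 6 ^+ 2 = 36)//; ring.
rewrite ler_pdivrMr ?mulr_gt0//.
have {1}-> : s = 3 * s / y * (2 * (y / 6)) by field; rewrite gt_eqF.
have H0 : 0 <= 3 * s / y by rewrite divr_ge0 ?mulr_ge0// ltW.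
by rewrite ler_wpM2l// ler_wpM2l.
Qed.

(** Two cases for each large n. If q >= M, the bound h <= H suffices. If q < M, then (n - 1)/q is
    large, so sigma is large and h itself is at most e, while q >= 1. *)
Lemma exponent_ratio_cvg (s e : R) : 0 < s -> 0 < e ->
  \forall n \near \oo,
    s / (2 * Num.sqrt (sigma2_n n (p n))) / (n%:R - 1 - (p n)%:R) <= e.
Proof.
move=> s0 e0.
pose H := 3 * s / y; have H0 : 0 < H by rewrite divr_gt0 ?mulr_gt0.
pose M := H / e; have M0 : 0 < M by exact: divr_gt0.
(* The variance level from which on s/(2 sigma) is at most e. *)
pose B := (s / (2 * e)) ^+ 2.
near=> n.
have n3 : (3 <= n)%N by near: n; exact: nbhs_infty_ge.
have nn := np n3.
have Sy : y ^+ 2 / 36 <= sigma2_n n (p n) by near: n; exact: sigma2_near.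
have hH := exponent_le s0 Sy.
have Nbig : M * expR (2 * B + 1) <= n%:R - 1.
  by rewrite lerBrDr; near: n; exact: nbhs_infty_ger.
move: Sy hH; set S := sigma2_n n (p n); set q : R := n%:R - 1 - (p n)%:R => Sy hH.
have q1 : 1 <= q.
  by have := nn; rewrite -(ler_nat R) -addnS add1n -addn2 !natrD /q; lra.
have S0 : 0 < S by apply: lt_le_trans Sy; rewrite divr_gt0// exprn_gt0.
have sg0 : 0 < Num.sqrt S by rewrite sqrtr_gt0.
have [Mq|qM] := leP M q.
  rewrite ler_pdivrMr; last by lra.
  apply: (le_trans hH); have := ler_wpM2l (ltW e0) Mq.
  by rewrite /M mulrCA divff ?mulr1 ?gt_eqF.
have n3r : 3 <= n%:R :> R by rewrite ler_nat.
have SB : B <= S.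
  have := @sigma2_ge_ln R _ _ nn; rewrite -/q; apply: le_trans.
  suff : 2 * B + 1 <= ln ((n%:R - 1) / q) by lra.
  rewrite -[leLHS]expRK ler_ln ?posrE ?expR_gt0 ?divr_gt0//; [|lra|lra].
  rewrite ler_pdivlMr; last by lra.
  apply: le_trans Nbig; rewrite mulrC ler_wpM2r ?expR_ge0//; exact: ltW.
have h1 : s / (2 * e) <= Num.sqrt S.
  rewrite -(@ger0_norm _ (s / (2 * e))) ?divr_ge0 ?mulr_ge0 ?(ltW s0) ?(ltW e0)//.
  by rewrite -sqrtr_sqr ler_wsqrtr.
have h2 : s / (2 * Num.sqrt S) <= e.
  rewrite ler_pdivrMr ?mulr_gt0//.
  have -> : s = 2 * e * (s / (2 * e)) by field; rewrite gt_eqF.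
  by rewrite [leRHS]mulrCA [leRHS]mulrA; apply: ler_wpM2l => //; rewrite mulr_ge0// ltW.
rewrite ler_pdivrMr; last by lra.
by apply: (le_trans h2); rewrite ler_peMr// ltW.
Unshelve. all: by end_near. Qed.

Context d (T : measurableType d) (P : probability T R).
Variable X : forall n : nat, 'I_n * 'I_(p n) -> {RV P >-> R}.
Hypothesis indepX : forall n, mutually_independent P (fun i => (@X n i : T -> R)).
Hypothesis normalX : forall n (i : 'I_n * 'I_(p n)), std_normal P (@X n i).

(** Since [H] bounds h for all large n, [asym_const H] is a single constant and the error is
    governed by h/q alone. *)
Lemma lrt_mgf_cvg (s : R) : 0 < s ->
  \int[P]_(x in nondegenerate (@X n)) expR (s * lrt_stat (sample (@X n) x))
    @[n --> \oo] --> expR (s ^+ 2 / 2).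
Proof.
move=> s0; pose u n := \int[P]_(x in nondegenerate (@X n)) expR (s * lrt_stat (sample (@X n) x)).
pose H := 3 * s / y; have H0 : 0 < H by rewrite divr_gt0 ?mulr_gt0.
have key e : 0 < e -> \forall n \near \oo, exists2 D : R, `|D| <= e & u n = expR (s ^+ 2 / 2 + D).
  move=> e0.
  have K0 : 0 < asym_const H + 1.
    by rewrite /asym_const; have := sqr_ge0 H; lra.
  near=> n.
  have n3 : (3 <= n)%N by near: n; exact: nbhs_infty_ge.
  have Sy : y ^+ 2 / 36 <= sigma2_n n (p n) by near: n; exact: sigma2_near.
  have S0 : 0 < sigma2_n n (p n) :> R.
    by apply: lt_le_trans Sy; rewrite divr_gt0// exprn_gt0.
  have hH : s / (2 * Num.sqrt (sigma2_n n (p n))) <= H by exact: exponent_le.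
  have hn : 2 * (s / (2 * Num.sqrt (sigma2_n n (p n)))) <= n%:R.
    apply: (@le_trans _ _ (2 * H)); first by rewrite ler_wpM2l.
    by near: n; exact: nbhs_infty_ger.
  have [D hD uD] := lrt_mgf_estimate (@indepX n) (@normalX n) (np n3) S0 s0 hH hn.
  exists D => //; apply: (le_trans hD).
  have r : s / (2 * Num.sqrt (sigma2_n n (p n))) / (n%:R - 1 - (p n)%:R) <= e / (asym_const H + 1).
    near: n; apply: exponent_ratio_cvg => //; exact: divr_gt0.
  have q0 : 0 <= s / (2 * Num.sqrt (sigma2_n n (p n))) / (n%:R - 1 - (p n)%:R).
    have := np n3; rewrite -(ler_nat R) -addnS add1n -addn2 !natrD => ?.
    by rewrite divr_ge0 ?divr_ge0 ?(ltW s0) ?mulr_ge0 ?sqrtr_ge0//; lra.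
  have : asym_const H * (s / (2 * Num.sqrt (sigma2_n n (p n))) / (n%:R - 1 - (p n)%:R))
    <= (asym_const H + 1) * (e / (asym_const H + 1)).
    apply: ler_pM => //; last by rewrite lerDl.
    by rewrite /asym_const; have := sqr_ge0 H; lra.
  by rewrite [X in _ <= X -> _]mulrC divfK// gt_eqF.
have cln : ln (u n) @[n --> \oo] --> s ^+ 2 / 2.
  apply/cvgrPdist_le => e e0; near=> n.
  have [D hD ->] : exists2 D : R, `|D| <= e & u n = expR (s ^+ 2 / 2 + D) by near: n; exact: key.
  by rewrite expRK opprD addNKr normrN.
have : expR (ln (u n)) @[n --> \oo] --> expR (s ^+ 2 / 2).
  by apply: (continuous_cvg _ _ cln); exact: continuous_expR.
apply: cvg_trans; apply: near_eq_cvg.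
near=> n.
have [D hD uD] : exists2 D : R, `|D| <= 1 & u n = expR (s ^+ 2 / 2 + D).
  by near: n; exact: key.
by rewrite -/(u n) uD expRK.
Unshelve. all: by end_near. Qed.

End clt.

Theorem theorem5 (R : realType) (d : measure_display) (T : measurableType d)
  (P : probability T R) (p : nat -> nat) (y : R)
  (X : forall n : nat, 'I_n -> 'I_(p n) -> {RV P >-> R}) :
  (forall n : nat, (3 <= n)%N -> (1 + p n < n)%N) ->
  0 < y <= 1 ->
  (fun n : nat => (p n)%:R / n%:R : R) @ \oo --> y ->
  (forall n : nat, mutually_independent P
     (fun ij : 'I_n * 'I_(p n) => (X n ij.1 ij.2 : T -> R))) ->
  (forall n (i : 'I_n) (j : 'I_(p n)), std_normal P (X n i j)) ->
  forall x : R,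
    (fun n : nat =>
       P [set t | (ln (Lambda (fun i j => X n i j t)) - mu_n n (p n))
                    / (n%:R * Num.sqrt (sigma2_n n (p n))) <= x])
    @ \oo --> normal_prob 0 1 `]-oo, x].
Proof.
move=> np /andP[y0 _] cvgp indepX normalX x.
pose Y n (ij : 'I_n * 'I_(p n)) := X n ij.1 ij.2.
have normalY n (i : 'I_n * 'I_(p n)) : std_normal P (Y n i) by exact: normalX.
have [m _ hm] := sigma2_near np y0 cvgp.
(* [cdf_cvg] wants integrability at every index, so the indices below 3 and those where the variance
   is not yet known to be positive are shifted away. *)
pose N := maxn 3 m.
have n3 n : (3 <= n + N)%N by rewrite (leq_trans (leq_maxl 3 m))// leq_addl.
have S0 n : 0 < sigma2_n (n + N) (p (n + N)) :> R.
  apply: (@lt_le_trans _ _ (y ^+ 2 / 36)); first by rewrite divr_gt0// exprn_gt0.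
  by apply: hm => /=; rewrite (leq_trans (leq_maxr 3 m))// leq_addl.
rewrite -(cvg_shiftn N).
apply: (@cdf_cvg _ _ _ P (fun n => nondegenerate (Y (n + N)%N))
   (fun n t => lrt_stat (sample (Y (n + N)%N) t))).
- by move=> n; exact: measurable_nondegenerate.
- by move=> n; apply: measurable_lrt_stat; exact: np.
- by move=> n s s0; exact: (lrt_integrable (Y (n + N)%N) (np _ (n3 n)) (S0 n) s0).
move=> s s0.
have c := lrt_mgf_cvg np y0 cvgp indepX normalY s0.
exact: (cvg_comp (addn^~ N) _ (@cvg_addnr N) c).
Qed.
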